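(* Let $F$ be a number field with odd class number. If $L/F$ is a normal extension with Galois group $\operatorname{Gal}(L/F)\simeq \operatorname{Hol}(C_8)$, and if $L/k$ is unramified for a quadratic subextension $k/F$ of $L/F$, then $\operatorname{Gal}(L/k)\simeq \operatorname{SD}_{16}$ or $\operatorname{Gal}(L/k)\simeq \operatorname{M}_4(2)$.
   Context: $\operatorname{Hol}(C_8)\simeq C_8\rtimes\operatorname{Aut}(C_8)$ is the holomorph of the cyclic group of order $8$: $\operatorname{Hol}(C_8)=\langle a,x,y: a^8=x^2=y^2=(xy)^2=1,\ xax^{-1}=a^{-1},\ yay^{-1}=a^5\rangle$, a group of order $32$. $\operatorname{SD}_{16}=\langle\sigma,\tau:\sigma^8=\tau^2=1,\ \tau\sigma\tau=\sigma^3\rangle$ is the semi-dihedral group of order $16$ and $\operatorname{M}_4(2)=\langle\sigma,\tau:\sigma^8=\tau^2=1,\ \tau\sigma\tau=\sigma^5\rangle$ is the modular group of order $16$. ''Unramified'' means unramified at all primes, finite and infinite. *)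

(* Defs.v *)
From HB Require Import structures.
From mathcomp Require Import all_boot all_order all_algebra all_fingroup.
From mathcomp Require Import all_solvable all_field.

Set Implicit Arguments.
Unset Strict Implicit.
Unset Printing Implicit Defensive.

Section Holomorph.

Local Open Scope group_scope.

(* The semidirect product of G by Aut G. *)
Definition Hol (gT : finGroupType) (G : {group gT}) :
    {group sdprod_by [Aut G]%gact} := [set: sdprod_by [Aut G]%gact]%G.

Local Notation C8 := [set: 'Z_8]%G.

Lemma C8_mul_inj (c : 'Z_8) :
  (c * c = 1)%R -> injective (fun z : 'Z_8 => (z * c)%R).
Proof.
move=> cc; apply: (can_inj (g := fun z : 'Z_8 => (z * c)%R)) => z.
by rewrite /= -GRing.mulrA cc GRing.mulr1.
Qed.

Lemma C8_sqr7 : ((inZp 7 : 'Z_8) * inZp 7 = 1)%R.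
Proof. exact/val_inj. Qed.

Lemma C8_sqr5 : ((inZp 5 : 'Z_8) * inZp 5 = 1)%R.
Proof. exact/val_inj. Qed.

Definition C8s7 := perm (C8_mul_inj C8_sqr7).
Definition C8s5 := perm (C8_mul_inj C8_sqr5).

Lemma C8_permM_Aut c (h : (c * c = 1)%R) : perm (C8_mul_inj h) \in Aut C8.
Proof.
rewrite inE; apply/andP; split; first by apply/subsetP=> z _; rewrite inE.
apply/morphicP=> u v _ _.
by rewrite !permE /= [u * v](_ : _ = (u + v)%R) // GRing.mulrDl.
Qed.
Lemma C8s7A : C8s7 \in Aut C8. Proof. exact: C8_permM_Aut. Qed.
Lemma C8s5A : C8s5 \in Aut C8. Proof. exact: C8_permM_Aut. Qed.

Lemma C8_Aut_lin (f : {perm 'Z_8}) (n : nat) :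
  f \in Aut C8 -> (f (n%:R) = n%:R * f 1%R)%R.
Proof.
move=> Af; elim: n => [|n IH].
  by rewrite GRing.mul0r; have := morph1 (autm_morphism Af).
rewrite -[n.+1]addn1 GRing.natrD GRing.mulrDl GRing.mul1r -IH.
by have /= := morphM (autm_morphism Af) (in_setT (n%:R)%R) (in_setT 1%R).
Qed.

Lemma C8_Aut_eq (f g : {perm 'Z_8}) : f \in Aut C8 -> g \in Aut C8 ->
  f 1%R = g 1%R -> f = g.
Proof.
by move=> Af Ag e; apply/permP=> z; rewrite -[z]natr_Zp !C8_Aut_lin ?e.
Qed.

Lemma C8_Aut_cases (f : {perm 'Z_8}) : f \in Aut C8 ->
  [\/ f = 1, f = C8s7, f = C8s5 | f = C8s7 * C8s5].
Proof.
move=> Af.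
have nz : f 4%:R%R != 0%R.
  have f0 : f 0%R = 0%R by have := C8_Aut_lin 0 Af; rewrite GRing.mul0r.
  by rewrite -f0 (inj_eq perm_inj).
rewrite C8_Aut_lin // in nz.
have A75 : C8s7 * C8s5 \in Aut C8 by rewrite groupM ?C8s7A ?C8s5A.
have : [\/ f 1%R = inZp 1, f 1%R = inZp 7, f 1%R = inZp 5 | f 1%R = inZp 3].
  move: nz; case: (f 1%R) => [[|[|[|[|[|[|[|[|//]]]]]]]] i] // _;
  by [constructor 1; exact: val_inj | constructor 2; exact: val_inj |
      constructor 3; exact: val_inj | constructor 4; exact: val_inj].
have E (h : {perm 'Z_8}) :
    h \in Aut C8 -> forall c, f 1%R = c -> h 1%R = c -> f = h.
  by move=> Ah c fc hc; apply: C8_Aut_eq; rewrite ?fc ?hc.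
case=> e; [constructor 1|constructor 2|constructor 3|constructor 4];
 apply: (E _ _ _ e);
 rewrite ?group1 ?C8s7A ?C8s5A ?A75 ?permM ?perm1 ?permE //=; exact: val_inj.
Qed.

Lemma C8s7E (z : 'Z_8) : C8s7 z = z^-1.
Proof.
rewrite permE /= [z^-1](_ : _ = - z)%R // -GRing.mulrN1.
by congr (_ * _)%R; exact: val_inj.
Qed.

Lemma C8s5E (z : 'Z_8) : C8s5 z = z ^+ 5.
Proof.
rewrite permE /= [z ^+ 5](_ : _ = z *+ 5)%R // -GRing.mulr_natr.
by congr (_ * _)%R; exact: val_inj.
Qed.

Lemma C8s77 : C8s7 * C8s7 = 1.
Proof. by apply/permP=> z; rewrite permM !C8s7E perm1 invgK. Qed.
Lemma C8s55 : C8s5 * C8s5 = 1.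
Proof. by apply/permP=> z; rewrite permM !permE /= -GRing.mulrA C8_sqr5 GRing.mulr1. Qed.
Lemma C8s75 : C8s7 * C8s5 = C8s5 * C8s7.
Proof.
apply/permP=> z; rewrite !permM !permE /= -!GRing.mulrA.
by congr (_ * _)%R; exact: val_inj.
Qed.

Lemma C8s7575 : C8s7 * C8s5 * (C8s7 * C8s5) = 1.
Proof.
rewrite -{1}mulgA {1}[C8s7 * C8s5]C8s75 [C8s5 * (C8s5 * _)]mulgA.
by rewrite C8s55 mul1g C8s77.
Qed.

Lemma C8s7_neq1 : (C8s7 == 1) = false.
Proof. by apply/eqP=> /permP/(_ 1%R); rewrite perm1 permE. Qed.
Lemma C8s5_neq1 : (C8s5 == 1) = false.
Proof. by apply/eqP=> /permP/(_ 1%R); rewrite perm1 permE. Qed.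
Lemma C8s7_neq5 : (C8s7 == C8s5) = false.
Proof. by apply/eqP=> /permP/(_ 1%R); rewrite !permE. Qed.
Lemma C8s75_neq1 : (C8s7 * C8s5 == 1) = false.
Proof. by apply/eqP=> /permP/(_ 1%R); rewrite permM perm1 !permE. Qed.
Lemma C8s75_neq7 : (C8s7 * C8s5 == C8s7) = false.
Proof. by rewrite -{2}[C8s7]mulg1 (inj_eq (mulgI _)) C8s5_neq1. Qed.
Lemma C8s75_neq5 : (C8s7 * C8s5 == C8s5) = false.
Proof. by rewrite -{2}[C8s5]mul1g (inj_eq (mulIg _)) C8s7_neq1. Qed.

Lemma Hol_C8_presentation : Hol C8 \isog Grp
  (a : x : y : a ^+ 8, x ^+ 2, y ^+ 2, (x * y) ^+ 2,
     x * a * x^-1 = a^-1, y * a * y^-1 = a ^+ 5).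
Proof.
apply: intro_isoGrp => [|gT G].
  pose to := [Aut C8]%gact.
  apply/existsP.
  exists (sdpair1 to (1%R : 'Z_8), sdpair2 to C8s7, sdpair2 to C8s5).
  rewrite /= !xpair_eqE.
  have J (s : {perm 'Z_8}) z : s \in Aut C8 -> s * s = 1 ->
     sdpair2 to s * sdpair1 to z * (sdpair2 to s)^-1 = sdpair1 to (s z).
    move=> As ss.
    have sV : (sdpair2 to s)^-1 = sdpair2 to s.
      by apply/eqP; rewrite eq_invg_mul -morphM // ss morph1.
    have := @sdpair_act _ _ _ _ to z s (in_setT _) As.
    rewrite /= /conjg /autact /= apermE => ->.
    by rewrite sV mulgA.
  apply/andP; split; last first.
    rewrite !J ?C8s7A ?C8s5A ?C8s77 ?C8s55 // C8s7E C8s5E.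
    rewrite morphV ?in_setT // morphX ?in_setT //.
    rewrite -!morphX ?in_setT ?C8s7A ?C8s5A //= !expgS !expg0 !mulg1.
    rewrite -!morphM ?groupM ?C8s7A ?C8s5A //=
      C8s77 C8s55 C8s7575 ?morph1 ?eqxx ?andbT.
    apply/eqP; rewrite -[RHS](morph1 (sdpair1_morphism to)).
    by congr (sdpair1 to _); exact: val_inj.
  apply/eqP/setP=> u; rewrite !inE [u]sdpairE.
  set H := (X in _ \in X).
  apply: groupM.
    have : u.1 \in Aut C8 by case: u => -[a z] /=; rewrite inE => /andP[].
    have H7 : sdpair2 to C8s7 \in H.
      by rewrite mem_gen // inE mem_gen ?orbT // inE cycle_id orbT.
    have H5 : sdpair2 to C8s5 \in H by rewrite mem_gen // inE cycle_id orbT.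
    case/C8_Aut_cases=> ->; rewrite ?morph1 ?morphM ?C8s7A ?C8s5A //=
      ?group1 ?groupM //.
  have -> : u.2 = (1%R : 'Z_8) ^+ u.2.
    by rewrite [RHS](_ : _ = 1 *+ (u.2 : nat))%R // natr_Zp.
  rewrite morphX ?in_setT // groupX //.
  by rewrite mem_gen // inE mem_gen // inE cycle_id.
case/existsP=> -[[a x] y] /= /eqP[defG a8 xx yy xyxy xa ya].
have x2 : x * x = 1 by rewrite -xx.
have y2 : y * y = 1 by rewrite -yy.
have xV : x^-1 = x by apply/eqP; rewrite eq_invg_mul x2.
have yV : y^-1 = y by apply/eqP; rewrite eq_invg_mul y2.
have cxy : x * y = y * x.
  by rewrite -{2}xV -{2}yV -invMg; apply/eqP; rewrite eq_sym eq_invg_mul; apply/eqP.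
have o8 : #[1%R : 'Z_8] = 8 by rewrite -[RHS](@order_Zp1 7).
have fP : #[a] %| #[1%R : 'Z_8] by rewrite o8 order_dvdn a8.
have sub : C8 \subset <[1%R : 'Z_8]> by rewrite -Zp_cycle.
pose fA := restrm_morphism sub (eltm_morphism fP).
pose fB (s : {perm 'Z_8}) := if s == 1 then 1 else if s == C8s7 then x else
   if s == C8s5 then y else x * y.
have fB1 : fB 1 = 1 by rewrite /fB eqxx.
have fB7 : fB C8s7 = x by rewrite /fB C8s7_neq1 eqxx.
have fB5 : fB C8s5 = y.
  by rewrite /fB C8s5_neq1 [C8s5 == _]eq_sym C8s7_neq5 eqxx.
have fB75 : fB (C8s7 * C8s5) = x * y.
  by rewrite /fB C8s75_neq1 C8s75_neq7 C8s75_neq5.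
have e1 : C8s7 * (C8s7 * C8s5) = C8s5 by rewrite mulgA C8s77 mul1g.
have e2 : C8s5 * (C8s7 * C8s5) = C8s7 by rewrite C8s75 mulgA C8s55 mul1g.
have e3 : C8s7 * C8s5 * C8s7 = C8s5 by rewrite C8s75 -mulgA C8s77 mulg1.
have e4 : C8s7 * C8s5 * C8s5 = C8s7 by rewrite -mulgA C8s55 mulg1.
have e5 : C8s7 * C8s5 * (C8s7 * C8s5) = 1 by rewrite -mulgA e2 C8s77.
have g1 : x * (x * y) = y by rewrite mulgA x2 mul1g.
have g2 : y * (x * y) = x by rewrite cxy mulgA y2 mul1g.
have g3 : x * y * x = y by rewrite cxy -mulgA x2 mulg1.
have g4 : x * y * y = x by rewrite -mulgA y2 mulg1.
have g5 : x * y * (x * y) = 1 by rewrite -mulgA g2 x2.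
have fBM : {in Aut C8 &, {morph fB : s t / s * t}}.
  move=> s t /C8_Aut_cases hs /C8_Aut_cases ht.
  by case: hs => ->; case: ht => ->;
   rewrite ?mul1g ?mulg1 ?fB1 ?mul1g ?mulg1 ?e1 ?e2 ?e3 ?e4 ?e5
     ?C8s77 ?C8s55 -?C8s75
     ?fB1 ?fB7 ?fB5 ?fB75 ?g1 ?g2 ?g3 ?g4 ?g5 ?x2 ?y2 -?cxy.
pose mB := Morphism fBM.
have act : {in C8 & Aut C8, morph_act [Aut C8]%gact 'J fA mB}.
  move=> z s _ As /=.
  have J g s0 : (s0 = C8s7 /\ g = x) \/ (s0 = C8s5 /\ g = y) ->
      forall z, fA (s0 z) = fA z ^ g.
    have fz : forall z, fA z = a ^+ z.
      move=> w; rewrite /= /restrm -{1}[w]natr_Zp.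
      have -> : (w%:R : 'Z_8)%R = (1%R : 'Z_8) ^+ w by [].
      by rewrite eltmE.
    have xJ : a ^ x = a^-1 by rewrite conjgE xV -xa xV mulgA.
    have yJ : a ^ y = a ^+ 5 by rewrite conjgE yV -ya yV mulgA.
    case=> -[-> ->] w.
      by rewrite C8s7E morphV ?in_setT // fz conjXg xJ expgVn.
    by rewrite C8s5E morphX ?in_setT // fz conjXg yJ -!expgM mulnC.
  rewrite /autact /= apermE.
  case/C8_Aut_cases: As => ->.
  - by rewrite perm1 fB1 conjg1.
  - by rewrite fB7; apply: J; left.
  - by rewrite fB5; apply: J; right.
  - by rewrite permM fB75 conjgM -(J x C8s7) ?(J y C8s5) //; [right|left].
apply/homgP; exists (xsdprod_morphism act).
rewrite /Hol /= im_xsdprodm.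
have imA : fA @* C8 = <[a]>.
  rewrite morphim_restrm setIid /= (_ : [set: _] = <[1%R : 'Z_8]>).
    by rewrite im_eltm.
  by rewrite -Zp_cycle.
rewrite imA.
have imB : mB @* Aut C8 = <[x]> <*> <[y]>.
  apply/eqP; rewrite eqEsubset; apply/andP; split.
    apply/subsetP=> _ /morphimP[s _ As ->] /=.
    have Hx : x \in <[x]> <*> <[y]> by rewrite mem_gen // inE cycle_id.
    have Hy : y \in <[x]> <*> <[y]> by rewrite mem_gen // inE cycle_id orbT.
    by case/C8_Aut_cases: As => ->; rewrite ?fB1 ?fB7 ?fB5 ?fB75 ?group1 ?groupM.
  rewrite join_subG !cycle_subG -{1}fB7 -{1}fB5.
  by rewrite !(mem_morphim mB) ?C8s7A ?C8s5A.
rewrite imB -norm_joinEr ?joingA //.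
rewrite join_subG !cycle_subG !inE -!cycleJ !conjgE xV yV mulgA mulgA.
rewrite -{2}xV xa -{2}yV ya !cycle_subG groupV cycle_id /=.
by rewrite groupX // cycle_id.
Qed.

End Holomorph.

From mathcomp Require Import finmap boolp classical_sets cardinality.

Import GRing.Theory.

Local Open Scope classical_set_scope.
Local Open Scope ring_scope.

Section RingOfIntegers.
Variable K : fieldType.

Definition algebraic_integer : {pred K} :=
  fun x => `[< integralOver (intr : int -> K) x >].

Lemma algebraic_integer_subring : subring_closed algebraic_integer.
Proof.
split=> [|x y /asboolP Ix /asboolP Iy|x y /asboolP Ix /asboolP Iy];
  apply/asboolP.
- exact: integral1.
- exact: integral_sub.
- exact: integral_mul.
Qed.

HB.instance Definition _ :=
  GRing.isSubringClosed.Build K algebraic_integer algebraic_integer_subring.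

Record integers := Integer {
  integer_val :> K;
  integer_valP : integer_val \in algebraic_integer }.

HB.instance Definition _ := [isSub for integer_val].
HB.instance Definition _ := [Choice of integers by <:].
HB.instance Definition _ := [SubChoice_isSubComNzRing of integers by <:].

End RingOfIntegers.

Section ClassNumber.
Variable K : fieldType.
Implicit Types I J : set K.

Definition fractional_ideal I : Prop :=
  [/\ exists2 x, I x & x != 0,
      forall x y, I x -> I y -> I (x + y),
      forall (a : integers K) x, I x -> I (integer_val a * x)
    & exists2 d : K, d != 0 & forall x, I x -> d * x \in @algebraic_integer K].

(* The coset of I modulo the group of principal fractional ideals. *)
Definition ideal_class I : set (set K) :=
  [set J | exists2 c : K, c != 0 & J = [set c * x | x in I]].

Definition ideal_classes : set (set (set K)) :=
  [set ideal_class I | I in fractional_ideal].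

(* Junk value 0 if there are infinitely many classes, which does not happen
   when K is a number field. *)
Definition class_number : nat := #|` fset_set ideal_classes |%fset.

End ClassNumber.

Section IdealPowers.
Variable R : comNzRingType.
Implicit Types I J S : set R.

Definition ideal_span S : set R :=
  [set x | exists n (a s : 'I_n -> R),
     (forall i, S (s i)) /\ x = \sum_i a i * s i].

Definition ideal_mul I J : set R :=
  ideal_span [set x * y | x in I & y in J].

Definition ideal_exp I n : set R := iter n (ideal_mul I) setT.

End IdealPowers.

Section Unramified.
Variables (F : fieldType) (L : fieldExtType F) (k : {subfield L}).

(* pO_L, where p is the prime of k below P. *)
Definition prime_below_extended (P : {pred integers L}) : set (integers L) :=
  ideal_span [set x | x \in P /\ integer_val x \in k].

Definition is_ramification_index (P : {pred integers L}) (e : nat) : Prop :=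
  prime_below_extended P `<=` ideal_exp [set` P] e /\
  ~ (prime_below_extended P `<=` ideal_exp [set` P] e.+1).

(* Residue fields of number fields are finite, so that residue extensions are
   automatically separable. Every nonzero prime of k lies below some P. *)
Definition unramified_finite : Prop :=
  forall P : prime_idealr (integers L),
    (exists2 x, x \in P & x != 0) -> is_ramification_index P 1.

(* The embeddings of a number field into C have values in algebraic numbers. *)
Definition unramified_infinite : Prop :=
  forall phi : {rmorphism L -> algC},
    (forall x, x \in k -> phi x \is Num.real) -> forall x, phi x \is Num.real.

Definition unramified : Prop := unramified_finite /\ unramified_infinite.

End Unramified.

(* Main.v *)
Require Import Defs.
From HB Require Import structures.
From mathcomp Require Import finmap boolp classical_sets cardinality.
From mathcomp Require Import all_boot all_order all_algebra all_fingroup.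
From mathcomp Require Import all_solvable all_field.
From mathcomp Require Import ring zify.

(** Write G = Gal(L/F) and N = Gal(L/k), a subgroup of index two of G.

    Let tau be a nontrivial element of the inertia group in G of a prime of L,
    or the complex conjugation at an embedding of L. As L/k is unramified, no
    such tau lies in N; the square of tau lies in N and in the same inertia
    group, so it is trivial, and tau is an involution outside N. Suppose that
    the involutions outside N generate a proper subgroup of G. It is contained
    in a subgroup H of index two, because G is a 2-group, and the fixed field
    of H is then a quadratic extension of F unramified at all places, finite
    and infinite. Such an extension forces the class number of F to be even
    (class_number_even). Hence G is generated by its involutions outside N,
    and for the holomorph of C8 this leaves only the subgroups SD16 and M4(2)
    among those of index two (Hol_C8_index2).

    That an odd class number excludes an everywhere unramified quadratic
    extension K/F is seen as in Hilbert's Theorem 94. Let sigma generate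
    Gal(K/F).

    - If the class number of F is odd, then each unit eta of K with
      eta * sigma eta = 1 is of the form u / sigma u for a unit u
      (norm_one_unit_is_quotient). Indeed eta = alpha / sigma alpha by Hilbert
      90; the ideal generated by alpha is invariant under sigma, hence is the
      extension of an ideal b of F, because K/F is unramified at the finite
      primes; the square of b is generated by the norm of alpha, so
      multiplication by b is an involution on the ideal classes of F, which
      must fix a class. So b is principal, and u is alpha divided by a
      generator of b.

    - Not every unit of norm one has this form
      (norm_one_units_not_all_quotients). Otherwise u / sigma u |-> u * sigma u
      would embed the units of norm one modulo the squares of units of norm one
      into the units of F modulo squares. If F has r infinite places, the
      second group has order at most 2^r. The first has order 2^(r+1) at
      least, since no infinite place of F ramifies in K, so that the units of
      norm one have rank r, and -1 is among them.

    The last argument is carried out by counting units of bounded height, which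
    replaces Dirichlet's theorem: a power T^r of T bounds from below the number
    of units of norm one of height at most c T (many_norm1_units), while T^(r-1)
    up to a constant bounds from above the number of units of F
    (few_fixed_units). The lower bound comes from a pigeonhole construction of
    units with prescribed absolute values (unit_near).

    Unramifiedness of K/F at the finite primes enters as an equation
    1 = sum of a_i * (x_i - sigma x_i) with algebraic integers a_i and x_i. It
    is derived from the absence of inertia by conjugate_differences_generate
    and no_inertia. That an unramified prime has trivial inertia is proved in
    unramified_inertia_trivial. *)

Set Implicit Arguments.
Unset Strict Implicit.
Unset Printing Implicit Defensive.

(** * The index-two subgroups of the holomorph of C8 *)

Section HolomorphSubgroups.
Local Open Scope group_scope.

Section IndexTwo.
Variables (gT : finGroupType) (G N : {group gT}).
Hypotheses (sNG : N \subset G) (iN : #|G : N| = 2).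

(** The complement of N in G is a single coset. *)
Lemma index2_mulg g h : g \in G -> h \in G -> (g * h \in N) = ((g \in N) == (h \in N)).
Proof.
move=> Gg Gh; have [Ng|nNg] := boolP (g \in N); first by rewrite groupMl.
have [Nh|nNh] := boolP (h \in N); first by rewrite groupMr // (negPf nNg).
have : h^-1 \in N :|: N :* g.
  have -> : N :|: N :* g = G.
    apply/eqP; rewrite eqEcard subUset sNG mul_subG ?sub1set //=.
    rewrite cardsU card_rcoset -(Lagrange sNG) iN muln2 -addnn.
    suff -> : N :&: N :* g = set0 by rewrite cards0 subn0.
    apply/setP => z; rewrite !inE mem_rcoset; apply/negP => /andP[Nz].
    by rewrite groupMl // groupV (negPf nNg).
  by rewrite groupV.
rewrite inE groupV (negPf nNh) mem_rcoset /= => Nhg.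
by rewrite -groupV invMg Nhg.
Qed.

Lemma index2_sq g : g \in G -> g * g \in N.
Proof. by move=> Gg; rewrite index2_mulg // eqxx. Qed.
End IndexTwo.

Lemma card_joingr_leq (gT : finGroupType) (H K : {group gT}) :
  K \subset 'N(H) -> (#|H <*> K| <= #|H| * #|K|)%N.
Proof.
move=> nHK; rewrite norm_joinEr // dvdn_leq ?dvdn_cardMg //.
by rewrite muln_gt0 !cardG_gt0.
Qed.

Section Hol.
Variables (gT : finGroupType) (G : {group gT}) (a x y : gT).
Hypothesis defG : <[a]> <*> <[x]> <*> <[y]> = G.
Hypothesis oG : #|G| = 32.
Hypotheses (a8 : a ^+ 8 = 1) (x2 : x ^+ 2 = 1) (y2 : y ^+ 2 = 1) (xy2 : (x * y) ^+ 2 = 1).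
Hypotheses (xa : x * a * x^-1 = a^-1) (ya : y * a * y^-1 = a ^+ 5).

Let xV : x^-1 = x. Proof. by apply/eqP; rewrite eq_invg_mul -expg2 x2. Qed.
Let yV : y^-1 = y. Proof. by apply/eqP; rewrite eq_invg_mul -expg2 y2. Qed.
Let ax : a ^ x = a^-1. Proof. by rewrite conjgE xV -xa xV mulgA. Qed.
Let ay : a ^ y = a ^+ 5. Proof. by rewrite conjgE yV -ya yV mulgA. Qed.
Let cxy : commute x y.
Proof. by apply/eqP; rewrite -{2}xV -{2}yV -invMg eq_sym eq_invg_mul -expg2 xy2. Qed.
Let Ga : a \in G. Proof. by rewrite -defG !mem_gen // inE mem_gen // inE cycle_id. Qed.
Let Gx : x \in G.
Proof. by rewrite -defG mem_gen // inE mem_gen // inE cycle_id orbT. Qed.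
Let Gy : y \in G. Proof. by rewrite -defG mem_gen // inE cycle_id orbT. Qed.

Let aX i j : i = j %[mod 8] -> a ^+ i = a ^+ j.
Proof. by move=> e; rewrite -(expg_mod i a8) e expg_mod. Qed.
Let aXV : a^-1 = a ^+ 7.
Proof. by apply/eqP; rewrite eq_invg_mul -expgS a8. Qed.

Let xy_x : x ^ y = x. Proof. by rewrite conjgE cxy mulKg. Qed.
Let nyx : <[y]> \subset 'N(<[x]>). Proof. by rewrite norms_cycle xy_x cycle_id. Qed.
Let nAx i : <[x]> \subset 'N(<[a ^+ i]>).
Proof. by rewrite norms_cycle conjXg ax expgVn groupV cycle_id. Qed.
Let nAy i : <[y]> \subset 'N(<[a ^+ i]>).
Proof. by rewrite norms_cycle conjXg ay -expgM mulnC expgM mem_cycle. Qed.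

Let defG' : <[a]> * <[x]> * <[y]> = G.
Proof.
have nAxy : <[y]> \subset 'N(<[a]> <*> <[x]>) := normsY (nAy 1) nyx.
by rewrite -defG (norm_joinEr nAxy) /= (norm_joinEr (nAx 1)).
Qed.

Lemma Hol_normal_form g : g \in G ->
  exists i (j k : bool), g = a ^+ i * x ^+ j * y ^+ k.
Proof.
rewrite -defG' => /mulsgP[_ _ /mulsgP[_ _ /cycleP[i ->] /cycleP[j ->] ->] /cycleP[k ->] ->].
exists i, (odd j), (odd k).
rewrite -(expg_mod j x2) -(expg_mod k y2) !modn2 //.
Qed.

Let o2 (s : gT) : s ^+ 2 = 1 -> (#[s] <= 2)%N.
Proof. by move=> s2; rewrite dvdn_leq // order_dvdn s2. Qed.

Lemma card_join_axy i : (#|<[a ^+ i]> <*> <[x]> <*> <[y]>| <= #[a ^+ i] * 4)%N.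
Proof.
apply: leq_trans (card_joingr_leq _) _; first by rewrite normsY.
rewrite -[4]/(2 * 2)%N mulnA leq_mul ?o2 //.
by apply: leq_trans (card_joingr_leq (nAx i)) _; rewrite leq_mul ?o2.
Qed.

Lemma Hol_order_a : #[a] = 8.
Proof.
have := card_join_axy 1; rewrite expg1 defG oG => o1.
apply/eqP; rewrite eqn_leq dvdn_leq ?order_dvdn ?a8 //=.
by move: o1; rewrite -[32]/(8 * 4)%N leq_pmul2r.
Qed.

Let o_a2 : #[a ^+ 2] = 4. Proof. by rewrite orderXdiv Hol_order_a. Qed.

Lemma twisted_square s m i : s ^+ 2 = 1 -> a ^ s = a ^+ m ->
  (a ^+ i * s) * (a ^+ i * s) = a ^+ (i * m.+1).
Proof.
move=> s2 as_; have sV : s^-1 = s by apply/eqP; rewrite eq_invg_mul -expg2 s2.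
have -> : (a ^+ i * s) * (a ^+ i * s) = a ^+ i * (a ^+ i) ^ s * (s * s).
  by rewrite conjgE sV !mulgA -(mulgA _ s s) -expg2 s2 mulg1.
rewrite -expg2 s2 mulg1 conjXg as_ -expgM -expgD; congr (a ^+ _).
by rewrite mulnS [(i * m)%N]mulnC.
Qed.

Let axy : a ^ (x * y) = a ^+ 3.
Proof. by rewrite conjgM ax conjVg ay -expgVn aXV -expgM; apply: aX. Qed.

(** The elements a^i, a^i y and a^i x y with i odd have the squares a^(2i), a^(6i)
    and a^(4i), all different from 1. *)
Lemma Hol_odd_involution i (j k : bool) : odd i ->
  (a ^+ i * x ^+ j * y ^+ k) * (a ^+ i * x ^+ j * y ^+ k) = 1 -> j && ~~ k.
Proof.
have ndvd m : odd i -> a ^+ (i * m) = 1 -> ~~ (8 %| m) -> False.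
  move=> oddi /eqP; rewrite -order_dvdn Hol_order_a Gauss_dvdr; first by move=> ->.
  by rewrite -[8]/(2 ^ 3)%N coprimeXl // coprime2n.
move=> oddi; case: j; case: k => //; rewrite ?expg1 ?expg0 ?mulg1.
- by rewrite -(mulgA _ x y) (twisted_square _ xy2 axy) => /(ndvd _ oddi)[].
- by rewrite (twisted_square _ y2 ay) => /(ndvd _ oddi)[].
by rewrite -expgD addnn -muln2 => /(ndvd _ oddi)[].
Qed.

Variable N : {group gT}.
Hypotheses (sNG : N \subset G) (iN : #|G : N| = 2).
Hypothesis genG : G \subset <<[set g in G | (g \notin N) && (g * g == 1)]>>.

Let N_mul g h : g \in G -> h \in G -> (g * h \in N) = ((g \in N) == (h \in N)).
Proof. exact: index2_mulg sNG iN g h. Qed.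

Let oN : #|N| = 16.
Proof. by have := Lagrange sNG; rewrite iN oG muln2 -[32]/(16.*2) => /double_inj. Qed.

Let NX g i : g \in G -> (g ^+ i \in N) = ~~ odd i || (g \in N).
Proof.
move=> Gg; elim: i => [|i IHi]; first by rewrite group1.
by rewrite expgS (N_mul Gg (groupX i Gg)) IHi /=; case: (g \in N); case: (odd i).
Qed.

(** If a and x were on the same side of N, then the involutions outside N would
    have an even exponent of a in their normal form, hence would lie in the
    subgroup generated by a^2, x and y, of order 16. *)
Lemma Hol_ax_out : (a \in N) != (x \in N).
Proof.
apply/negP => /eqP Eax.
have sT : [set g in G | (g \notin N) && (g * g == 1)] \subset <[a ^+ 2]> <*> <[x]> <*> <[y]>.
  apply/subsetP => g; rewrite !inE => /and3P[Gg nNg /eqP g2].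
  have [i [j [k Dg]]] := Hol_normal_form Gg.
  have [oddi|eveni] := boolP (odd i).
    rewrite Dg in g2; have /andP[j1 /negPf k0] := Hol_odd_involution oddi g2.
    move: nNg; rewrite Dg j1 k0 expg0 mulg1 expg1 (N_mul (groupX i Ga) Gx) NX // oddi /=.
    by rewrite Eax eqxx.
  have xM : x \in <[a ^+ 2]> <*> <[x]> <*> <[y]>.
    by rewrite mem_gen // inE mem_gen // inE cycle_id orbT.
  have yM : y \in <[a ^+ 2]> <*> <[x]> <*> <[y]> by rewrite mem_gen // inE cycle_id orbT.
  have aM : a ^+ i \in <[a ^+ 2]> <*> <[x]> <*> <[y]>.
    rewrite mem_gen // inE mem_gen // inE -(odd_double_half i) (negPf eveni) add0n.
    by rewrite -mul2n expgM mem_cycle.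
  by rewrite Dg (groupM (groupM aM (groupX j xM)) (groupX k yM)).
have : (32 <= 16)%N; last by [].
rewrite -oG -[16]/(4 * 4)%N -{1}o_a2; apply: leq_trans (card_join_axy 2).
by apply: subset_leq_card; apply: subset_trans genG _; rewrite gen_subG.
Qed.

(** In this case the involutions outside N are among the a^i x with i odd, and lie
    in the dihedral group of order 8 generated by a^2 and a x. *)
Lemma Hol_not_only_a : ~ [/\ a \notin N, x \in N & y \in N].
Proof.
case=> nNa Nx Ny.
have sT : [set g in G | (g \notin N) && (g * g == 1)] \subset <[a ^+ 2]> <*> <[a * x]>.
  apply/subsetP => g; rewrite !inE => /and3P[Gg nNg /eqP g2].
  have [i [j [k Dg]]] := Hol_normal_form Gg.
  have [oddi|eveni] := boolP (odd i); last first.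
    move: nNg; rewrite Dg (N_mul (groupM (groupX i Ga) (groupX j Gx)) (groupX k Gy)).
    by rewrite (N_mul (groupX i Ga) (groupX j Gx)) !NX // eveni Nx Ny !orbT.
  rewrite Dg in g2; have /andP[j1 /negPf k0] := Hol_odd_involution oddi g2.
  rewrite Dg j1 k0 expg0 mulg1 expg1 -(odd_double_half i) oddi expgD expg1.
  rewrite -(commuteX2 _ 1 (commute_refl a)) expg1 -mulgA groupM //.
    by rewrite mem_gen // inE -mul2n expgM mem_cycle.
  by rewrite mem_gen // inE cycle_id orbT.
have : (32 <= 8)%N; last by [].
rewrite -oG; apply: (@leq_trans (#[a ^+ 2] * #[a * x])); last first.
  rewrite o_a2 -[8]/(4 * 2)%N leq_mul // o2 // expg2.
  by have := twisted_square 1 x2 (etrans ax aXV); rewrite expg1 mul1n a8.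
apply: leq_trans (card_joingr_leq _).
  by apply: subset_leq_card; apply: subset_trans genG _; rewrite gen_subG.
rewrite norms_cycle conjXg conjgM (conjgE a) mulKg ax expgVn groupV cycle_id //.
Qed.

(** An element of order 8 and an involution not commuting with it generate a group
    of order at least 16. *)
Lemma cyclic_ext_eq (b s : gT) m : b \in N -> s \in N -> #[b] = 8 ->
  s ^+ 2 = 1 -> b ^ s = b ^+ m -> b <> b ^+ m -> <[b]> <*> <[s]> = N.
Proof.
move=> Nb Ns ob s2 bs nbm; apply/eqP; rewrite eqEcard join_subG !cycle_subG Nb Ns /= oN.
have sBJ : <[b]> \subset <[b]> <*> <[s]> by apply: joing_subl.
have [k Dk] := dvdnP (cardSg sBJ); rewrite -orderE ob in Dk; rewrite Dk.
case: k Dk => [|[|k]] Dk; last by rewrite -[16]/(2 * 8)%N leq_mul2r.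
  by have := cardG_gt0 (<[b]> <*> <[s]>)%G; rewrite Dk.
case: nbm; rewrite -bs; apply/esym/conjg_fixP/commgP.
have /eqP EB : <[b]> == <[b]> <*> <[s]> by rewrite eqEcard sBJ Dk mul1n -orderE ob.
have : s \in <[b]> by rewrite EB mem_gen // inE cycle_id orbT.
by case/cycleP => l ->; apply: commuteX.
Qed.

(** By the two preceding lemmas, N is generated by a and x y, by a and y, or by
    a y and x. The first and the last give the semidihedral group, since x y
    raises a, and x raises a y, to the third power; the second gives the modular
    group. *)
Lemma Hol_subgroup_isog : N \isog 'SD_16 \/ N \isog 'Mod_16.
Proof.
have naX m : ~~ (8 %| m)%N -> a <> a ^+ m.+1.
  move=> ndv E; move: ndv; rewrite -Hol_order_a order_dvdn; case/eqP.
  by apply: (mulgI a); rewrite -expgS mulg1.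
have SD (b s : gT) : b \in N -> s \in N -> #[b] = 8 -> s ^+ 2 = 1 -> b ^ s = b ^+ 3 ->
    b <> b ^+ 3 -> N \isog 'SD_16.
  move=> Nb Ns ob s2 bs nb; apply/(isoGrpP _ (@Grp_semidihedral 4 isT)).
  rewrite card_semidihedral //; split; first exact: oN.
  apply/existsP; exists (b, s); rewrite /= !xpair_eqE (cyclic_ext_eq Nb Ns ob s2 bs nb) eqxx /=.
  have b8 : b ^+ 8 = 1 by rewrite -ob expg_order.
  by rewrite -[b ^+ (2 ^ 3)]/(b ^+ 8) -[b ^+ (_ * _).+1]/(b ^+ 3) b8 s2 bs !eqxx.
have Na_x := Hol_ax_out; have no_a := Hol_not_only_a.
have [Na|nNa] := boolP (a \in N).
  have nNx : x \notin N by move: Na_x; rewrite Na eq_sym eqb_id.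
  have [Ny|nNy] := boolP (y \in N); last first.
    left; apply: (SD a (x * y)) => //; [|exact: Hol_order_a|exact: (naX 2)].
    by rewrite N_mul // (negPf nNx) (negPf nNy).
  right; have Np : 2.-group N by rewrite /pgroup oN.
  apply/(isoGrpP _ (@Grp_modular_group 2 4 isT isT)).
  rewrite card_modular_group //; split; first exact: oN.
  apply/existsP; exists (a, y); rewrite /= !xpair_eqE (cyclic_ext_eq Na Ny Hol_order_a y2 ay (naX 4 isT)).
  by rewrite a8 y2 ay !eqxx.
left; have Nx : x \in N by move: Na_x; rewrite (negPf nNa); case: (x \in N).
have nNy : y \notin N by apply/negP => Ny; case: no_a.
have ay2 : (a * y) ^+ 2 = a ^+ 6 by rewrite expg2; have := twisted_square 1 y2 ay; rewrite expg1 mul1n.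
have a6 : a ^+ 6 <> 1 by move/eqP; rewrite -order_dvdn Hol_order_a.
have oay : #[a * y] = 8.
  have d8 : #[a * y] %| 8.
    by rewrite order_dvdn -[8]/(2 * 4)%N expgM ay2 -expgM; apply/eqP/(aX (j := 0)).
  have d4 : ~~ (#[a * y] %| 4).
    by rewrite order_dvdn -[4]/(2 * 2)%N expgM ay2 -expgM -order_dvdn Hol_order_a.
  have le8 : (#[a * y] <= 8)%N by apply: dvdn_leq.
  by move: le8 d8 d4; case: #[a * y] => [|[|[|[|[|[|[|[|[|m]]]]]]]]].
have xyC : y ^ x = y by rewrite conjgE -cxy mulKg.
apply: (SD (a * y) x) => //.
- by rewrite N_mul // (negPf nNa) (negPf nNy).
- by rewrite conjMg ax xyC aXV [RHS]expgSr ay2 mulgA -expgSr.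
by move=> E; apply: a6; apply: (mulIg (a * y)); rewrite mul1g -ay2 -expgSr -E.
Qed.
End Hol.

Lemma card_Hol_C8 : #|Hol [set: 'Z_8]%G| = 32.
Proof.
pose to := [Aut [set: 'Z_8]%G]%gact.
have := sdprod_card (sdprod_sdpair to); rewrite /= => <-.
rewrite !card_injm ?injm_sdpair1 ?injm_sdpair2 // card_Aut_cyclic; last by rewrite /= Zp_cycle cycle_cyclic.
by rewrite cardsT card_ord.
Qed.

Theorem Hol_C8_index2 (gT : finGroupType) (G N : {group gT}) :
  G \isog Hol [set: 'Z_8]%G -> N \subset G -> #|G : N| = 2 ->
  G \subset <<[set g in G | (g \notin N) && (g * g == 1)]>> ->
  N \isog 'SD_16 \/ N \isog 'Mod_16.
Proof.
move=> isoG sNG iN genG.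
have oG : #|G| = 32 by rewrite (card_isog isoG) card_Hol_C8.
have /existsP[[[a x] y] /=] : G \homg Grp (a : x : y : a ^+ 8, x ^+ 2, y ^+ 2, (x * y) ^+ 2,
     x * a * x^-1 = a^-1, y * a * y^-1 = a ^+ 5).
  by rewrite -Hol_C8_presentation isog_hom.
move=> /eqP[defG a8 x2 y2 xy2 xa ya].
exact: (Hol_subgroup_isog defG oG a8 x2 y2 xy2 xa ya sNG iN genG).
Qed.

End HolomorphSubgroups.

Import Order.TTheory GRing.Theory Num.Theory.
Local Open Scope ring_scope.

Local Notation Oint := (@algebraic_integer _).

(** * Number fields through their complex embeddings *)

(** Applied below to the powers of an element modulo an ideal. *)
Lemma pigeonhole (T : finType) (f : nat -> T) : exists i j, (i < j)%N /\ f i = f j.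
Proof.
pose g (i : 'I_#|T|.+1) := f i.
have /injectivePn[i [j neqij eqf]] : ~~ injectiveb g.
  by apply/negP => /injectiveP/leq_card; rewrite card_ord ltnn.
have [lt|lt|/val_inj eq] := ltngtP i j; [by exists i, j | by exists j, i |].
by rewrite eq eqxx in neqij.
Qed.

Lemma root_intr_rmorph (K L : fieldType) (f : {rmorphism K -> L}) (p : {poly int}) x :
  root (map_poly intr p) (f x) = root (map_poly intr p) x.
Proof.
rewrite -(fmorph_root f) -map_poly_comp.
by congr (root _ _); apply: eq_map_poly => m; rewrite /= rmorph_int.
Qed.

Lemma Oint_rmorph (K L : fieldType) (f : {rmorphism K -> L}) x :
  (f x \in Oint) = (x \in Oint).
Proof.
by apply/asboolP/asboolP => -[p mon_p]; rewrite ?root_intr_rmorph => px0;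
  exists p; rewrite ?root_intr_rmorph.
Qed.

Section Extend.
Variables (E : fieldType) (L : fieldExtType E) (C : fieldType).
Variables (phi : {rmorphism E -> C}) (t : L) (z : C) (p : {poly E}).
Hypothesis genL : <<1; t>>%VS = fullv.
Hypothesis min_p : minPoly 1 t = map_poly (in_alg L) p.
Hypothesis pz0 : root (map_poly phi p) z.

(** The value of the extension at q(t) is phi(q)(z); this is well defined because
    a polynomial killing t is divisible by the minimal polynomial p of t. *)
Lemma rmorphism_extension :
  exists psi : {rmorphism L -> C},
    psi t = z /\ forall a, psi a%:A = phi a.
Proof.
have ker0 (q : {poly E}) : (map_poly (in_alg L) q).[t] = 0 -> (map_poly phi q).[z] = 0.
  move=> qt0; have : minPoly 1 t %| map_poly (in_alg L) q.
    apply: minPoly_dvdp; last exact/rootP.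
    by apply/polyOver1P; exists q.
  rewrite min_p dvdp_map => /dvdpP[r ->].
  by rewrite rmorphM hornerM (rootP pz0) mulr0.
have /choice[f fE] (v : L) : exists q : {poly E}, (map_poly (in_alg L) q).[t] = v.
  have /Fadjoin1_polyP[q ->] : v \in <<1; t>>%VS by rewrite genL memvf.
  by exists q.
pose g v := (map_poly phi (f v)).[z].
have gE (q : {poly E}) : g (map_poly (in_alg L) q).[t] = (map_poly phi q).[z].
  apply/eqP; rewrite -subr_eq0 /g -hornerN -hornerD -rmorphN -rmorphD.
  by apply/eqP/ker0; rewrite rmorphD rmorphN hornerD hornerN fE subrr.
have gA : zmod_morphism g.
  move=> u v; have := gE (f u - f v).
  by rewrite !rmorphB !hornerD !hornerN !fE.
have gM : monoid_morphism g.
  split.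
    by have := gE 1; rewrite !rmorph1 !hornerE.
  by move=> u v; have := gE (f u * f v); rewrite !rmorphM !hornerM !fE.
pose gaddM := GRing.isZmodMorphism.Build L C g gA.
pose gmulM := GRing.isMonoidMorphism.Build L C g gM.
pose psi : {rmorphism L -> C} := HB.pack g gaddM gmulM.
exists psi; split.
  by have := gE 'X; rewrite !map_polyX !hornerX.
by move=> a; have := gE a%:P; rewrite !map_polyC !hornerC.
Qed.
End Extend.

(** What is used of a number field: an integral primitive element, and the list of
    all complex embeddings. The carrier is a bare field, because the same facts are
    applied to fields which are presented over different base fields. *)
Record embedding_system (K : fieldType) := EmbeddingSystem {
  deg : nat;
  gen : K;
  emb : 'I_deg -> {rmorphism K -> algC};
  gen_int : gen \in Oint;
  emb_gen_inj : injective (fun i => emb i gen);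
  gen_span : forall x, exists c : 'I_deg -> rat,
    x = \sum_(j < deg) ratr (c j) * gen ^+ j;
  emb_complete : forall psi : {rmorphism K -> algC},
    exists i, forall x, psi x = emb i x }.

Lemma integral_multiple (K : fieldType) (x : K) (q : {poly int}) :
  root (map_poly intr q) x -> (lead_coef q)%:~R * x \in Oint.
Proof.
move=> /rootP qx0; set a := lead_coef q.
have [q1|q1] := leqP (size q) 1.
  have Dq : q = a%:P by rewrite /a (size1_polyC q1) lead_coefC.
  by move: qx0; rewrite Dq map_polyC hornerC /= => ->; rewrite mul0r rpred0.
pose d := (size q).-1.
have sq : size q = d.+1 by rewrite /d; case: (size q) q1.
have d0 : (0 < d)%N by rewrite -ltnS -sq.
(* If q = a X^d + ..., then a x is a root of the monic polynomial
   a^(d-1) q(X / a). *)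
pose r := \poly_(i < d) (q`_i * a ^+ (d.-1 - i)).
have sr : (size r < size ('X^d : {poly int}))%N by rewrite size_polyXn ltnS size_poly.
apply/asboolP; exists ('X^d + r).
  by rewrite monicE lead_coefDl // lead_coefXn.
apply/rootP; rewrite rmorphD rmorphXn /= map_polyX hornerD hornerXn.
rewrite (@horner_coef_wide _ d); last exact: leq_trans (size_poly _ _) (size_poly _ _).
transitivity ((a ^+ d.-1)%:~R * (map_poly intr q).[x]); last by rewrite qx0 mulr0.
rewrite (@horner_coef_wide _ d.+1); last by rewrite -sq; exact: size_poly.
rewrite big_ord_recr /= mulrDr addrC mulr_sumr; congr (_ + _).
  apply: eq_bigr => i _; rewrite !coef_map /= coef_poly ltn_ord.
  rewrite exprMn !rmorphM /= !rmorphXn /=.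
  have -> : d.-1 = (d.-1 - i + i)%N by rewrite subnK // -ltnS prednK.
  by rewrite addnK exprD; ring.
rewrite coef_map /= exprMn -{1}(prednK d0) exprS rmorphXn /= /a lead_coefE -/d.
by ring.
Qed.

(** A primitive element exists by separability, and a multiple of it is integral;
    the embeddings correspond to the complex roots of its minimal polynomial. *)
Lemma embedding_system_rat (K : fieldExtType rat) : inhabited (embedding_system K).
Proof.
have sep x : separable_element 1%AS (x : K).
  apply: pcharf0_separable => p; rewrite pchar_lalg; exact: pchar_num.
have sepK : separable 1%AS (fullv : {vspace K}) by apply/separableP => x _; exact: sep.
have genK := eq_adjoin_separable_generator sepK (sub1v _).
set t := separable_generator _ _ in genK.
have in_algE (c : rat) : c%:A = ratr c :> K := fmorph_eq_rat (in_alg K) c.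
have [p min_p] : exists p : {poly rat}, minPoly 1 t = map_poly (in_alg K) p.
  by have /polyOver1P := minPolyOver 1 t.
have [q [a a0 Dp]] := rat_poly_scale p.
have q0 : q != 0.
  apply: contraTneq (monic_minPoly 1 t) => q0.
  by rewrite min_p Dp q0 rmorph0 scaler0 rmorph0 monicE lead_coef0 eq_sym oner_eq0.
have qt0 : root (map_poly intr q) t.
  have := root_minPoly 1 t; rewrite min_p Dp /root map_polyZ hornerZ /= mulf_eq0.
  rewrite scaler_eq0 invr_eq0 intr_eq0 (negPf a0) oner_eq0 /= -map_poly_comp.
  by congr (_.[t] == 0); apply: eq_map_poly => c /=; rewrite in_algE ratr_int.
pose m := lead_coef q; have m0 : m%:~R != 0 :> rat by rewrite intr_eq0 lead_coef_eq0.
pose u : K := m%:~R * t.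
have uE : u = m%:~R *: t by rewrite scaler_int /u mulrzl.
have u_int : u \in Oint := integral_multiple qt0.
have genu : <<1; u>>%VS = fullv.
  apply/eqP; rewrite eqEsubv subvf {1}genK; apply/FadjoinP; split; first exact: sub1v.
  have -> : t = m%:~R^-1 *: u by rewrite uE scalerK.
  by rewrite rpredZ // memv_adjoin.
have [pu min_pu] : exists p : {poly rat}, minPoly 1 u = map_poly (in_alg K) p.
  by have /polyOver1P := minPolyOver 1 u.
have [rs Drs] := closed_field_poly_normal (map_poly (ratr : rat -> algC) pu).
have mon_pu : pu \is monic by rewrite -(map_monic (in_alg K)) -min_pu monic_minPoly.
rewrite lead_coef_map (monicP mon_pu) rmorph1 scale1r in Drs.
have Urs : uniq rs.
  rewrite -separable_prod_XsubC -Drs separable_map -(separable_map (in_alg K)) -min_pu.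
  exact: sep.
have srs : size rs = adjoin_degree 1 u.
  apply: succn_inj; rewrite -size_minPoly min_pu -(size_prod_XsubC rs id) -Drs.
  by rewrite !size_map_poly.
have rootrs z : root (map_poly (ratr : rat -> algC) pu) z = (z \in rs).
  by rewrite Drs root_prod_XsubC.
pose n := size rs.
have ext (i : 'I_n) : exists psi : {rmorphism K -> algC}, psi u = rs`_i.
  have := @rmorphism_extension _ K algC ratr u rs`_i pu genu min_pu.
  by rewrite rootrs mem_nth // => /(_ isT)[psi [psiu _]]; exists psi.
have [phi phiE] := choice ext.
have span x : exists c : 'I_n -> rat, x = \sum_(j < n) ratr (c j) * u ^+ j.
  have xu : x \in <<1; u>>%VS by rewrite genu memvf.
  have /polyOver1P[f Df] := Fadjoin_polyOver 1 u x.
  exists (fun j => f`_j); rewrite -{1}(Fadjoin_poly_eq xu).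
  rewrite (@horner_coef_wide _ n); last by rewrite /n srs size_Fadjoin_poly.
  rewrite Df.
  by apply: eq_bigr => j _; rewrite coef_map /= in_algE.
constructor; apply: (@EmbeddingSystem K n u phi) => //.
  by move=> i j; rewrite !phiE => /eqP; rewrite nth_uniq // => /eqP/val_inj.
move=> psi.
have : psi u \in rs.
  rewrite -rootrs; have := root_minPoly 1 u; rewrite min_pu -(fmorph_root psi) -map_poly_comp.
  by congr (root _ _); apply: eq_map_poly => c; rewrite /= in_algE fmorph_rat.
move/(nthP 0) => [i lti Di]; exists (Ordinal lti) => x.
have [c ->] := span x; rewrite !rmorph_sum; apply: eq_bigr => j _.
by rewrite [LHS]rmorphM [RHS]rmorphM !fmorph_rat !rmorphXn phiE /= Di.
Qed.

Section NumberField.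
Variables (K : fieldType) (S : embedding_system K).
Local Notation n := (deg S).
Local Notation theta := (gen S).
Local Notation phi := (emb (e := S)).

Lemma deg_gt0 : (0 < n)%N.
Proof.
rewrite lt0n; apply/eqP => n0; have [c] := gen_span S 1.
rewrite big1 => [/eqP|j]; first by rewrite oner_eq0.
by have := ltn_ord j; rewrite {2}n0.
Qed.

Lemma intr_eq0_field (m : int) : (m%:~R == 0 :> K) = (m == 0).
Proof.
by rewrite -(fmorph_eq0 (phi (Ordinal deg_gt0))) rmorph_int intr_eq0.
Qed.

Lemma monic_intr (p : {poly int}) : (map_poly (intr : int -> algC) p \is monic) = (p \is monic).
Proof.
rewrite !monicE lead_coef_map_inj //; last exact: intr_inj.
by rewrite -(inj_eq (@intr_inj algC)).
Qed.

Lemma emb_Aint (f : {rmorphism K -> algC}) x : (f x \in Aint) = (x \in Oint).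
Proof.
apply/idP/idP => [Afx | /asboolP[p mon_p px0]].
  have /floorpP[p Dp] := Afx; apply/asboolP; exists p.
    by rewrite -monic_intr -Dp minCpoly_monic.
  by rewrite -(root_intr_rmorph f) -Dp root_minCpoly.
apply: (@root_monic_Aint (map_poly intr p)); first by rewrite root_intr_rmorph.
  by rewrite monic_map.
by apply/polyOverP => i; rewrite coef_map /= intr_int.
Qed.

Let V := Vandermonde n (\row_j phi j theta).

Lemma V_unit : V \in unitmx.
Proof.
rewrite unitmxE unitfE det_Vandermonde; apply/prodf_neq0 => i _.
apply/prodf_neq0 => j ltij; rewrite !mxE subr_eq0.
by apply: contraTneq ltij => /emb_gen_inj ->; rewrite ltnn.
Qed.

(** Multiplication by x on the basis of powers of theta has a rational matrix, and
    the Vandermonde matrix of the conjugates of theta diagonalizes it. *)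
Lemma mult_matrix x : exists A : 'M[rat]_n,
  map_mx ratr A = V *m diag_mx (\row_i phi i x) *m invmx V.
Proof.
have /choice[M ME] (j : 'I_n) := gen_span S (x * theta ^+ j).
pose A : 'M[rat]_n := \matrix_(i, j) M i j; exists A.
suff <- : map_mx ratr A *m V = V *m diag_mx (\row_i phi i x) by rewrite mulmxK // V_unit.
apply/matrixP => j i; rewrite mul_mx_diag !mxE.
rewrite mulrC -rmorphXn -rmorphM ME rmorph_sum; apply: eq_bigr => k _.
by rewrite !mxE [RHS]rmorphM fmorph_rat rmorphXn.
Qed.

Lemma emb_charpoly_rat x : \prod_i ('X - (phi i x)%:P) \is a polyOver Crat.
Proof.
have [A DA] := mult_matrix x.
suff -> : \prod_i ('X - (phi i x)%:P) = char_poly (map_mx ratr A).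
  rewrite -map_char_poly; apply/polyOverP => i; rewrite coef_map; exact: Crat_rat.
rewrite DA; set D := diag_mx _.
rewrite /char_poly; have -> : char_poly_mx (V *m D *m invmx V) =
   map_mx polyC V *m char_poly_mx D *m map_mx polyC (invmx V).
  rewrite /char_poly_mx mulmxBr mulmxBl !map_mxM; congr (_ - _).
  by rewrite mul_mx_scalar -scalemxAl -map_mxM mulmxV ?V_unit // map_mx1 scalemx1.
rewrite !det_mulmx mulrAC -det_mulmx -map_mxM mulmxV ?V_unit // map_mx1 det1 mul1r.
rewrite /char_poly_mx map_diag_mx -diag_const_mx -raddfB /= det_diag.
by apply: eq_bigr => i _; rewrite !mxE.
Qed.

(** The coefficients are rational, being those of the characteristic polynomial of
    multiplication by x, and they are algebraic integers. *)
Lemma emb_charpoly_int x : x \in Oint ->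
  exists p : {poly int}, map_poly intr p = \prod_i ('X - (phi i x)%:P).
Proof.
move=> xO; suff /floorpP[p ->] : \prod_i ('X - (phi i x)%:P) \is a polyOver Num.int.
  by exists p.
apply/polyOverP => k; apply: Cint_rat_Aint.
  by have /polyOverP := emb_charpoly_rat x; apply.
have /polyOverP : \prod_i ('X - (phi i x)%:P) \is a polyOver Aint; last exact.
by apply: rpred_prod => i _; rewrite polyOverXsubC emb_Aint.
Qed.

Definition emb_norm x : algC := \prod_i phi i x.

Lemma emb_norm_int x : x \in Oint -> emb_norm x \is a Num.int.
Proof.
move=> xO; have [p Dp] := emb_charpoly_int xO.
have : (map_poly intr p).[0] \is a @Num.int algC.
  by rewrite horner_coef0 coef_map intr_int.
rewrite Dp horner_prod (eq_bigr (fun i => - phi i x)) => [|i _]; last by rewrite !hornerE.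
by rewrite prodrN rpredMsign.
Qed.

Definition emb_trace x : algC := \sum_i phi i x.

Lemma emb_trace_int x : x \in Oint -> emb_trace x \is a Num.int.
Proof.
move=> xO; apply: Cint_rat_Aint; last by apply: rpred_sum => i _; rewrite emb_Aint.
have [A DA] := mult_matrix x.
have -> : emb_trace x = \tr (map_mx ratr A).
  rewrite DA mxtrace_mulC mulKmx ?V_unit // mxtrace_diag.
  by apply: eq_bigr => i _; rewrite mxE.
by rewrite trace_map_mx Crat_rat.
Qed.

Lemma emb_norm_neq0 x : x != 0 -> emb_norm x != 0.
Proof. by move=> x0; apply/prodf_neq0 => i _; rewrite fmorph_eq0. Qed.

(** The quotient of the norm by x is the product of the other conjugates of x. *)
Lemma emb_norm_dvd x : x \in Oint -> x != 0 -> exists m : int,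
  emb_norm x = m%:~R /\ m%:~R / x \in Oint.
Proof.
move=> xO x0; have /intrP[m Dm] := emb_norm_int xO; exists m; split=> //.
pose i0 := Ordinal deg_gt0.
rewrite -(emb_Aint (phi i0)) fmorph_div rmorph_int -Dm /emb_norm (bigD1 i0) //=.
by rewrite mulrAC mulfV ?fmorph_eq0 // mul1r rpred_prod // => i _; rewrite emb_Aint.
Qed.

(** The discriminant of theta bounds the denominators of the coordinates of all
    algebraic integers: the coordinates solve a linear system whose matrix is the
    Gram matrix of the trace form. *)
Lemma bounded_denominators : exists2 d : int, d != 0 & forall x (c : 'I_n -> rat),
  x \in Oint -> x = \sum_(j < n) ratr (c j) * theta ^+ j ->
  forall j, d%:~R * ratr (c j) \is a @Num.int algC.
Proof.
pose G := V *m V^T.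
have GE i j : G i j = emb_trace (theta ^+ i * theta ^+ j).
  by rewrite !mxE; apply: eq_bigr => k _; rewrite !mxE rmorphM !rmorphXn.
have G_int i j : G i j \is a Num.int.
  by rewrite GE emb_trace_int // rpredM ?rpredX ?gen_int.
have det_int m (B : 'M[algC]_m) : (forall i j, B i j \is a Num.int) -> \det B \is a Num.int.
  by move=> Bi; apply: rpred_sum => s _; rewrite rpredMsign rpred_prod.
have /intrP[d Dd] := det_int _ _ G_int.
have V0 : \det V != 0 by rewrite -unitfE -unitmxE V_unit.
exists d; first by rewrite -(intr_eq0 algC) -Dd det_mulmx det_tr mulf_neq0.
move=> x c xO Dx j.
pose C : 'cV[algC]_n := \col_j ratr (c j).
pose b : 'cV[algC]_n := \col_i emb_trace (x * theta ^+ i).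
have Gc : G *m C = b.
  apply/colP => i; rewrite [LHS]mxE [RHS]mxE /emb_trace.
  under eq_bigr => k _ do rewrite GE mxE /emb_trace mulr_suml.
  rewrite exchange_big; apply: eq_bigr => k _ /=.
  rewrite {1}Dx rmorphM rmorph_sum mulr_suml; apply: eq_bigr => l _.
  rewrite [phi k (ratr _ * _)]rmorphM fmorph_rat rmorphM; ring.
(* Cramer's rule for G C = b, where G and b have integer entries. *)
have -> : d%:~R * ratr (c j) = (\adj G *m b) j 0.
  by rewrite -Gc mulmxA mul_adj_mx mul_scalar_mx Dd !mxE.
rewrite mxE; apply: rpred_sum => i _; rewrite rpredM //.
  by rewrite mxE rpredMsign det_int // => k l; rewrite 2!mxE; exact: G_int.
by rewrite mxE emb_trace_int // rpredM ?rpredX ?gen_int.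
Qed.

(** Finiteness of the ring of integers modulo a, in the form needed for pigeonhole
    arguments. *)
Lemma finite_quotient (a : K) : a \in Oint -> a != 0 ->
  exists (T : finType) (key : K -> T), forall x y, x \in Oint -> y \in Oint ->
    key x = key y -> (x - y) / a \in Oint.
Proof.
move=> aO a0; have [m [Dm ma]] := emb_norm_dvd aO a0.
have m0 : m != 0 by rewrite -(intr_eq0 algC) -Dm emb_norm_neq0.
have [d d0 dP] := bounded_denominators.
have [c cE] := choice (gen_span S).
(* With d bounding the denominators and m the norm of a, which a divides,
   the coordinates multiplied by d and read modulo d m determine x modulo a. *)
pose N := absz (d * m); have N0 : (0 < N)%N by rewrite absz_gt0 mulf_neq0.
pose z x j := Num.floor (d%:~R * ratr (c x j) : algC).
have zE x j : x \in Oint -> (z x j)%:~R = d%:~R * ratr (c x j) :> algC.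
  by move=> xO; rewrite floorK // (dP x).
have modN (t : int) : (absz (t %% N)%Z < N)%N.
  by rewrite -ltz_nat gez0_abs ?modz_ge0 ?ltz_pmod // -lt0n.
exists {ffun 'I_n -> 'I_N}, (fun x => [ffun j => Ordinal (modN (z x j))]).
move=> x y xO yO /ffunP eqk.
have /choice[t tE] j : exists t : int, z x j - z y j = t * (d * m).
  have := congr1 val (eqk j); rewrite !ffunE /= => /(congr1 Posz).
  have NZ : N%:Z != 0 by rewrite -lt0n.
  rewrite (gez0_abs (modz_ge0 _ NZ)) (gez0_abs (modz_ge0 _ NZ)) => /eqP.
  rewrite eqz_mod_dvd.
  by move=> dv; apply/dvdzP.
pose i0 := Ordinal deg_gt0.
have -> : (x - y) / a = m%:~R / a * \sum_(j < n) (t j)%:~R * theta ^+ j.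
  apply: (fmorph_inj (phi i0)); rewrite fmorph_div rmorphB !rmorphM /= fmorphV.
  rewrite [RHS]mulrAC; congr (_ / _); rewrite {1}(cE x) {1}(cE y) !rmorph_sum /=.
  rewrite -sumrB rmorph_int mulr_sumr; apply: eq_bigr => j _.
  rewrite [phi i0 (ratr _ * _)]rmorphM [phi i0 (ratr (c y j) * _)]rmorphM.
  have -> : phi i0 ((t j)%:~R * theta ^+ j) = (t j)%:~R * phi i0 (theta ^+ j).
    by rewrite rmorphM rmorph_int.
  have fr u : phi i0 (ratr u) = ratr u := fmorph_rat _ u.
  rewrite !fr -mulrBl mulrA; congr (_ * _).
  have dC : d%:~R != 0 :> algC by rewrite intr_eq0.
  apply: (mulfI dC); rewrite mulrBr -!zE // -intrB tE !intrM; ring.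
rewrite rpredM // rpred_sum // => j _; rewrite rpredM ?rpredX ?gen_int //.
by rewrite rpred_int.
Qed.

(** Two of the elements a z^i are congruent modulo a, which gives an integral
    equation for z. This says that the ring of integers is completely integrally
    closed, and it replaces the use of finitely generated modules below. *)
Lemma almost_integral (a z : K) : a \in Oint -> a != 0 ->
  (forall i, a * z ^+ i \in Oint) -> z \in Oint.
Proof.
move=> aO a0 az; have [T [key keyP]] := finite_quotient aO a0.
have [i [j [ltij eqf]]] := pigeonhole (fun i => key (a * z ^+ i)).
have := keyP _ _ (az j) (az i) (esym eqf).
rewrite -mulrBr mulrAC mulfV // mul1r; set o := _ - _ => oO.
(* z^j - z^i is an algebraic integer, so z is a root of a monic polynomial
   with algebraic integer coefficients. *)
apply/asboolP; apply: (@integral_root_monic _ _ _ z ('X^j - 'X^i - o%:P)).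
- rewrite monicE -addrA lead_coefDl ?lead_coefXn // size_polyXn ltnS.
  rewrite -opprD size_polyN (leq_trans (size_polyD _ _)) // geq_max size_polyXn ltij.
  by rewrite (leq_trans (size_polyC_leq1 _)) // (leq_trans _ ltij).
- by apply/rootP; rewrite !hornerE /o subrr.
apply/integral_poly => k; apply/asboolP.
suff : ('X^j - 'X^i - o%:P)`_k \in Oint by [].
rewrite !coefE !rpredB ?rpred_nat //.
by case: ifP => _; rewrite ?rpred0.
Qed.
End NumberField.

(** * Prime ideals *)

(** The polynomial with roots the conjugates of a suitable element is invariant, so phi
    and psi have the same value on it. The lemma is applied twice: to reduction modulo
    a prime, where it produces inertia, and to a complex embedding and its conjugate. *)
Lemma integral_conjugates (S : comNzRingType) (O : idomainType) (phi psi : {rmorphism S -> O})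
  (I : finType) (s : I -> {rmorphism S -> S}) (e : I) :
  (forall x, s e x = x) ->
  (forall j, exists p : {perm I}, forall i x, s j (s i x) = s (p i) x) ->
  (forall x, (forall i, s i x = x) -> phi x = psi x) ->
  exists i, forall x, psi x = phi (s i x).
Proof.
move=> se sperm inv; apply: contrapT => none.
have /choice[a aP] i : exists a, psi a <> phi (s i a).
  apply: contrapT => none_i; apply: none; exists i => x.
  by apply: contrapT => neq; apply: none_i; exists x.
(* The coefficients of A witness, one for each i, that psi is not phi composed
   with s i; the polynomial with roots s i (A) is invariant under all s j, so phi
   and psi agree on it, and psi(A) is a root of it. *)
pose A := \sum_i (a i)%:P * 'X^(enum_rank i).
have coefA (f : {rmorphism S -> O}) i : (map_poly f A)`_(enum_rank i) = f (a i).
  rewrite coef_map /= /A coef_sum (bigD1 i) //= coefCM coefXn eqxx mulr1.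
  rewrite big1 ?addr0 // => j neq; rewrite coefCM coefXn.
  by case: eqP => [/val_inj/enum_rank_inj eq|]; rewrite ?mulr0 //; rewrite eq eqxx in neq.
pose Q : {poly {poly S}} := \prod_i ('X - (map_poly (s i) A)%:P).
have Qinv j : map_poly (map_poly (s j)) Q = Q.
  have [p pE] := sperm j; rewrite rmorph_prod [RHS](reindex_inj (@perm_inj _ p)).
  apply: eq_bigr => i _; rewrite rmorphB /= map_polyX map_polyC /= -map_poly_comp.
  by congr (_ - _%:P); apply: eq_map_poly => x; rewrite /= pE.
have Qeq : map_poly (map_poly phi) Q = map_poly (map_poly psi) Q.
  apply/polyP => k; rewrite !coef_map; apply/polyP => l; rewrite !coef_map /=.
  apply: inv => i; rewrite -[in RHS](Qinv i) !coef_map //.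
have : (map_poly (map_poly psi) Q).[map_poly psi A] = 0.
  rewrite horner_map /= /Q horner_prod (bigD1 e) //= !hornerE.
  have -> : map_poly (s e) A = A by rewrite (eq_map_poly se) map_poly_id.
  by rewrite subrr mul0r rmorph0.
rewrite -Qeq rmorph_prod horner_prod => /eqP/prodf_eq0[i _].
rewrite rmorphB /= map_polyX map_polyC !hornerE subr_eq0.
move=> /eqP/(congr1 (fun q : {poly O} => q`_(enum_rank i))).
rewrite coefA /= -map_poly_comp.
have -> : map_poly (phi \o s i) A = map_poly ([the {rmorphism S -> O} of phi \o s i]) A by [].
by rewrite coefA; apply: aP.
Qed.

Section Ideals.
Variables (K : fieldType) (S : embedding_system K).
Implicit Types (J P : K -> Prop) (a b x y : K).

(** Ideals of the ring of integers are represented by predicates on the field. *)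
Definition int_ideal J := [/\ forall x, J x -> x \in Oint, J 0,
  forall x y, J x -> J y -> J (x + y) & forall c x, c \in Oint -> J x -> J (c * x)].

Definition maximal_ideal P := [/\ int_ideal P, ~ P 1 &
  forall x, x \in Oint -> ~ P x -> exists p c, [/\ P p, c \in Oint & 1 = p + c * x]].

Lemma ideal_opp J x : int_ideal J -> J x -> J (- x).
Proof. by case=> _ _ _ JM Jx; rewrite -mulN1r; apply: JM => //; rewrite rpredN rpred1. Qed.

Lemma ideal_sub J x y : int_ideal J -> J x -> J y -> J (x - y).
Proof. by move=> IJ Jx Jy; case: (IJ) => _ _ JD _; apply: JD => //; apply: ideal_opp. Qed.

Lemma ideal_div J a x : int_ideal J -> J a -> a != 0 -> x / a \in Oint -> J x.
Proof. by case=> _ _ _ JM Ja a0 xa; rewrite -(divfK a0 x); apply: JM. Qed.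

(** An ideal containing a is a union of classes modulo a. Among the ideals that
    contain J and not 1, one that meets the largest number of classes is maximal. *)
Lemma exists_maximal_ideal J a : int_ideal J -> J a -> a != 0 -> ~ J 1 ->
  exists2 P, maximal_ideal P & forall x, J x -> P x.
Proof.
move=> IJ Ja a0 J1; have aO : a \in Oint by case: (IJ) => JO _ _ _; apply: JO.
have [T [key keyP]] := finite_quotient S aO a0.
pose tr (Q : K -> Prop) : {set T} := [set t | `[< exists2 x, Q x & key x = t >]].
pose good Q := [/\ int_ideal Q, forall x, J x -> Q x & ~ Q 1].
pose sz n := `[< exists2 Q, good Q & #|tr Q| = n >].
have exn : exists n, sz n by exists #|tr J|; apply/asboolP; exists J.
have len n : sz n -> (n <= #|T|)%N by move/asboolP => [Q _ <-]; apply: max_card.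
case: (ex_maxnP exn len) => _ /asboolP[P [IP JP P1] <-] maxP.
exists P => //; split=> // x xO Px; apply: contrapT => none.
case: (IP) => PO P0 PD PM.
pose Q z := exists p c, [/\ P p, c \in Oint & z = p + c * x].
have PQ z : P z -> Q z by move=> Pz; exists z, 0; rewrite rpred0 mul0r addr0.
have Qx : Q x by exists 0, 1; rewrite rpred1 mul1r add0r.
have IQ : int_ideal Q.
  split=> [z [p [c [Pp cO ->]]]||z1 z2 [p [c [Pp cO ->]]] [p' [c' [Pp' cO' ->]]]|d z dO [p [c [Pp cO ->]]]].
  - by rewrite rpredD ?(PO p) // rpredM.
  - exact: PQ.
  - by exists (p + p'), (c + c'); rewrite rpredD //; split=> //; [exact: PD | ring].
  - by exists (d * p), (d * c); rewrite rpredM //; split=> //; [exact: PM | ring].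
have trPQ : tr P = tr Q.
  apply/eqP; rewrite eqEcard; apply/andP; split.
    by apply/subsetP => t; rewrite !inE => /asboolP[z Pz kz]; apply/asboolP; exists z; auto.
  apply: maxP; apply/asboolP; exists Q => //; split=> //; first by move=> z Jz; apply/PQ/JP.
have : key x \in tr Q by rewrite inE; apply/asboolP; exists x.
rewrite -trPQ inE => /asboolP[z Pz kz]; apply: Px.
rewrite -(subrK z x); apply: PD => //; apply: ideal_div IP (JP _ Ja) a0 _.
by apply: keyP => //; apply: PO.
Qed.

Lemma maximal_ideal_prime P x y : maximal_ideal P -> x \in Oint -> y \in Oint ->
  P (x * y) -> P x \/ P y.
Proof.
move=> [IP P1 maxP] xO yO Pxy; have [Px|/(maxP x xO)[p [c [Pp cO E]]]] := EM (P x); [by left|right].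
rewrite -[y]mul1r E mulrDl; case: IP => _ _ PD PM; apply: PD.
  by rewrite mulrC; apply: PM.
by rewrite -mulrA; apply: PM.
Qed.

(** Invertibility of P: the element y belongs to the inverse of P and not to the
    ring of integers. Since O / aO is finite, there is b, nonzero in its
    localization at P, with b P contained in aO; then y = b / a. *)
Lemma maximal_ideal_inverse P a : maximal_ideal P -> P a -> a != 0 ->
  exists y p p', [/\ y \notin Oint, forall x, P x -> y * x \in Oint,
     P p, P p' & 1 = p + y * p'].
Proof.
move=> MP Pa a0; case: (MP) => IP P1 maxP; case: (IP) => PO P0 PD PM.
have aO := PO _ Pa.
have [T [key keyP]] := finite_quotient S aO a0.
(* free b says that b is nonzero in the localization of O / aO at P. *)
pose free b := forall s, s \in Oint -> ~ P s -> b * s / a \notin Oint.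
have PX p i : P p -> (0 < i)%N -> P (p ^+ i).
  by case: i => // i Pp _; rewrite exprSr; apply: PM => //; rewrite rpredX ?PO.
have kill (ps : seq K) : (forall p, p \in ps -> P p) -> exists b,
    [/\ b \in Oint, free b & forall p, p \in ps -> b * p / a \in Oint].
  elim: ps => [|p ps IHps] Pps.
    exists 1; split=> //; first exact: rpred1.
    by move=> s sO Ps; apply/negP; rewrite mul1r => /(ideal_div IP Pa a0).
  have Pp : P p by apply: Pps; rewrite mem_head.
  have pO := PO _ Pp.
  have [|b [bO fb bps]] := IHps; first by move=> q qps; apply: Pps; rewrite inE qps orbT.
  (* Some power of p in P vanishes in that localization, because O / aO is
     finite and 1 - p^k is outside P; multiply b by the last power that does
     not annihilate it. *)
  pose R e := `[< exists s, [/\ s \in Oint, ~ P s & b * p ^+ e * s / a \in Oint] >].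
  have exR : exists e, R e.
    have [i [j [ltij eqf]]] := pigeonhole (fun i => key (p ^+ i)).
    exists i; apply/asboolP; exists (1 - p ^+ (j - i)); split.
    - by rewrite rpredB ?rpred1 ?rpredX.
    - move=> Pq; apply: P1; rewrite -(subrK (p ^+ (j - i)) 1); apply: PD => //.
      by apply: PX; rewrite ?subn_gt0.
    have -> : b * p ^+ i * (1 - p ^+ (j - i)) / a = b * ((p ^+ i - p ^+ j) / a).
      by rewrite -{2}(subnKC (ltnW ltij)) exprD; ring.
    by rewrite rpredM // keyP ?rpredX.
  case: (ex_minnP exR) => -[|e] /asboolP[s [sO Ps bs]] mine.
    by have := fb s sO Ps; rewrite -{1}(mulr1 b) -(expr0 p) bs.
  exists (b * p ^+ e * s); split.
  - by rewrite !rpredM ?rpredX.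
  - move=> s' sO' Ps'; apply/negP => bss.
    have : R e.
      apply/asboolP; exists (s * s'); rewrite rpredM //; split=> //.
        by case/(maximal_ideal_prime MP sO sO').
      by rewrite mulrA.
    by move/mine; rewrite ltnn.
  move=> q; rewrite inE => /predU1P[->|qps].
    by rewrite -[X in X / a](_ : b * p ^+ e.+1 * s = _) // exprSr; ring.
  have -> : b * p ^+ e * s * q / a = p ^+ e * s * (b * q / a) by ring.
  by rewrite rpredM ?bps // rpredM ?rpredX.
have /choice[r rP] (t : T) : exists r, P r /\ forall x, P x -> key x = t -> key r = t.
  have [[x Px kx]|none] := EM (exists2 x, P x & key x = t); first by exists x.
  by exists 0; split=> // x Px kx; case: none; exists x.
have [|b [bO fb bP]] := kill [seq r t | t <- enum T].
  by move=> _ /mapP[t _ ->]; case: (rP t).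
pose y := b / a.
have yP x : P x -> y * x \in Oint.
  move=> Px; have [Pr kr] := rP (key x).
  have -> : y * x = b * r (key x) / a + b * ((x - r (key x)) / a) by rewrite /y; ring.
  rewrite rpredD ?bP ?map_f ?mem_enum // rpredM // keyP ?PO //.
  by rewrite (kr x).
have yO : y \notin Oint by have := fb 1 (rpred1 _) P1; rewrite mulr1.
have [p' Pp' nPp'] : exists2 p', P p' & ~ P (y * p').
  (* If y P were contained in P, then a y^i would be in P for all i and y would
     be integral. *)
  apply: contrapT => none; move/negP: yO; apply; apply: (almost_integral S aO a0) => i.
  apply: PO; elim: i => [|i IHi]; first by rewrite mulr1.
  apply: contrapT => nP; apply: none; exists (a * y ^+ i) => //.
  by move=> Py; apply: nP; rewrite exprS mulrCA.
have [p [c [Pp cO E]]] := maxP _ (yP _ Pp') nPp'.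
by exists y, p, (c * p'); split=> //; [exact: PM | rewrite E; ring].
Qed.

(** If J were contained in a maximal ideal P, then an element y of the inverse of P
    would be integral, as 1 is in the extension of P to L. *)
Lemma ideal_going_down (L : fieldType) (iota : {rmorphism K -> L}) J (I : finType)
    (c : I -> L) (j : I -> K) :
  int_ideal J -> (forall i, c i \in Oint) -> (forall i, J (j i)) ->
  1 = \sum_i c i * iota (j i) -> J 1.
Proof.
move=> IJ cO Jj E; apply: contrapT => J1.
have [a Ja a0] : exists2 a, J a & a != 0.
  apply: contrapT => none; move/eqP: E; apply/negP; rewrite big1 ?oner_eq0 // => i _.
  have [->|ji0] := eqVneq (j i) 0; first by rewrite rmorph0 mulr0.
  by case: none; exists (j i).
have [P MP JP] := exists_maximal_ideal IJ Ja a0 J1.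
have [y [p [p' [/negP yO yP _ _ _]]]] := maximal_ideal_inverse MP (JP _ Ja) a0.
apply: yO; rewrite -(Oint_rmorph iota) -[iota y]mulr1 E mulr_sumr rpred_sum // => i _.
by rewrite mulrCA -rmorphM rpredM // Oint_rmorph yP //; apply: JP.
Qed.

Lemma maximal_prime_idealr P : maximal_ideal P ->
  exists I : prime_idealr (integers K), forall x : integers K, (x \in I) = `[< P (integer_val x) >].
Proof.
move=> MP; case: (MP) => IP P1 _; case: (IP) => PO P0 PD PM.
pose Pb (x : integers K) : bool := `[< P (integer_val x) >].
have zc : zmod_closed Pb.
  split=> [|x y /asboolP Px /asboolP Py]; apply/asboolP; first exact: P0.
  exact: ideal_sub.
have pc : 1 \notin (Pb : {pred _}) /\
    forall c : integers K, {in (Pb : {pred _}), forall u, c * u \in (Pb : {pred _})}.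
  split; first by apply/asboolP.
  move=> x y /asboolP Py; apply/asboolP; apply: PM => //; exact: integer_valP.
have prc : @prime_idealr_closed (integers K) Pb.
  move=> x y /asboolP Pxy; apply/orP.
  have [] := maximal_ideal_prime MP (integer_valP x) (integer_valP y) Pxy.
    by left; apply/asboolP.
  by right; apply/asboolP.
pose I : prime_idealr (integers K) := HB.pack Pb (GRing.isZmodClosed.Build _ Pb zc)
   (isProperIdeal.Build _ Pb pc) (isPrimeIdealrClosed.Build _ Pb prc).
by exists I.
Qed.

End Ideals.

(** * Inertia at an unramified prime *)

Section Inertia.
Local Open Scope quotient_scope.
Variables (K : fieldType) (S : embedding_system K) (P : K -> Prop).
Hypothesis MP : maximal_ideal P.

(** Reduction modulo P as a homomorphism to a field, which is the form required by
    integral_conjugates. *)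
Lemma residue_field : exists (k : fieldType) (pi : {rmorphism integers K -> k}),
  (forall z, (pi z == 0) = `[< P (integer_val z) >]).
Proof.
case: (MP) => IP P1 maxP; case: (IP) => PO P0 PD PM.
have [I PI] := maximal_prime_idealr MP.
pose Q : comNzRingType := {ideal_quot I}.
have piP (z : integers K) : (\pi_Q z == 0) = `[< P (integer_val z) >].
  by rewrite -PI -[z in RHS]subr0 Quotient.idealrBE -(rmorph0 (\pi_Q)).
have /choice[f fP] (x : Q) : exists y, (x != 0 -> y * x = 1) /\ (x = 0 -> y = 0).
  have [->|x0] := eqVneq x 0; first by exists 0; split.
  have [u ux] : exists u : integers K, \pi_Q u = x.
    by exists (generic_quotient.repr x); apply: reprK.
  have nPx : ~ P (integer_val u).
    by move=> Px; move: x0; rewrite -ux piP; move/asboolP.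
  have [p [c [Pp cO E]]] := maxP _ (integer_valP u) nPx.
  exists (\pi_Q (Integer cO)); split=> [_|x1]; last by move: x0; rewrite x1 eqxx.
  rewrite -ux -rmorphM; apply/eqP; rewrite -subr_eq0 -(rmorph1 \pi_Q) -rmorphB piP.
  apply/asboolP; rewrite -[integer_val _]/(\val _) rmorphB rmorphM rmorph1 /=.
  suff -> : c * integer_val u - 1 = - p by exact: ideal_opp.
  by rewrite E; ring.
(* Every nonzero class has an inverse by maximality of P. *)
pose k : fieldType := HB.pack Q (GRing.ComNzRing_isField.Build Q
  (fun x => (fP x).1) ((fP 0).2 erefl)).
by exists k, \pi_Q.
Qed.

(** Residue fields are finite, hence a power of Frobenius acts trivially on them;
    m is a power of the residue characteristic. *)
Lemma frobenius_fixed x a : P a -> a != 0 -> x \in Oint ->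
  exists m, P m%:R /\ P (x - x ^+ m).
Proof.
move=> Pa a0 xO; case: (MP) => IP P1 _; case: (IP) => PO P0 PD PM.
have aO := PO _ Pa.
have [Om [pi piP]] := residue_field.
(* P contains a nonzero integer; the least positive one is a prime number p. *)
have exm : exists m, (0 < m)%N && `[< P m%:R >].
  have [m [Dm ma]] := emb_norm_dvd S aO a0; exists (absz m).
  have m0 : m != 0 by rewrite -(intr_eq0 algC) -Dm emb_norm_neq0.
  rewrite absz_gt0 m0; apply/asboolP.
  have Pm := ideal_div IP Pa a0 ma.
  case: {Dm ma m0} m Pm => k Pk //.
  by rewrite -[_%:R]opprK; apply: ideal_opp.
case: (ex_minnP exm) => p /andP[p0 /asboolP Pp] minp.
have p_pr : prime p.
  apply/primeP; split.
    by rewrite ltn_neqAle p0 andbT; apply/eqP => p1; apply: P1; rewrite -[1]/(1%:R) p1.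
  move=> d /dvdnP[e De]; rewrite De natrM in Pp.
  have [d0 e0] : (0 < d)%N /\ (0 < e)%N by apply/andP; rewrite -muln_gt0 mulnC -De.
  have [Pe|Pd] := maximal_ideal_prime MP (rpred_nat _ _) (rpred_nat _ _) Pp.
    have : (p <= e)%N by apply: minp; rewrite e0; apply/asboolP.
    by rewrite De -{2}(muln1 e) leq_pmul2l // => d1; rewrite eqn_leq d1 d0.
  have : (p <= d)%N by apply: minp; rewrite d0; apply/asboolP.
  by move=> ld; apply/orP; right; rewrite eqn_leq ld andbT dvdn_leq // De dvdn_mull.
have charp : p \in [pchar Om].
  rewrite inE p_pr /= -(rmorph_nat pi) piP; apply/asboolP.
  by rewrite -[integer_val _]/(\val _) rmorph_nat.
have [T [key keyP]] := finite_quotient S aO a0.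
have [i [j [ltij eqf]]] := pigeonhole (fun i => key (x ^+ (p ^ i))).
have k0 : (0 < j - i)%N by rewrite subn_gt0.
exists (p ^ (j - i))%N; split.
  rewrite -(prednK k0) expnS mulnC natrM; apply: PM => //; exact: rpred_nat.
pose X := Integer xO.
have valX l : integer_val (X ^+ l) = x ^+ l.
  by rewrite -[integer_val _]/(\val _) rmorphXn.
have chq l : [pchar Om].-nat (p ^ l)%N.
  by rewrite pnatX pnatE // charp.
(* Modulo P, raising to the power p^i is injective and additive. *)
suff : (pi (X - X ^+ (p ^ (j - i)))) ^+ (p ^ i) == 0.
  rewrite expf_eq0 => /andP[_]; rewrite piP => /asboolP.
  by rewrite -[integer_val _]/(\val _) rmorphB /= -valX.
rewrite rmorphB exprDn_pchar // exprNn_pchar // -!rmorphXn -exprM -expnD subnK ?(ltnW ltij) //.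
rewrite -rmorphB piP; apply/asboolP; rewrite -[integer_val _]/(\val _) rmorphB /=.
rewrite -![\val _]/(integer_val _) !valX; apply: ideal_div IP Pa a0 _.
by apply: keyP; rewrite ?rpredX.
Qed.

(** The element w is a uniformizer at P fixed by tau. If tau is trivial modulo P,
    then y^n * (tau x - x) is integral for all n, where y is in the inverse of P and
    is not integral: an induction on n gains one factor y at each step. By
    almost_integral this forces tau x = x. *)
Lemma unramified_inertia_trivial (tau : {rmorphism K -> K}) (w : K) :
  P w -> tau w = w ->
  (forall u v u' v', P u -> P v -> P u' -> P v' -> w <> u * v + u' * v') ->
  (forall x, x \in Oint -> P (tau x - x)) ->
  forall x, x \in Oint -> tau x = x.
Proof.
move=> Pw tw sqw inert; case: (MP) => IP P1 maxP; case: (IP) => PO P0 PD PM.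
have w0 : w != 0 by apply/eqP => w0; apply: (sqw 0 0 0 0) => //; rewrite w0; ring.
have [y [p [p' [/negP yO yP Pp Pp' E]]]] := maximal_ideal_inverse S MP Pw w0.
have nPyw : ~ P (y * w).
  by move=> Pyw; apply: (sqw p w (y * w) p') => //; rewrite -[LHS]mul1r E; ring.
(* y w is a unit modulo P, so that each z in P is of the form q z + w v with
   q in P. *)
have [q [c [Pq cO E']]] := maxP _ (yP _ Pw) nPyw.
have tauO x : x \in Oint -> tau x \in Oint by rewrite Oint_rmorph.
have tauP x : P x -> P (tau x).
  by move=> Px; rewrite -(subrK x (tau x)); apply: PD => //; apply: inert; apply: PO.
have step n x : x \in Oint -> y ^+ n * (tau x - x) \in Oint.
  elim: n x => [|n IHn] x xO; first by rewrite mul1r rpredB ?tauO.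
  have [m [Pm Pz]] := frobenius_fixed Pw w0 xO.
  (* tau x - x = (tau x - x) s + (tau z - z) with s in P, and since tau fixes w,
     tau z - z is likewise a sum of terms of the form (element of P) * (tau v - v).
     Each element of P absorbs one factor y. *)
  set z := x - x ^+ m in Pz; have zO := PO _ Pz.
  pose s := \sum_(i < m) tau x ^+ (m.-1 - i) * x ^+ i.
  have Ps : P s.
    have -> : s = \sum_(i < m) (tau (x ^+ (m.-1 - i)) - x ^+ (m.-1 - i)) * x ^+ i + m%:R * x ^+ m.-1.
      have -> : m%:R * x ^+ m.-1 = \sum_(i < m) x ^+ m.-1.
        by rewrite sumr_const card_ord mulr_natl.
      rewrite -big_split; apply: eq_bigr => i _ /=.
      have lei : (i <= m.-1)%N by rewrite -ltnS prednK // (leq_trans _ (ltn_ord i)).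
      by rewrite -[X in _ = _ + x ^+ X](subnK lei) exprD rmorphXn; ring.
    apply: (PD); last by rewrite mulrC; apply: PM; rewrite ?rpredX.
    apply: (big_ind P) => // i _; rewrite mulrC; apply: PM; rewrite ?rpredX //.
    by apply: inert; rewrite rpredX.
  have -> : tau x - x = (tau x - x) * s + (tau z - z).
    have -> : (tau x - x) * s = tau (x ^+ m) - x ^+ m by rewrite rmorphXn subrXX.
    by rewrite /z rmorphB; ring.
  pose v := c * (y * z); have vO : v \in Oint by rewrite rpredM // yP.
  have Dz : z = q * z + w * v by rewrite -{1}[z]mul1r E' /v; ring.
  have -> : y ^+ n.+1 * ((tau x - x) * s + (tau z - z)) =
    (y ^+ n * (tau x - x)) * (y * s) + (y ^+ n * (tau q - q)) * (y * tau z) +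
    (y * q) * (y ^+ n * (tau z - z)) + (y * w) * (y ^+ n * (tau v - v)).
    have tDz : tau z = tau q * tau z + w * tau v by rewrite {1}Dz rmorphD !rmorphM /= tw.
    have Et : tau z - z = (tau q - q) * tau z + q * (tau z - z) + w * (tau v - v).
      by transitivity ((tau q * tau z + w * tau v) - (q * z + w * v)); [rewrite -tDz -Dz | ring].
    by rewrite {1}Et exprS; ring.
  have [zP qO] := (tauP _ Pz, PO _ Pq).
  by rewrite !rpredD // rpredM ?IHn ?yP.
move=> x xO; apply/eqP; rewrite -subr_eq0; apply/eqP; apply: contrapT => /eqP d0.
apply: yO; apply: (almost_integral S _ d0); first by rewrite rpredB ?tauO.
by move=> i; rewrite mulrC step.
Qed.

End Inertia.

(** * Ideal classes when the class number is odd *)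

Lemma even_involution (T : eqType) (f : T -> T) (s : seq T) : uniq s ->
  (forall x, x \in s -> [/\ f x \in s, f (f x) = x & f x <> x]) -> ~~ odd (size s).
Proof.
have [n] := ubnP (size s); elim: n s => // n IHn [|x s] //= sn /andP[xs us] fP.
have [] := fP x (mem_head _ _); rewrite inE => /predU1P[//|fxs] ffx nfx.
have s0 : (0 < size s)%N by case: (s) fxs.
have -> : odd (size s) = ~~ odd (size (rem (f x) s)).
  by rewrite size_rem // -{1}(prednK s0).
rewrite negbK; apply: IHn; rewrite ?rem_uniq //.
  by rewrite size_rem // -ltnS prednK // ltnW.
move=> y; rewrite mem_rem_uniq // !inE => /andP[yfx ys].
have [] := fP y; first by rewrite inE ys orbT.
move=> fys ffy nfy; split=> //; rewrite mem_rem_uniq // !inE.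
apply/andP; split.
  apply: contraNneq xs => /(congr1 f); rewrite ffx ffy => <- //.
move: fys; rewrite inE => /predU1P[fyx|//].
by move: yfx; rewrite -fyx ffy eqxx.
Qed.

Section ClassGroup.
Variables (F : fieldType) (S : embedding_system F).

(** The additive subgroup generated by the products, defined by its induction
    principle: this spares manipulations of finite families. *)
Definition ideal_product (A B : F -> Prop) : set F := fun x =>
  forall Q : F -> Prop, Q 0 -> (forall x y, Q x -> Q y -> Q (x + y)) ->
    (forall u v, A u -> B v -> Q (u * v)) -> Q x.

Lemma ideal_product0 A B : ideal_product A B 0. Proof. by move=> Q. Qed.
Lemma ideal_productD A B x y : ideal_product A B x -> ideal_product A B y ->
  ideal_product A B (x + y).
Proof. by move=> hx hy Q Q0 QD QM; exact: (QD _ _ (hx Q Q0 QD QM) (hy Q Q0 QD QM)). Qed.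
Lemma ideal_productM (A B : F -> Prop) u v : A u -> B v -> ideal_product A B (u * v).
Proof. by move=> Au Bv Q Q0 QD QM; apply: QM. Qed.

Variables (b : F -> Prop) (c0 : F).
Hypotheses (Ib : int_ideal b) (c00 : c0 != 0).
Hypothesis b2_sub : forall x y, b x -> b y -> x * y / c0 \in Oint.
Hypothesis b2_mem : ideal_product b b c0.

Let b_neq0 : exists2 x, b x & x != 0.
Proof.
apply: contrapT => none; move/eqP: c00; apply.
apply: (b2_mem (Q := fun x => x = 0)) => // [x y -> ->|u v bu bv]; first by rewrite addr0.
have [->|u0] := eqVneq u 0; first by rewrite mul0r.
by case: none; exists u.
Qed.

Lemma fractional_product (I : set F) : fractional_ideal I -> fractional_ideal (ideal_product b I).
Proof.
case: (Ib) => bO _ _ bM [[x Ix x0] ID IM [d d0 dI]]; split.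
- have [z bz z0] := b_neq0; exists (z * x); first exact: ideal_productM.
  by rewrite mulf_neq0.
- exact: ideal_productD.
- move=> a y Iy; apply: (Iy (fun y => ideal_product b I (integer_val a * y))).
  + by rewrite mulr0; exact: ideal_product0.
  + by move=> u v Iu Iv; rewrite mulrDr; apply: ideal_productD.
  by move=> u v bu Iv; rewrite mulrCA; apply: ideal_productM => //; apply: IM.
exists d => // y Iy; apply: (Iy (fun y => d * y \in Oint)).
- by rewrite mulr0 rpred0.
- by move=> u v du dv; rewrite mulrDr rpredD.
by move=> u v bu Iv; rewrite mulrCA rpredM ?dI ?bO.
Qed.

(** The product with b is defined on ideal classes. *)
Lemma scaled_product (I : set F) (c : F) :
  ideal_product b [set c * x | x in I]%classic = [set c * x | x in ideal_product b I]%classic.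
Proof.
apply/predeqP => x; split=> [Ix|[y Iy <-]].
  apply: (Ix (fun x => exists2 y, ideal_product b I y & c * y = x)).
  - by exists 0; [exact: ideal_product0 | rewrite mulr0].
  - by move=> _ _ [u Iu <-] [v Iv <-]; exists (u + v); [exact: ideal_productD | rewrite mulrDr].
  by move=> u _ bu [v Iv <-]; exists (u * v); [exact: ideal_productM | rewrite mulrCA].
apply: (Iy (fun y => ideal_product b [set c * x | x in I]%classic (c * y))).
- by rewrite mulr0; exact: ideal_product0.
- by move=> u v Iu Iv; rewrite mulrDr; apply: ideal_productD.
by move=> u v bu Iv; rewrite mulrCA; apply: ideal_productM => //; exists v.
Qed.

(** The hypotheses on b mean that its square is the principal ideal generated by c0. *)
Lemma square_product (I : set F) : fractional_ideal I ->
  ideal_product b (ideal_product b I) = [set c0 * x | x in I]%classic.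
Proof.
move=> [[x0 Ix0 _] ID IM _]; have I0 : I 0 by rewrite -(mul0r x0); apply: (IM 0).
apply/predeqP => x; split=> [Ix|[y Iy <-]].
  apply: (Ix (fun x => exists2 y, I y & c0 * y = x)).
  - by exists 0; rewrite ?mulr0.
  - by move=> _ _ [u Iu <-] [v Iv <-]; exists (u + v); rewrite ?mulrDr //; apply: ID.
  move=> u w bu Iw; apply: (Iw (fun w => exists2 y, I y & c0 * y = u * w)).
  - by exists 0; rewrite ?mulr0.
  - by move=> v v' [y Iy e] [y' Iy' e']; exists (y + y'); rewrite ?mulrDr ?e ?e' //; apply: ID.
  move=> v y bv Iy; exists (u * v / c0 * y); first exact: (IM (Integer (b2_sub bu bv))).
  by rewrite mulrA mulrCA mulfV // mulr1 mulrA.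
apply: (b2_mem (Q := fun c => ideal_product b (ideal_product b I) (c * y))).
- by rewrite mul0r; exact: ideal_product0.
- by move=> u v Iu Iv; rewrite mulrDl; apply: ideal_productD.
by move=> u v bu bv; rewrite -mulrA; apply: ideal_productM => //; exact: ideal_productM.
Qed.

Let mulb (C : set (set F)) : set (set F) := [set (ideal_product b J) | J in C]%classic.

Let mulb_class (I : set F) : mulb (ideal_class I) = ideal_class (ideal_product b I).
Proof.
apply/predeqP => J; split=> [[_ [c c_neq0 ->] <-]|[c c_neq0 ->]].
  by exists c; rewrite ?scaled_product.
by exists [set c * x | x in I]%classic; [exists c | rewrite scaled_product].
Qed.

Let scale_class (I : set F) (c : F) : c != 0 -> ideal_class [set c * x | x in I]%classic = ideal_class I.
Proof.
move=> c_neq0; apply/predeqP => J; split=> -[d d0 ->].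
  exists (d * c); rewrite ?mulf_neq0 //; apply/predeqP => x.
  split=> [[_ [y Iy <-] <-]|[y Iy <-]]; first by exists y; rewrite ?mulrA.
  by exists (c * y); [exists y | rewrite mulrA].
exists (d / c); rewrite ?mulf_neq0 ?invr_neq0 //; apply/predeqP => x.
split=> [[y Iy <-]|[_ [y Iy <-] <-]].
  by exists (c * y); [exists y | rewrite mulrA divfK].
by exists y => //; rewrite mulrA divfK.
Qed.

Lemma odd_class_number_fixes_class : odd (class_number F) ->
  exists2 I : set F, fractional_ideal I &
    exists2 c, c != 0 & ideal_product b I = [set c * x | x in I]%classic.
Proof.
move=> oddh; apply: contrapT => none.
have finC : finite_set (@ideal_classes F).
  apply: contrapT => inf; move: oddh; rewrite /class_number /fset_set.
  by case: pselect => [//|_]; rewrite cardfs0.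
move: oddh; apply/negP; rewrite /class_number.
(* Otherwise multiplication by b would be an involution without fixed point on
   an odd number of classes. *)
apply: (@even_involution _ mulb (enum_fset (fset_set (@ideal_classes F)))) => [|C].
  exact: fset_uniq.
have mem D : (D \in enum_fset (fset_set (@ideal_classes F))) = (D \in @ideal_classes F).
  exact: (in_fset_set finC).
rewrite !mem !in_setE => -[I fI <-].
have fbI := fractional_product fI.
split; first by rewrite mulb_class; exists (ideal_product b I).
  by rewrite !mulb_class square_product // scale_class.
rewrite mulb_class => E; apply: none; exists I => //.
have : ideal_class (ideal_product b I) (ideal_product b I).
  by exists 1; rewrite ?oner_neq0 //; apply/predeqP => x; split=> [Ix|[y Iy <-]];
     [exists x; rewrite ?mul1r | rewrite mul1r].
by rewrite E => -[c c_neq0 bI]; exists c.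
Qed.

(** A multiplier of a fractional ideal is integral, because all its powers have a
    common denominator. *)
Lemma scaled_ideal_almost_integral (I : set F) z : fractional_ideal I ->
  (forall x, I x -> I (z * x)) -> z \in Oint.
Proof.
move=> [[x Ix x0] _ _ [d d0 dI]] zI.
apply: (almost_integral S (dI _ Ix)); first by rewrite mulf_neq0.
move=> i; rewrite -mulrA dI //; elim: i => [|i IHi]; first by rewrite mulr1.
by rewrite exprS mulrCA; apply: zI.
Qed.

(** Multiplication by b fixes the class of some ideal I, so b I = c I for some c.
    Then b is the principal ideal generated by c; what is stated here are the
    consequences that c divides b and that c^2 and c0 are associate. *)
Lemma odd_class_number_principal : odd (class_number F) ->
  exists c, [/\ c != 0, forall x, b x -> x / c \in Oint,
     c0 / c ^+ 2 \in Oint & c ^+ 2 / c0 \in Oint].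
Proof.
move=> /odd_class_number_fixes_class[I fI [c c_neq0 bI]].
have c2I : [set c0 * x | x in I]%classic = [set c ^+ 2 * x | x in I]%classic.
  rewrite -square_product // bI scaled_product bI; apply/predeqP => x.
  split=> [[_ [y Iy <-] <-]|[y Iy <-]]; first by exists y; rewrite ?mulrA.
  by exists (c * y); [exists y | rewrite mulrA].
exists c; split=> // [x bx||].
- apply: (scaled_ideal_almost_integral fI) => y Iy.
  have : ideal_product b I (x * y) by apply: ideal_productM.
  by rewrite bI => -[z Iz e]; rewrite mulrAC -e mulrC mulKf.
- apply: (scaled_ideal_almost_integral fI) => y Iy.
  have : [set c0 * x | x in I]%classic (c0 * y) by exists y.
  by rewrite c2I => -[z Iz e]; rewrite mulrAC -e mulrC mulKf ?expf_neq0.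
apply: (scaled_ideal_almost_integral fI) => y Iy.
have : [set c ^+ 2 * x | x in I]%classic (c ^+ 2 * y) by exists y.
by rewrite -c2I => -[z Iz e]; rewrite mulrAC -e mulrC mulKf.
Qed.
End ClassGroup.

(** * Units of norm one are quotients of conjugate units *)

Lemma exists_integral_multiple (K : fieldType) (S : embedding_system K) (x : K) :
  exists2 m : int, m%:~R != 0 :> K & m%:~R * x \in Oint.
Proof.
have [c Dx] := gen_span S x.
pose m : int := \prod_j denq (c j).
exists m.
  by rewrite (intr_eq0_field S); apply/prodf_neq0 => j _; apply: denq_neq0.
rewrite Dx mulr_sumr rpred_sum // => j _; rewrite mulrA rpredM ?rpredX ?gen_int //.
suff -> : m%:~R * ratr (c j) = (numq (c j) * \prod_(i | i != j) denq (c i))%:~R :> K.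
  exact: rpred_int.
have d0 : (denq (c j))%:~R != 0 :> K by rewrite (intr_eq0_field S) denq_neq0.
rewrite /m (bigD1 j) //= !intrM mulrAC; congr (_ * _).
by rewrite /ratr mulrC divfK.
Qed.

Definition int_unit (K : fieldType) (u : K) := [&& u != 0, u \in Oint & u^-1 \in Oint].

Lemma int_unitM (K : fieldType) (u v : K) : int_unit u -> int_unit v -> int_unit (u * v).
Proof.
by move=> /and3P[u0 uO uVO] /and3P[v0 vO vVO]; rewrite /int_unit mulf_neq0 // invfM !rpredM.
Qed.

Lemma int_unitV (K : fieldType) (u : K) : int_unit u -> int_unit u^-1.
Proof. by move=> /and3P[u0 uO uVO]; rewrite /int_unit invrK invr_eq0 u0 uO uVO. Qed.

Lemma int_unit_rmorph (K L : fieldType) (f : {rmorphism K -> L}) u : int_unit (f u) = int_unit u.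
Proof. by rewrite /int_unit fmorph_eq0 -fmorphV !Oint_rmorph. Qed.

Section Quadratic.
Variables (F K : fieldType) (SF : embedding_system F) (SK : embedding_system K).
Variables (iota : {rmorphism F -> K}) (sigma : {rmorphism K -> K}).
Hypothesis sigmaK : forall x, sigma (sigma x) = x.
Hypothesis sigma_iota : forall y, sigma (iota y) = iota y.
Hypothesis sigma_fixed : forall x, sigma x = x -> exists y, x = iota y.
Hypothesis sigma_nontrivial : exists x, sigma x != x.

Variables (n : nat) (a x : 'I_n -> K).
Hypothesis aO : forall i, a i \in Oint.
Hypothesis xO : forall i, x i \in Oint.
Hypothesis etale : 1 = \sum_i a i * (x i - sigma (x i)).

(** The equation etale gives elements X_i and Y_i for which sum X_i Y_i = 1 and
    sum X_i (sigma Y_i) = 0. They split the descent from K to F. *)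
Let X (i : 'I_n.+1) := if unlift ord0 i is Some j then a j else - \sum_i a i * sigma (x i).
Let Y (i : 'I_n.+1) := if unlift ord0 i is Some j then x j else 1.

Let XO i : X i \in Oint.
Proof.
rewrite /X; case: unliftP => [j _|_]; first exact: aO.
by rewrite rpredN rpred_sum // => j _; rewrite rpredM ?Oint_rmorph.
Qed.

Let YO i : Y i \in Oint.
Proof. by rewrite /Y; case: unliftP => [j _|_]; rewrite ?xO ?rpred1. Qed.

Let sumXY : \sum_i X i * Y i = 1.
Proof.
rewrite big_ord_recl {1}/X {1}/Y unlift_none mulr1 etale.
have -> : \sum_(i < n) X (lift ord0 i) * Y (lift ord0 i) = \sum_i a i * x i.
  by apply: eq_bigr => i _; rewrite /X /Y liftK.
by rewrite addrC -sumrB; apply: eq_bigr => i _; ring.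
Qed.

Let sumXsY : \sum_i X i * sigma (Y i) = 0.
Proof.
rewrite big_ord_recl {1}/X {1}/Y unlift_none rmorph1 mulr1.
have -> : \sum_(i < n) X (lift ord0 i) * sigma (Y (lift ord0 i)) = \sum_i a i * sigma (x i).
  by apply: eq_bigr => i _; rewrite /X /Y liftK.
by rewrite addNr.
Qed.

(** Independence of the automorphisms 1 and sigma, in integral form. *)
Lemma norm_one_integral_multiplier eta : eta * sigma eta = 1 ->
  exists2 z, z \in Oint & z + eta * sigma z != 0.
Proof.
move=> eta1; have [etaN1|] := eqVneq (1 + eta) 0; last first.
  by move=> h; exists 1; rewrite ?rpred1 // rmorph1 mulr1.
have [w sw] := sigma_nontrivial; have [m m0 mw] := exists_integral_multiple SK w.
exists (m%:~R * w) => //; have -> : eta = -1 by apply/eqP; rewrite -addr_eq0 addrC etaN1.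
rewrite mulN1r subr_eq0 rmorphM rmorph_int (inj_eq (mulfI m0)) eq_sym //.
Qed.

(** Hilbert 90 gives eta = al / sigma al, with al = z + eta * sigma z. The ideal
    generated by al comes from an ideal b of F, whose square is generated by the
    norm c0 of al. As b is principal, al can be divided by a generator of b to
    give a unit. *)
Lemma norm_one_unit_is_quotient eta : odd (class_number F) ->
  eta \in Oint -> eta * sigma eta = 1 ->
  exists2 u, int_unit u & eta = u / sigma u.
Proof.
move=> oddh etaO eta1.
have [z zO] := norm_one_integral_multiplier eta1; set al := z + _ => al0.
have eta0 : eta != 0 by apply: contraTneq (oner_neq0 K) => e; rewrite -eta1 e mul0r eqxx.
have etasal : eta * sigma al = al.
  by rewrite rmorphD rmorphM sigmaK mulrDr mulrA eta1 mul1r addrC.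
have sal0 : sigma al != 0 by rewrite fmorph_eq0.
have salO : sigma al \in Oint by rewrite Oint_rmorph rpredD // rpredM // Oint_rmorph.
have alO : al \in Oint by rewrite -(Oint_rmorph sigma).
have [c0 Dc0] : exists c0, al * sigma al = iota c0.
  by apply: sigma_fixed; rewrite rmorphM sigmaK mulrC.
have c00 : c0 != 0 by rewrite -(fmorph_eq0 iota) -Dc0 mulf_neq0.
(* b is the ideal of F whose extension to K is generated by al. *)
pose b y := y \in Oint /\ iota y / al \in Oint.
have Ib : int_ideal b.
  split=> [y []||y y' [yO ya] [yO' ya']|c y cO [yO ya]] //.
  - by split; rewrite ?rpred0 // rmorph0 mul0r rpred0.
  - by split; rewrite ?rpredD // rmorphD mulrDl rpredD.
  by split; [rewrite rpredM | rewrite rmorphM -mulrA rpredM // Oint_rmorph].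
have b2_sub y y' : b y -> b y' -> y * y' / c0 \in Oint.
  move=> [yO ya] [yO' ya']; rewrite -(Oint_rmorph iota) fmorph_div rmorphM -Dc0.
  have -> : iota y * iota y' / (al * sigma al) = (iota y / al) * sigma (iota y' / al).
    by rewrite fmorph_div sigma_iota invfM; ring.
  by rewrite rpredM // Oint_rmorph.
(* The traces t_i of Y_i al lie in b, and the relations on X and Y express al
   through them. *)
have /choice[t tE] i : exists t, Y i * al + sigma (Y i * al) = iota t.
  by apply: sigma_fixed; rewrite rmorphD sigmaK addrC.
have bt i : b (t i).
  split; rewrite -?(Oint_rmorph iota) -tE rmorphM.
    by rewrite rpredD // rpredM ?Oint_rmorph.
  have -> : (Y i * al + sigma (Y i) * sigma al) / al = Y i + sigma (Y i) * sigma eta.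
    have -> : sigma al = sigma eta * al by rewrite -{1}etasal rmorphM sigmaK.
    by field.
  by rewrite rpredD // rpredM ?Oint_rmorph.
have al_sum : al = \sum_i X i * iota (t i).
  transitivity (\sum_i (X i * Y i * al + X i * sigma (Y i) * sigma al)).
    by rewrite big_split /= -!mulr_suml sumXY sumXsY mul1r mul0r addr0.
  by apply: eq_bigr => i _; rewrite -tE rmorphM; ring.
(* J is b^2 / c0; its extension to K contains 1, because al * sigma al = c0 and
   al is a combination of elements of b. *)
pose J y := ideal_product b b (y * c0).
have IJ : int_ideal J.
  split=> [y Jy||y y' Jy Jy'|c y cO Jy].
  - rewrite -(mulfK c00 y); apply: (Jy (fun w => w / c0 \in Oint)).
    + by rewrite mul0r rpred0.
    + by move=> u v hu hv; rewrite mulrDl rpredD.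
    by move=> u v bu bv; apply: b2_sub.
  - by rewrite /J mul0r; exact: ideal_product0.
  - by rewrite /J mulrDl; apply: ideal_productD.
  rewrite /J -mulrA; apply: (Jy (fun w => ideal_product b b (c * w))).
  - by rewrite mulr0; exact: ideal_product0.
  - by move=> u v hu hv; rewrite mulrDr; apply: ideal_productD.
  by move=> u v bu bv; rewrite mulrA; apply: ideal_productM => //; case: Ib => _ _ _; apply.
have b2_mem : ideal_product b b c0.
  rewrite -[c0]mul1r.
  apply: (ideal_going_down SF (iota := iota) (J := J) (I := ('I_n.+1 * 'I_n.+1)%type)
    (c := fun ij => X ij.1 * sigma (X ij.2)) (j := fun ij => t ij.1 * t ij.2 / c0)) => //.
  - by move=> ij; rewrite rpredM ?Oint_rmorph.
  - by move=> ij; rewrite /J divfK //; apply: ideal_productM.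
  have ic0 : iota c0 != 0 by rewrite fmorph_eq0.
  apply: (mulIf ic0); rewrite mul1r -Dc0 {2}al_sum rmorph_sum {1}al_sum /=.
  rewrite big_distrlr /= pair_big /= mulr_suml; apply: eq_bigr => ij _.
  by rewrite Dc0 fmorph_div [iota (t _ * t _)]rmorphM [sigma (X _ * _)]rmorphM sigma_iota; field.
have [c [c_neq0 bc c0c cc0]] := odd_class_number_principal SF Ib c00 b2_sub b2_mem oddh.
have ic0 : iota c != 0 by rewrite fmorph_eq0.
pose u := al / iota c.
have uO : u \in Oint.
  rewrite /u al_sum mulr_suml rpred_sum // => i _.
  by rewrite -mulrA -fmorph_div rpredM // Oint_rmorph bc.
have u0 : u != 0 by rewrite mulf_neq0 ?invr_eq0.
have su : sigma u = sigma al / iota c by rewrite fmorph_div sigma_iota.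
exists u; last first.
  by rewrite su /u -{1}etasal; field; rewrite ic0.
apply/and3P; split=> //.
have -> : u^-1 = sigma u * iota (c ^+ 2 / c0).
  rewrite su fmorph_div rmorphXn -Dc0 /u; field; rewrite al0 sal0 ic0 //.
by rewrite rpredM ?Oint_rmorph.
Qed.
End Quadratic.

(** * Units with prescribed absolute values *)

(** Absolute values are compared on a logarithmic scale, to base 2 and with integer
    exponents. *)
Definition pow2 (k : int) : algC := 2%:R ^ k.

Lemma pow2_gt0 k : 0 < pow2 k. Proof. by rewrite exprz_gt0 // ltr0n. Qed.
Lemma pow2_ge0 k : 0 <= pow2 k. Proof. exact/ltW/pow2_gt0. Qed.
Lemma pow2_neq0 k : pow2 k != 0. Proof. exact/lt0r_neq0/pow2_gt0. Qed.
Lemma pow2D k l : pow2 (k + l) = pow2 k * pow2 l.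
Proof. by rewrite /pow2 expfzDr // pnatr_eq0. Qed.
Lemma pow2N k : pow2 (- k) = (pow2 k)^-1. Proof. by rewrite /pow2 invr_expz. Qed.
Lemma pow2_nat (k : nat) : pow2 k = (2 ^ k)%:R.
Proof. by rewrite natrX. Qed.
Lemma pow2_lt_homo k l : k < l -> pow2 k < pow2 l.
Proof.
move=> ltkl; have -> : l = k + (absz (l - k))%:Z by lia.
rewrite pow2D -[X in X < _]mulr1 ltr_pM2l ?pow2_gt0 // pow2_nat ltr1n -{1}(expn0 2) ltn_exp2l //; lia.
Qed.
Lemma pow2_lt k l : (pow2 k < pow2 l) = (k < l).
Proof.
have [/pow2_lt_homo //|/pow2_lt_homo/ltW/le_gtF //|->] := ltgtP k l; exact: ltxx.
Qed.
Lemma pow2_le k l : (pow2 k <= pow2 l) = (k <= l).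
Proof.
have [/pow2_lt_homo/ltW //|/pow2_lt_homo/lt_geF //|->] := ltgtP k l; exact: lexx.
Qed.
Lemma pow2_sum (I : finType) (P : pred I) (f : I -> int) :
  pow2 (\sum_(i | P i) f i) = \prod_(i | P i) pow2 (f i).
Proof. exact: (big_morph pow2 pow2D (expr0z _)). Qed.

Lemma pow2_bound (z : algC) : exists c : nat, `|z| <= pow2 c.
Proof.
exists (Num.bound `|z|); apply: le_trans (ltW (archi_boundP (normr_ge0 z))) _.
by rewrite pow2_nat ler_nat ltnW // ltn_expl.
Qed.

Section Units.
Variables (K : fieldType) (S : embedding_system K).
Local Notation n := (deg S).
Local Notation theta := (gen S).
Local Notation phi := (emb (e := S)).

Lemma gen_free (c : 'I_n -> algC) :
  (forall i, \sum_j c j * phi i theta ^+ j = 0) -> forall j, c j = 0.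
Proof.
move=> c0 j; pose v : 'rV_n := \row_j c j.
have : v *m Vandermonde n (\row_j phi j theta) = 0.
  by apply/rowP => i; rewrite !mxE -[RHS](c0 i); apply: eq_bigr => k _; rewrite !mxE.
move/(congr1 (fun u => u *m invmx (Vandermonde n (\row_j phi j theta)))).
rewrite mul0mx mulmxK ?V_unit // => /rowP/(_ j); by rewrite !mxE.
Qed.

Lemma emb_conj i : exists j, forall x, phi j x = (phi i x)^*.
Proof.
have [j jE] := emb_complete S [the {rmorphism K -> algC} of Num.conj \o phi i].
by exists j => x; rewrite -jE.
Qed.

Definition conj_emb i := sval (cid (emb_conj i)).
Lemma conj_embE i x : phi (conj_emb i) x = (phi i x)^*. Proof. exact: (svalP (cid (emb_conj i))). Qed.
Lemma emb_inj i j : phi i theta = phi j theta -> i = j.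
Proof. exact: emb_gen_inj. Qed.
Lemma conj_embK : involutive conj_emb.
Proof. by move=> i; apply: emb_inj; rewrite !conj_embE conjCK. Qed.

(** Real coordinates on K: the real part for one of two conjugate embeddings and
    the imaginary part for the other one. *)
Let l i x := if 0 <= 'Im (phi i theta) then 'Re (phi i x) else 'Im (phi i x).

Let l_real i x : l i x \is Num.real.
Proof. by rewrite /l; case: ifP => _; rewrite ?Creal_Re ?Creal_Im. Qed.

Let lB i x y : l i (x - y) = l i x - l i y.
Proof. by rewrite /l; case: ifP => _; rewrite rmorphB raddfB. Qed.

Lemma norm_Re (z : algC) : `|'Re z| <= `|z|.
Proof. by have [] := leif_normC_Re_Creal z. Qed.
Lemma norm_Im (z : algC) : `|'Im z| <= `|z|.
Proof.
have := norm_Re ('i * z); rewrite ReMil normrN normrM normCi mul1r //.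
Qed.

Let l_le i x : `|l i x| <= `|phi i x|.
Proof. by rewrite /l; case: ifP => _; rewrite ?norm_Re ?norm_Im. Qed.

Let le_l i x : `|phi i x| <= `|l i x| + `|l (conj_emb i) x|.
Proof.
have tri (z : algC) : `|z| <= `|'Re z| + `|'Im z|.
  by rewrite {1}[z]Crect; apply: le_trans (ler_normD _ _) _; rewrite normrM normCi mul1r.
have [Im0|Im0] := eqVneq ('Im (phi i theta)) 0.
  have ci : conj_emb i = i by apply: emb_inj; rewrite conj_embE; apply/CrealP/Creal_ImP.
  have xr : phi i x \is Num.real by apply/CrealP; rewrite -conj_embE ci.
  by rewrite /l Im0 lexx (Creal_ReP _ xr) ler_wpDr.
rewrite /l !conj_embE Re_conj !Im_conj oppr_ge0.
have [ge|lt] := real_ge0P (Creal_Im (phi i theta)).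
  have /lt_geF -> : 0 < 'Im (phi i theta) by rewrite lt_def Im0 ge.
  by rewrite normrN.
by rewrite (ltW lt) addrC.
Qed.

(** Minkowski's theorem for the box with sides 2^(w_i + q), by the pigeonhole
    principle. *)
Lemma small_integers : exists q : nat, forall w : 'I_n -> int,
  (forall i, w (conj_emb i) = w i) -> \sum_i w i = 0 ->
  exists x, [/\ x \in Oint, x != 0 & forall i, `|phi i x| <= pow2 (w i + q)].
Proof.
have [c cE] := pow2_bound (\sum_i \sum_(j < n) `|phi i theta| ^+ j).
exists (c + 3)%N => w wc w0.
(* The box: sums of a_j theta^j with 0 <= a_j <= 2^E give (2^E + 1)^n points;
   their coordinates l_i are cut into 2^(E - w_i) cells of length about 2^w_i,
   hence there are 2^(n E) cells as the w_i add up to zero. *)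
pose E := (\sum_i absz (w i)).+1.
have Ew i : (w i + 1 <= E)%R.
  rewrite /E (bigD1 i) //=; lia.
pose H := (2 ^ E)%N.
pose xs (a : {ffun 'I_n -> 'I_H.+1}) : K := \sum_j (a j)%:R * theta ^+ j.
pose del i := pow2 (w i + c + 2).
have xs_le i a : `|l i (xs a)| <= pow2 (c%:Z + E%:Z).
  apply: le_trans (l_le _ _) _; rewrite rmorph_sum /=.
  apply: le_trans (ler_norm_sum _ _ _) _.
  apply: (@le_trans _ _ (\sum_(j < n) pow2 E * `|phi i theta| ^+ j)).
    apply: ler_sum => j _; rewrite rmorphM rmorphXn normrM normrX rmorph_nat normr_nat.
    by rewrite ler_wpM2r ?exprn_ge0 // pow2_nat ler_nat -ltnS.
  rewrite -mulr_sumr addrC pow2D ler_wpM2l ?pow2_ge0 //; apply: le_trans cE.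
  rewrite [X in _ <= X]ger0_norm; last by do 2!(apply: sumr_ge0 => ? _); rewrite exprn_ge0.
  rewrite [X in _ <= X](bigD1 i) //= lerDl; do 2!(apply: sumr_ge0 => ? _); by rewrite exprn_ge0.
pose y i a := (l i (xs a) + pow2 (c%:Z + E%:Z)) / del i.
have y_ge0 i a : 0 <= y i a.
  rewrite divr_ge0 ?pow2_ge0 // -lerBlDr sub0r.
  by have := xs_le i a; rewrite real_ler_norml ?l_real // => /andP[].
pose e i := absz (E - w i).
have y_lt i a : y i a < (2 ^ e i)%:R.
  rewrite -pow2_nat ltr_pdivrMr ?pow2_gt0 // -pow2D.
  apply: (@le_lt_trans _ _ (pow2 (c%:Z + E%:Z + 1))).
    rewrite [X in _ <= X]pow2D /pow2 -[_ ^ 1]/(2%:R : algC) mulr_natr mulr2n lerD2r.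
    by have := xs_le i a; rewrite real_ler_norml ?l_real // => /andP[].
  by rewrite pow2_lt; have := Ew i; rewrite /e; lia.
have cell_lt i a : (Num.truncn (y i a) < 2 ^ e i)%N by rewrite truncn_lt_nat.
pose cell a : {dffun forall i : 'I_n, 'I_(2 ^ e i)} := [ffun i => Ordinal (cell_lt i a)].
have /injectivePn[a [b neqab eqc]] : ~~ injectiveb cell.
  apply/negP => /injectiveP/leq_card; rewrite leqNgt => /negP; apply.
  rewrite card_dep_ffun card_ffun !card_ord.
  have -> : foldr muln 1%N [seq #|'I_(2 ^ e x)| | x : 'I_n] = (2 ^ (\sum_i e i))%N.
    by rewrite foldrE big_image expn_sum; apply: eq_bigr => i _; rewrite card_ord.
  have -> : (\sum_i e i)%N = (E * n)%N.
    apply/eqP; rewrite -eqz_nat PoszM (big_morph Posz PoszD (erefl _)).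
    have eE i : (e i)%:Z = E%:Z - w i by rewrite /e; have := Ew i; lia.
    rewrite (eq_bigr _ (fun i _ => eE i)) sumrB w0 subr0 sumr_const card_ord.
    by rewrite -mulr_natr natz.
  by rewrite expnM ltn_exp2r ?deg_gt0.
exists (xs a - xs b); split.
- by rewrite rpredB // rpred_sum // => j _; rewrite rpredM ?rpred_nat ?rpredX ?gen_int.
- apply: contraNneq neqab => /eqP; rewrite subr_eq0 => /eqP xab.
  apply/eqP/ffunP => j; apply/val_inj/eqP.
  rewrite -(@eqr_nat algC) -subr_eq0; apply/eqP.
  apply: (gen_free (c := fun j => (a j)%:R - (b j)%:R)) => i.
  transitivity (phi i (xs a - xs b)); last by rewrite xab subrr rmorph0.
  rewrite rmorphB !rmorph_sum -sumrB; apply: eq_bigr => k _.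
  by rewrite !rmorphM !rmorph_nat rmorphXn mulrBl.
have l_lt i : `|l i (xs a - xs b)| <= del i.
  rewrite lB -[X in X <= _](_ : `|(y i a - y i b) * del i| = _); last first.
    by congr `|_|; rewrite /y; field; rewrite pow2_neq0.
  rewrite normrM (gtr0_norm (pow2_gt0 _)) -[X in _ <= X]mul1r ler_wpM2r ?pow2_ge0 //.
  have := congr1 (fun f : {dffun forall i : 'I_n, 'I_(2 ^ e i)} => val (f i)) eqc.
  rewrite !ffunE /= => ct.
  have /andP[a1 a2] := truncn_itv (y_ge0 i a); have /andP[b1 b2] := truncn_itv (y_ge0 i b).
  have [yar ybr] : y i a \is Num.real /\ y i b \is Num.real by rewrite !ger0_real.
  rewrite real_ler_norml ?rpredB // lerBrDr lerBlDr; apply/andP; split.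
    by rewrite addrC lerBlDr; apply: le_trans (ltW b2) _; rewrite -ct -natr1 lerD2r.
  by apply: le_trans (ltW a2) _; rewrite ct -natr1 addrC lerD2l.
move=> i; apply: le_trans (le_l _ _) _; apply: le_trans (lerD (l_lt _) (l_lt _)) _.
have -> : w i + (c + 3)%N = w i + c + 2 + 1 by lia.
by rewrite /del wc (pow2D _ 1) {4}/pow2 expr1z mulr_natr mulr2n lexx.
Qed.

Lemma emb_norm_ge1 x : x \in Oint -> x != 0 -> 1 <= `|emb_norm S x|.
Proof. by move=> xO x0; rewrite norm_intr_ge1 ?emb_norm_int ?emb_norm_neq0. Qed.

(** If two such integers are congruent modulo 2^(X+2), then their difference divided by
    2^(X+2) is an integer with all conjugates smaller than 1, hence is zero. *)
Lemma bounded_integers_finite (X : nat) : exists M, forall s : seq K, uniq s ->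
  (forall x, x \in s -> x \in Oint /\ forall i, `|phi i x| <= pow2 X) -> (size s <= M)%N.
Proof.
pose m : K := (2 ^ (X + 2))%:R.
have m0 : m != 0.
  by rewrite /m pmulrn (intr_eq0_field S) -lt0n expn_gt0.
have [T [key keyP]] := finite_quotient S (rpred_nat _ _ : m \in Oint) m0.
exists #|T| => s us sP; rewrite -(size_map key) cardE; apply: uniq_leq_size; last first.
  by move=> t _; rewrite mem_enum.
rewrite map_inj_in_uniq // => x y xs ys kxy.
have [[xO xX] [yO yX]] := (sP x xs, sP y ys).
have zO := keyP x y xO yO kxy; set z := (x - y) / m in zO.
apply/eqP; rewrite -subr_eq0 -(divfK m0 (x - y)) -/z mulf_eq0 (negPf m0) orbF.
apply/eqP; apply: contrapT => /eqP z0; have := emb_norm_ge1 zO z0.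
apply/negP; rewrite -real_ltNge ?normr_real ?real1 //.
rewrite /emb_norm normr_prod.
have z_lt i : `|phi i z| <= 2^-1.
  rewrite /z fmorph_div rmorph_nat normrM normfV normr_nat -pow2_nat ler_pdivrMr ?pow2_gt0 //.
  rewrite rmorphB; apply: le_trans (ler_normB _ _) _; apply: le_trans (lerD (xX i) (yX i)) _.
  have -> : (X + 2)%N%:Z = X%:Z + 1 + 1 by lia.
  by rewrite !(pow2D _ 1) /pow2 expr1z mulrCA mulVf ?pnatr_eq0 // mulr1 mulr_natr mulr2n lexx.
apply: (@le_lt_trans _ _ (\prod_(i < n) 2^-1)).
  by apply: ler_prod => i _; rewrite normr_ge0 z_lt.
by rewrite prodr_const card_ord exprVn invf_lt1 ?exprn_gt0 ?ltr0n // exprn_egt1 ?ltr1n // -lt0n deg_gt0.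
Qed.

Lemma emb_norm_unit u : int_unit u -> `|emb_norm S u| = 1.
Proof.
move=> /and3P[u0 uO uVO]; apply/eqP; rewrite eq_le emb_norm_ge1 // andbT.
have := emb_norm_ge1 uVO; rewrite invr_eq0 => /(_ u0).
have -> : emb_norm S u^-1 = (emb_norm S u)^-1.
  by rewrite /emb_norm -prodfV; apply: eq_bigr => i _; rewrite fmorphV.
by rewrite normfV invf_ge1 // normr_gt0 emb_norm_neq0.
Qed.

Definition height_le (h : nat) (u : K) := forall i, pow2 (- h%:Z) <= `|phi i u| <= pow2 h.

Lemma exists_height u : u != 0 -> exists h, height_le h u.
Proof.
move=> u0; have /choice[h1 h1P] i := pow2_bound (phi i u).
have /choice[h2 h2P] i := pow2_bound (phi i u)^-1.
exists (\max_i maxn (h1 i) (h2 i))%N => i.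
have hi := leq_bigmax (F := fun i => maxn (h1 i) (h2 i)) i.
apply/andP; split; last first.
  by apply: le_trans (h1P i) _; rewrite pow2_le lez_nat; apply: leq_trans hi; rewrite leq_maxl.
rewrite pow2N -[ `|_|]invrK lef_pV2 ?posrE ?invr_gt0 ?normr_gt0 ?fmorph_eq0 ?pow2_gt0 //.
rewrite -normfV; apply: le_trans (h2P i) _.
by rewrite pow2_le lez_nat; apply: leq_trans hi; rewrite leq_maxr.
Qed.

(** The pigeonhole argument of Dirichlet's unit theorem. The integers given by
    small_integers have bounded norms, so each of them is associate to one of
    finitely many representatives, and its quotient by the representative is the
    required unit. *)
Lemma unit_near : exists C : nat, forall w : 'I_n -> int,
  (forall i, w (conj_emb i) = w i) -> \sum_i w i = 0 ->
  exists2 u : K, int_unit u & forall i, pow2 (w i - C%:Z) <= `|phi i u| <= pow2 (w i + C%:Z).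
Proof.
have [q smallP] := small_integers.
(* The integers x of small_integers have norm at most B, so they divide a = B!.
   Two of them which are congruent modulo a divide each other. *)
pose B := (2 ^ (n * q))%N.
pose a : K := B`!%:R.
have a0 : a != 0 by rewrite /a pmulrn (intr_eq0_field S) -lt0n fact_gt0.
have [T [key keyP]] := finite_quotient S (rpred_nat _ _ : a \in Oint) a0.
pose good x := [/\ x \in Oint, x != 0 & `|emb_norm S x| <= B%:R].
have good_div x : good x -> a / x \in Oint.
  move=> [xO x0 nx]; have [m [Dm mx]] := emb_norm_dvd S xO x0.
  have m0 : m != 0 by rewrite -(intr_eq0 algC) -Dm emb_norm_neq0.
  have mK : m%:~R != 0 :> K by rewrite (intr_eq0_field S).
  have /dvdnP[d Dd] : (absz m %| B`!)%N.
    apply: dvdn_fact; rewrite absz_gt0 m0 /=.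
    by rewrite -(ler_nat algC) natr_absz intr_norm -Dm.
  have -> : a / x = d%:R * ((absz m)%:R / m%:~R) * (m%:~R / x).
    by rewrite /a Dd natrM; field; rewrite x0 mK.
  rewrite rpredM // rpredM ?rpred_nat //.
  case: (intP m) mK => [|k|k] mK; rewrite ?mul0r ?rpred0 ?abszN //.
    by rewrite mulfV // rpred1.
  move: mK; rewrite mulrNz oppr_eq0 => mK.
  by rewrite invrN mulrN rpredN mulfV // rpred1.
have /choice[r rP] (t : T) : exists r, (exists2 x, good x & key x = t) -> good r /\ key r = t.
  have [[x gx kx]|none] := EM (exists2 x, good x & key x = t); first by exists x.
  by exists 0.
have /choice[h hP] (t : T) : exists h, r t != 0 -> height_le h (r t).
  have [->|rt0] := eqVneq (r t) 0; first by exists 0%N.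
  by have [h hP] := exists_height rt0; exists h.
pose C := (\max_t h t)%N.
exists (n * q + C)%N => w wc w0; have [x [xO x0 xw]] := smallP w wc w0.
have sumq : \sum_i (w i + q) = (n * q)%N by rewrite big_split /= w0 add0r sumr_const card_ord; lia.
have gx : good x.
  split=> //; rewrite /emb_norm normr_prod -pow2_nat -sumq pow2_sum.
  by apply: ler_prod => i _; rewrite normr_ge0 xw.
have [gr kr] := rP (key x) (ex_intro2 _ _ x gx erefl).
set y := r (key x) in gr kr; have [yO y0 ny] := gr.
have quo z t : good z -> good t -> key z = key t -> z / t \in Oint.
  move=> gz gt kzt; have [[zO z0 _] [tO t0 _]] := (gz, gt).
  have -> : z / t = 1 + (z - t) / a * (a / t) by field; rewrite t0 a0.
  by rewrite rpredD ?rpred1 // rpredM ?good_div // keyP.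
exists (x / y).
  by apply/and3P; split; rewrite ?mulf_neq0 ?invr_eq0 // ?invf_div; apply: quo.
(* All absolute values are bounded above and their product is at least 1, so
   each of them is bounded below. *)
have xlow i : pow2 (w i - (n * q)%N%:Z) <= `|phi i x|.
  have := emb_norm_ge1 xO x0; rewrite /emb_norm normr_prod (bigD1 i) //= => ge1.
  have le1 : 1 <= `|phi i x| * pow2 ((n * q)%N%:Z - w i).
    apply: le_trans ge1 _; rewrite ler_wpM2l //.
    apply: (@le_trans _ _ (\prod_(j | j != i) pow2 (w j + q))).
      by apply: ler_prod => j _; rewrite normr_ge0 xw.
    rewrite -pow2_sum pow2_le.
    have := sumq; rewrite (bigD1 i) //= => /esym/eqP; rewrite addrC -subr_eq => /eqP <-.
    lia.
  by rewrite -opprB pow2N -[X in X <= _]mul1r ler_pdivrMr ?pow2_gt0.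
have hy i : pow2 (- C%:Z) <= `|phi i y| <= pow2 C.
  have /andP[h1 h2] := hP (key x) y0 i.
  have hC : (h (key x) <= C)%N by apply: leq_bigmax.
  by apply/andP; split; [apply: le_trans h1 | apply: le_trans h2 _]; rewrite pow2_le; lia.
move=> i; have /andP[y1 y2] := hy i.
have py : 0 < `|phi i y| by rewrite normr_gt0 fmorph_eq0.
rewrite fmorph_div normrM normfV ler_pdivlMr // ler_pdivrMr //; apply/andP; split.
  apply: le_trans (xlow i); apply: le_trans (ler_wpM2l (pow2_ge0 _) y2) _.
  by rewrite -pow2D pow2_le; lia.
apply: le_trans (xw i) _; apply: le_trans (ler_wpM2l (pow2_ge0 _) y1).
rewrite -pow2D pow2_le; have : (q <= n * q)%N by rewrite leq_pmull ?deg_gt0.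
lia.
Qed.
End Units.

(** * Counting units by height *)

Lemma fiber_bound (A B : eqType) (s : seq A) (t : seq B) (f : A -> B) M :
  (forall x, x \in s -> f x \in t) ->
  (forall y, y \in t -> (size [seq x <- s | f x == y] <= M)%N) ->
  (size s <= M * size t)%N.
Proof.
elim: t s => [|y t IHt] s st fib; first by case: s st {fib} => [|x s] // /(_ x (mem_head _ _)).
rewrite -(count_predC (fun x => f x == y)) -!size_filter /= mulnS leq_add //.
  by apply: fib; rewrite mem_head.
apply: IHt => [x|z zt].
  by rewrite mem_filter => /andP[/= nxy /st]; rewrite inE (negPf nxy).
apply: leq_trans (fib z _); last by rewrite inE zt orbT.
rewrite -filter_predI !size_filter; apply: sub_count => x /= /andP[] //.
Qed.

(** By Bernoulli's inequality, (1 + 1/q)^k outgrows every constant A. *)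
Lemma exponential_growth_bound (d q A : nat) : (0 < q)%N ->
  (forall k, d ^ k <= A * q ^ k)%N -> (d <= q)%N.
Proof.
move=> q0 dA; rewrite leqNgt; apply/negP => ltqd.
have bern k : (q ^ k * (q + k) <= q * d ^ k)%N.
  apply: (@leq_trans (q * q.+1 ^ k)); last first.
    by case: k => [|k]; rewrite ?expn0 // leq_mul2l leq_exp2r // ltqd orbT.
  elim: k => [|k IHk]; first by rewrite !expn0 addn0 mul1n muln1.
  rewrite !expnS; nia.
have := bern (q * A).+1; have := dA (q * A).+1.
move: (q ^ _)%N (expn_gt0 q (q * A).+1) => e; rewrite q0 /= => e0; nia.
Qed.

(** The bound provides a family of inequivalent elements of maximal size, and then each
    element is equivalent to a member of it. *)
Lemma maximal_inequivalent (T : eqType) (Q : T -> Prop) (E : T -> T -> Prop) M :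
  (forall s : seq T, uniq s -> (forall x, x \in s -> Q x) ->
     (forall x y, x \in s -> y \in s -> x <> y -> ~ E x y) -> (size s <= M)%N) ->
  (forall x y, E x y -> E y x) -> (forall x, E x x) ->
  exists s : seq T, [/\ (size s <= M)%N, forall x, x \in s -> Q x &
    forall x, Q x -> exists2 y, y \in s & E x y].
Proof.
move=> bound Esym Erefl.
pose good s := [/\ uniq s, forall x, x \in s -> Q x &
     forall x y, x \in s -> y \in s -> x <> y -> ~ E x y].
pose sz m := `[< exists2 s, good s & size s = m >].
have ex0 : exists m, sz m by exists 0%N; apply/asboolP; exists [::].
have le m : sz m -> (m <= M)%N.
  by move=> /asboolP[s [us Qs Es] <-]; apply: bound.
case: (ex_maxnP ex0 le) => _ /asboolP[s [us Qs Es] <-] maxs.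
exists s; split=> // [|x Qx]; first exact: bound.
apply: contrapT => none.
have xs : x \notin s by apply/negP => xs; apply: none; exists x.
have : sz (size s).+1; last by move/maxs; rewrite ltnn.
apply/asboolP; exists (x :: s) => //; split.
- by rewrite /= xs.
- by move=> y; rewrite inE => /predU1P[->|/Qs].
move=> y z; rewrite !inE => /predU1P[->|ys] /predU1P[->|zs] nyz //.
- by move=> Exz; apply: none; exists z.
- by move=> Eyx; apply: none; exists y => //; apply: Esym.
exact: Es.
Qed.

Section Heights.
Variables (K : fieldType) (S : embedding_system K).
Local Notation n := (deg S).
Local Notation phi := (emb (e := S)).
Local Notation height_le := (height_le S).

Lemma height_leM h k u v : height_le h u -> height_le k v -> height_le (h + k) (u * v).
Proof.
move=> hu kv i; have [/andP[u1 u2] /andP[v1 v2]] := (hu i, kv i).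
rewrite rmorphM normrM PoszD opprD !pow2D.
by rewrite !ler_pM ?pow2_ge0.
Qed.

Lemma height_leW h k u : (h <= k)%N -> height_le h u -> height_le k u.
Proof.
move=> lehk hu i; have /andP[u1 u2] := hu i.
by apply/andP; split; [apply: le_trans u1 | apply: le_trans u2 _]; rewrite pow2_le; lia.
Qed.

Lemma height_le1 : height_le 0 1.
Proof. by move=> i; rewrite rmorph1 normr1 oppr0 /pow2 expr0z lexx. Qed.

Lemma height_leN h u : height_le h u -> height_le h (- u).
Proof. by move=> hu i; rewrite rmorphN normrN. Qed.

Lemma height_leV h u : height_le h u -> height_le h u^-1.
Proof.
move=> hu i; have /andP[u1 u2] := hu i.
have u0 : 0 < `|phi i u| by apply: lt_le_trans u1; apply: pow2_gt0.
rewrite fmorphV normfV -{2}[h%:Z]opprK !pow2N.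
by apply/andP; split; rewrite lef_pV2 ?posrE ?invr_gt0 ?pow2_gt0 // -?pow2N.
Qed.

Lemma height_le_sqrt h u : height_le (h + h) (u ^+ 2) -> height_le h u.
Proof.
move=> hu i; have /andP[] := hu i.
rewrite rmorphXn normrX PoszD opprD !pow2D -!expr2.
by rewrite !ler_pXn2r ?nnegrE ?pow2_ge0 // => -> ->.
Qed.

Lemma height_cell h u : height_le h u -> exists k : 'I_n -> 'I_(h + h).+1,
  forall i, pow2 ((k i : nat)%:Z - h%:Z) <= `|phi i u| < pow2 ((k i : nat)%:Z - h%:Z + 1).
Proof.
move=> hu; suff cell i : exists k : 'I_(h + h).+1,
    pow2 ((k : nat)%:Z - h%:Z) <= `|phi i u| < pow2 ((k : nat)%:Z - h%:Z + 1).
  by have [k kP] := choice cell; exists k.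
have /andP[u1 u2] := hu i.
have ex : exists k : nat, pow2 (k%:Z - h%:Z) <= `|phi i u| by exists 0%N; rewrite sub0r.
have bnd k : pow2 (k%:Z - h%:Z) <= `|phi i u| -> (k <= h + h)%N.
  by move/le_trans/(_ u2); rewrite pow2_le; lia.
case: (ex_maxnP ex bnd) => k k1 maxk.
have ltk : (k < (h + h).+1)%N by rewrite ltnS bnd.
exists (Ordinal ltk); rewrite k1 /= real_ltNge ?normr_real ?ger0_real ?pow2_ge0 //.
apply/negP; have -> : k%:Z - h%:Z + 1 = k.+1%:Z - h%:Z by lia.
by move/maxk; rewrite ltnn.
Qed.

End Heights.

Section Counting.
Variables (K : fieldType) (S : embedding_system K).
Local Notation n := (deg S).
Local Notation phi := (emb (e := S)).
Local Notation height_le := (height_le S).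
Local Notation conj_emb := (@conj_emb K S).
Variable sigma : {rmorphism K -> K}.
Hypothesis sigmaK : forall x, sigma (sigma x) = x.
Hypothesis sigma_nontrivial : exists x, sigma x != x.
Hypothesis noconj : forall f : {rmorphism K -> algC}, ~ forall x, (f x)^* = f (sigma x).

Lemma emb_sigma i : exists j, forall x, phi j x = phi i (sigma x).
Proof.
have [j jE] := emb_complete S [the {rmorphism K -> algC} of phi i \o sigma].
by exists j => x; rewrite -jE.
Qed.
Definition sigma_emb i := sval (cid (emb_sigma i)).
Lemma sigma_embE i x : phi (sigma_emb i) x = phi i (sigma x).
Proof. exact: (svalP (cid (emb_sigma i))). Qed.

Lemma sigma_embK : involutive sigma_emb.
Proof. by move=> i; apply: (@emb_inj _ S); rewrite !sigma_embE sigmaK. Qed.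
Lemma conj_sigma_emb i : conj_emb (sigma_emb i) = sigma_emb (conj_emb i).
Proof. by apply: (@emb_inj _ S); rewrite sigma_embE !conj_embE sigma_embE. Qed.
Lemma sigma_emb_neq i : sigma_emb i <> i.
Proof.
have [x /eqP sx] := sigma_nontrivial => E; apply: sx.
by apply: (fmorph_inj (phi i)); rewrite -sigma_embE E.
Qed.
Lemma sigma_emb_neq_conj i : sigma_emb i <> conj_emb i.
Proof. by move=> E; apply: (noconj (f := phi i)) => x; rewrite -conj_embE -E sigma_embE. Qed.

Let m (i : 'I_n) : nat := minn i (conj_emb i).
Let m_cj i : m (conj_emb i) = m i. Proof. by rewrite /m conj_embK minnC. Qed.
Let m_inj i j : m i = m j -> j = i \/ j = conj_emb i.
Proof.
rewrite /m /minn; case: ifP => _; case: ifP => _ /val_inj E; [left|right|right|left];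
by [rewrite E | rewrite E conj_embK | rewrite E | apply: (inv_inj (@conj_embK _ S)); rewrite E].
Qed.

(** The group generated by complex conjugation and sigma acts freely on the
    embeddings of K, so two infinite places of K lie above each infinite place of F,
    and sigma permutes them. This predicate selects one of the two; the function m
    numbers the places of K. *)
Definition upper i := (m i < m (sigma_emb i))%N.

Lemma upper_conj i : upper (conj_emb i) = upper i.
Proof. by rewrite /upper -conj_sigma_emb !m_cj. Qed.
Lemma upper_sigma i : upper (sigma_emb i) = ~~ upper i.
Proof.
rewrite /upper sigma_embK -leqNgt [in RHS]leq_eqVlt; case: eqP => // E.
case: (m_inj E) => E'; first by case: (@sigma_emb_neq i).
by case: (@sigma_emb_neq_conj i); rewrite {2}E' conj_embK.
Qed.

(** The orbits of embeddings correspond to the infinite places of F, and the set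
    reps of representatives to these places. *)
Definition rep i :=
  let j := if upper i then i else sigma_emb i in
  if (j <= conj_emb j)%N then j else conj_emb j.

Lemma rep_conj i : rep (conj_emb i) = rep i.
Proof.
have sw (j k : 'I_n) : (if (j <= k)%N then j else k) = (if (k <= j)%N then k else j).
  by case: ltngtP => // /val_inj.
by rewrite /rep upper_conj; case: (upper i); rewrite -?conj_sigma_emb conj_embK sw.
Qed.
Lemma rep_sigma i : rep (sigma_emb i) = rep i.
Proof. by rewrite /rep upper_sigma sigma_embK; case: (upper i). Qed.
Lemma rep_orbit (Q : 'I_n -> Prop) i :
  Q i -> Q (conj_emb i) -> Q (sigma_emb i) -> Q (conj_emb (sigma_emb i)) -> Q (rep i).
Proof. by rewrite /rep => *; do 2!case: ifP. Qed.
Lemma rep_rep i : rep (rep i) = rep i.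
Proof. by apply: (rep_orbit (Q := fun j => rep j = rep i)); rewrite ?rep_conj ?rep_sigma ?rep_conj. Qed.
Lemma upper_rep i : upper (rep i).
Proof.
rewrite /rep; case: (boolP (upper i)) => pi; case: ifP => _; rewrite ?upper_conj ?upper_sigma //.
Qed.

Definition reps := [set rep i | i : 'I_n].
Definition rep0 := rep (Ordinal (deg_gt0 S)).
Lemma mem_reps i : rep i \in reps. Proof. exact: imset_f. Qed.
Lemma reps_id i : i \in reps -> rep i = i.
Proof. by case/imsetP => j _ ->; rewrite rep_rep. Qed.

(** Counts appear only through lower bounds; that there are finitely many units of
    bounded height is a separate fact (many_units_bounded). *)
Definition many_units (Q : K -> Prop) (h N : nat) := exists s : seq K,
  [/\ uniq s, (N <= size s)%N & forall u, u \in s -> [/\ Q u, int_unit u & height_le h u]].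

Definition fixed u := sigma u = u.
Definition norm1 u := u * sigma u = 1.

Lemma many_units_bounded Q h : exists M, forall N, many_units Q h N -> (N <= M)%N.
Proof.
have [M MP] := bounded_integers_finite S h; exists M => N [s [us Ns sP]].
apply: leq_trans Ns (MP s us _) => x xs; have [_ /and3P[_ xO _] hx] := sP x xs.
by split=> // i; have /andP[] := hx i.
Qed.

(** The units of norm one have rank at least #|reps|, the number of infinite places
    of F: unit_near provides units whose logarithms are prescribed above each place
    of F, up to sign, and u / sigma u is of norm one. *)
Lemma many_norm1_units : exists c, forall T, many_units norm1 (c * T.+1) (T.+1 ^ #|reps|).
Proof.
have [C CP] := unit_near S; pose C1 := (C + C).+1; have C1E : C1 = (C + C).+1 := erefl.
clearbody C1; exists (C1 + C1)%N => T.
pose w (t : {ffun 'I_n -> 'I_T.+1}) i : int :=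
  (if upper i then 1 else -1) * ((t (rep i) : nat) * C1)%N%:Z.
have wcj t i : w t (conj_emb i) = w t i by rewrite /w upper_conj rep_conj.
have wsj t i : w t (sigma_emb i) = - w t i.
  by rewrite /w upper_sigma rep_sigma; case: (upper i); rewrite /= ?mulN1r ?mul1r ?opprK.
have w0 t : \sum_i w t i = 0.
  have : \sum_i w t i = - \sum_i w t i.
    rewrite {1}(reindex_inj (can_inj sigma_embK)) /= -sumrN.
    by apply: eq_bigr => i _; rewrite wsj.
  lia.
have /choice[u uP] t : exists u, int_unit u /\
     forall i, pow2 (w t i - C%:Z) <= `|phi i u| <= pow2 (w t i + C%:Z).
  by have [u] := CP (w t) (wcj t) (w0 t); exists u.
(* u is large above the chosen place and small above its conjugate, as prescribed
   by t, and u / sigma u has norm one with the same behaviour. *)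
pose b t := u t / sigma (u t).
have bE t i : pow2 (w t i + w t i - (C + C)%N%:Z) <= `|phi i (b t)| <= pow2 (w t i + w t i + (C + C)%N%:Z).
  have [ut uw] := uP t; have /andP[a1 a2] := uw i; have /andP[b1 b2] := uw (sigma_emb i).
  have u0 : 0 < `|phi (sigma_emb i) (u t)| by apply: lt_le_trans b1; apply: pow2_gt0.
  rewrite /b fmorph_div -sigma_embE normrM normfV ler_pdivlMr // ler_pdivrMr //.
  rewrite wsj in b1 b2; apply/andP; split.
    apply: le_trans a1; apply: le_trans (ler_wpM2l (pow2_ge0 _) b2) _.
    by rewrite -pow2D pow2_le; lia.
  apply: le_trans a2 _; apply: le_trans (ler_wpM2l (pow2_ge0 _) b1).
  by rewrite -pow2D pow2_le; lia.
(* C1 exceeds twice the error made by unit_near, so that different t give different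
   units. *)
have gap (x y : nat) : (y * C1)%N%:Z + (y * C1)%N%:Z - (C + C)%N%:Z <=
    (x * C1)%N%:Z + (x * C1)%N%:Z + (C + C)%N%:Z -> (y <= x)%N.
  move=> le; rewrite leqNgt; apply/negP => lt; have := leq_mul lt (leqnn C1).
  by rewrite mulSn; move: (x * C1)%N (y * C1)%N le => p q; lia.
pose D := pffun_on (ord0 : 'I_T.+1) (mem reps) predT.
exists [seq b t | t <- enum D]; split.
- rewrite map_inj_in_uniq ?enum_uniq // => t t'; rewrite !mem_enum => Dt Dt' eqb.
  apply/ffunP => i; have [iR|niR] := boolP (i \in reps); last first.
    have off (f : {ffun 'I_n -> 'I_T.+1}) : f \in D -> f i = ord0.
      move=> /pffun_onP[/subsetP sub _]; apply/eqP; apply: contraNT niR => fi.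
      by apply: sub; rewrite inE.
    by rewrite !off.
  have wi f : w f i = (f i * C1)%N.
    by rewrite /w -{1}(reps_id iR) upper_rep mul1r (reps_id iR).
  have /andP[b1 b2] := bE t i; have /andP[b3 b4] := bE t' i.
  rewrite eqb in b1 b2; have := le_trans b1 b4; have := le_trans b3 b2.
  by rewrite !pow2_le !wi => /gap h1 /gap h2; apply/val_inj/eqP; rewrite eqn_leq h1 h2.
- by rewrite size_map -cardE card_pffun_on card_ord.
move=> _ /mapP[t _ ->]; have [ut _] := uP t; have /and3P[ut0 _ _] := ut.
split.
- by rewrite /norm1 /b fmorph_div sigmaK; field; rewrite ut0 fmorph_eq0.
- by rewrite int_unitM // int_unitV // int_unit_rmorph.
move=> i; have /andP[b1 b2] := bE t i.
have lew : (absz (w t i) <= T * C1)%N.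
  have := ltn_ord (t (rep i)); rewrite /w; case: (upper i); rewrite ?mul1r ?mulN1r ?abszN => ltT;
  by rewrite /= leq_mul2r -ltnS ltT orbT.
apply/andP; split; [apply: le_trans b1|apply: le_trans b2 _]; rewrite pow2_le; nia.
Qed.

Lemma fixed_abs_rep u i : fixed u -> `|phi (rep i) u| = `|phi i u|.
Proof.
move=> fu; apply: (rep_orbit (Q := fun j => `|phi j u| = `|phi i u|)) => //;
by rewrite ?conj_embE ?norm_conjC ?sigma_embE ?fu.
Qed.

(** The product of all absolute values of a unit is 1, which bounds the one at rep0 in
    terms of the others. *)
Lemma fixed_unit_bounded v : fixed v -> int_unit v ->
  (forall i, rep i != rep0 -> pow2 (-1) <= `|phi i v| <= pow2 1) -> forall i, `|phi i v| <= pow2 n.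
Proof.
move=> fv uv vb; have [v0 _ _] := and3P uv.
have nv := emb_norm_unit S uv; rewrite /emb_norm normr_prod in nv.
have rep0E i : rep i == rep0 -> `|phi i v| = `|phi rep0 v|.
  by move=> /eqP bi; rewrite -(fixed_abs_rep i fv) bi.
have b00 : rep rep0 == rep0 by rewrite /rep0 rep_rep.
suff bi0 : `|phi rep0 v| <= pow2 n.
  move=> i; have [/rep0E ->//|/vb/andP[_ h]] := boolP (rep i == rep0).
  by apply: le_trans h _; rewrite pow2_le lez_nat deg_gt0.
rewrite real_leNgt ?normr_real ?ger0_real ?pow2_ge0 //; apply/negP => gt.
suff : 1 < \prod_i `|phi i v| by rewrite nv ltxx.
have ge i : i != rep0 -> pow2 (-1) <= `|phi i v|.
  move=> _; have [/rep0E ->|/vb/andP[] //] := boolP (rep i == rep0).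
  by apply: ltW; apply: le_lt_trans gt; rewrite pow2_le.
have low : pow2 (- n%:Z) <= \prod_(i | i != rep0) `|phi i v|.
  apply: (@le_trans _ _ (pow2 (\sum_(i | i != rep0) -1))).
    rewrite pow2_le sumr_const mulNrn natz lerN2 lez_nat -[X in (_ <= X)%N](card_ord n).
    by apply: max_card.
  by rewrite pow2_sum; apply: ler_prod => i ni; rewrite pow2_ge0 ge.
rewrite (bigD1 rep0) //=; apply: lt_le_trans (ler_wpM2l (normr_ge0 _) low).
by rewrite pow2N ltr_pdivlMr ?pow2_gt0 // mul1r.
Qed.

(** The units of F have rank at most #|reps| - 1: a unit is determined up to finitely
    many by the rounded logarithms at all places but one. *)
Lemma few_fixed_units : exists M, forall h N, many_units fixed h N ->
  (N <= M * (h + h).+1 ^ (#|reps|.-1))%N.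
Proof.
have [M MP] := bounded_integers_finite S n.
exists M => h N [s [us Ns sP]]; apply: leq_trans Ns _.
pose reps' := reps :\ rep0.
have /choice[e eP] (u : K) : exists k : 'I_n -> 'I_(h + h).+1, height_le h u ->
    forall i, pow2 ((k i : nat)%:Z - h%:Z) <= `|phi i u| < pow2 ((k i : nat)%:Z - h%:Z + 1).
  have [hu|nhu] := EM (height_le h u); last by exists (fun=> ord0).
  by have [k kP] := height_cell hu; exists k.
pose key u : {ffun 'I_n -> 'I_(h + h).+1} := [ffun i => if i \in reps' then e u i else ord0].
pose D := pffun_on (ord0 : 'I_(h + h).+1) (mem reps') predT.
have -> : ((h + h).+1 ^ #|reps|.-1 = size (enum D))%N.
  rewrite -cardE card_pffun_on card_ord; congr (_ ^ _)%N.
  by rewrite (cardsD1 rep0 reps) mem_reps.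
apply: (fiber_bound (f := key)) => [u us'|k _].
  rewrite mem_enum; apply/pffun_onP; split; last by move=> i _.
  by apply/subsetP => i; rewrite inE ffunE; case: (boolP (i \in reps')); rewrite ?eqxx.
case: (posnP (size [seq x <- s | key x == k])) => [->//|]; rewrite -has_predT => /hasP[u0 + _].
rewrite mem_filter => /andP[/eqP ku0 u0s]; have [fu0 uu0 hu0] := sP u0 u0s.
have [u00 _ _] := and3P uu0.
rewrite -(size_map (fun u => u / u0)); apply: MP.
  by rewrite map_inj_uniq ?filter_uniq //; apply: mulIf; rewrite invr_eq0.
move=> w /mapP[u + ->]; rewrite mem_filter => /andP[/eqP ku us'] {w}.
have [fu uu hu] := sP u us'.
have uq : int_unit (u / u0) by rewrite int_unitM // int_unitV.
split; first by case/and3P: uq.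
apply: fixed_unit_bounded => // [|i bi]; first by rewrite /fixed fmorph_div fu fu0.
have fq : fixed (u / u0) by rewrite /fixed fmorph_div fu fu0.
rewrite -(fixed_abs_rep i fq); set j := rep i.
have jR : j \in reps' by rewrite !inE bi mem_reps.
have ej : e u j = e u0 j.
  by have := congr1 (fun f : {ffun _ -> _} => f j) (etrans ku (esym ku0)); rewrite !ffunE jR.
have /andP[a1 a2] := eP u hu j; have /andP[b1 b2] := eP u0 hu0 j; rewrite ej in a1 a2.
have p0 : 0 < `|phi j u0| by apply: lt_le_trans b1; apply: pow2_gt0.
rewrite fmorph_div normrM normfV ler_pdivlMr // ler_pdivrMr //; apply/andP; split.
  apply: le_trans a1; apply: le_trans (ler_wpM2l (pow2_ge0 _) (ltW b2)) _.
  by rewrite -pow2D pow2_le addrC addrK.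
apply: le_trans (ltW a2) _; apply: le_trans (ler_wpM2l (pow2_ge0 _) b1).
by rewrite -pow2D pow2_le addrC.
Qed.

Definition square_equiv (Q : K -> Prop) x y := exists e, [/\ Q e, int_unit e & x = y * e ^+ 2].

Lemma heights_bounded (s : seq K) : (forall x, x \in s -> int_unit x) ->
  exists C, forall x, x \in s -> height_le C x.
Proof.
elim: s => [|x s IHs] us; first by exists 0%N.
have [C CP] : exists C, forall x, x \in s -> height_le C x.
  by apply: IHs => y ys; apply: us; rewrite inE ys orbT.
have [x0 _ _] := and3P (us x (mem_head _ _)).
have [h hx] := exists_height S x0; exists (maxn C h) => y; rewrite inE => /predU1P[->|/CP].
  by apply: height_leW hx; rewrite leq_maxr.
by apply: height_leW; rewrite leq_maxl.
Qed.

(** Multiplying the squares of units of bounded height by inequivalent elements gives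
    distinct units, up to the sign of the square root. *)
Lemma fixed_units_step (s : seq K) C h N : uniq s ->
  (forall x, x \in s -> [/\ fixed x, int_unit x & height_le C x]) ->
  (forall x y, x \in s -> y \in s -> x <> y -> ~ square_equiv fixed x y) ->
  many_units fixed h N -> exists2 N', many_units fixed (C + (h + h)) N' & (size s * N <= 2 * N')%N.
Proof.
move=> us sP sE [t [ut Nt tP]].
pose p := [seq (x, y) | x <- s, y <- t]; pose f (xy : K * K) := xy.1 * xy.2 ^+ 2.
have mem_p x y : ((x, y) \in p) = (x \in s) && (y \in t).
  by rewrite /p; apply/allpairsP/andP => [[[x' y'] /= [xs yt [-> ->]]]|[xs yt]] //; exists (x, y).
exists (size (undup (map f p))).
  exists (undup (map f p)); split=> //; first exact: undup_uniq.
  move=> z; rewrite mem_undup => /mapP[[x y]]; rewrite mem_p => /andP[xs yt] ->.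
  have [fx ux hx] := sP x xs; have [fy uy hy] := tP y yt; rewrite /f /=; split.
  - by rewrite /fixed rmorphM rmorphXn fx fy.
  - by rewrite expr2 !int_unitM.
  by rewrite expr2; do 2!apply: height_leM => //.
apply: leq_trans (leq_mul (leqnn _) Nt) _.
have -> : (size s * size t)%N = size p by rewrite size_allpairs.
apply: (fiber_bound (f := f)) => [xy xyp|z _]; first by rewrite mem_undup map_f.
case: (posnP (size [seq q <- p | f q == z])) => [->//|]; rewrite -has_predT => /hasP[[x0 y0] + _].
rewrite mem_filter => /andP[/eqP fz]; rewrite mem_p => /andP[x0s y0t].
have [fx0 ux0 _] := sP _ x0s; have [fy0 uy0 _] := tP _ y0t.
have [x00 _ _] := and3P ux0; have [y00 _ _] := and3P uy0.
apply: (@leq_trans (size [:: (x0, y0); (x0, - y0)])) => //.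
apply: uniq_leq_size.
  by apply/filter_uniq/allpairs_uniq => // -[? ?] [? ?] _ _ [-> ->].
move=> [x y]; rewrite mem_filter => /andP[/eqP fxy]; rewrite mem_p => /andP[xs yt].
have [fx ux _] := sP _ xs; have [fy uy _] := tP _ yt.
have [x_0 _ _] := and3P ux; have [y_0 _ _] := and3P uy.
move: fxy; rewrite -fz /f /= => exy.
have xx0 : x = x0.
  apply: contrapT => nx; apply: (sE x x0 xs x0s nx); exists (y0 / y); split.
  - by rewrite /fixed fmorph_div fy fy0.
  - by rewrite int_unitM // int_unitV.
  by rewrite exprMn mulrA -exy exprVn mulfK // expf_neq0.
rewrite xx0 in exy *; move: (mulfI x00 exy) => /eqP; rewrite eqf_sqr !inE.
by case/orP => /eqP ->; rewrite eqxx ?orbT.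
Qed.

(** Each unit of norm one is a representative times the square of a unit of norm one
    of half the height; the two square roots are both counted, whence the factor 2. *)
Lemma norm1_units_step (s : seq K) C h N :
  (forall x, x \in s -> height_le C x) ->
  (forall b, norm1 b -> int_unit b -> exists2 x, x \in s & square_equiv norm1 b x) ->
  many_units norm1 (h + h) N -> exists2 N', many_units norm1 (C + h) N' & (2 * N <= size s * N')%N.
Proof.
move=> sC sE [t [ut Nt tP]].
have /choice[g gP] (b : K) : exists xy : K * K, norm1 b -> int_unit b ->
    [/\ xy.1 \in s, norm1 xy.2, int_unit xy.2 & b = xy.1 * xy.2 ^+ 2].
  have [[nb ub]|no] := EM (norm1 b /\ int_unit b); last by exists (0, 0) => nb ub; case: no.
  by have [x xs [y [ny uy E]]] := sE b nb ub; exists (x, y).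
pose f (bz : K * bool) := (-1) ^+ bz.2 * (g bz.1).2.
pose p := [seq (b, z) | b <- t, z <- [:: true; false]].
have mem_p b z : ((b, z) \in p) = (b \in t).
  rewrite /p; apply/allpairsP/idP => [[[b' z'] /= [bt _ [-> _]]]|bt] //.
  by exists (b, z); split=> //; case: z.
exists (size (undup (map f p))).
  exists (undup (map f p)); split=> //; first exact: undup_uniq.
  move=> y; rewrite mem_undup => /mapP[[b z]]; rewrite mem_p => bt ->; rewrite /f /=.
  have [nb ub hb] := tP b bt; have [xs ny uy E] := gP b nb ub.
  have hy : height_le (C + h) (g b).2.
    have x0 : (g b).1 != 0.
      by have [b0 _ _] := and3P ub; apply: contraNneq b0 => x0; rewrite E x0 mul0r.
    apply: height_le_sqrt; have -> : (g b).2 ^+ 2 = (g b).1^-1 * b by rewrite {3}E mulKf.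
    apply: (@height_leW _ _ (C + (h + h))); first by lia.
    by apply: height_leM => //; apply/height_leV/sC.
  case: z; rewrite /= ?expr0 ?expr1 ?mul1r ?mulN1r; split=> //.
  - by rewrite /norm1 rmorphN mulrNN.
  - by move: uy; rewrite /int_unit invrN oppr_eq0 !rpredN.
  exact: height_leN.
apply: leq_trans (leq_mul (leqnn 2) Nt) _.
have -> : (2 * size t)%N = size p by rewrite size_allpairs mulnC.
have -> : (size s * size (undup (map f p)))%N = size [seq (x, y) | x <- s, y <- undup (map f p)].
  by rewrite size_allpairs.
rewrite -(size_map (fun bz => ((g bz.1).1, f bz))); apply: uniq_leq_size; last first.
  move=> _ /mapP[[b z] bzp ->]; move: (bzp); rewrite mem_p => bt.
  have [nb ub hb] := tP b bt; have [xs ny uy E] := gP b nb ub.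
  by apply/allpairsP; exists ((g b).1, f (b, z)); split=> //=; rewrite mem_undup map_f.
rewrite map_inj_in_uniq.
  by apply: allpairs_uniq => // -[? ?] [? ?] _ _ [-> ->].
move=> [b z] [b' z']; rewrite !mem_p => bt bt' /= [e1 e2].
have [nb ub hb] := tP b bt; have [xs ny uy E] := gP b nb ub.
have [nb' ub' hb'] := tP b' bt'; have [xs' ny' uy' E'] := gP b' nb' ub'.
have ebb : b = b'.
  rewrite E E' e1; congr (_ * _); move: e2; rewrite /f /= => /(congr1 (fun u => u ^+ 2)).
  by rewrite !exprMn -!exprM !(mulnC _ 2) !exprM sqrrN expr1n !expr1n !mul1r.
subst b'; congr (_, _); move: e2; rewrite /f /=.
have [y0 _ _] := and3P uy.
have nz : (1 == -1 :> K) = false.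
  by rewrite -subr_eq0 opprK -[1 + 1]/(2%:R) pmulrn (intr_eq0_field S).
by move/(mulIf y0)/eqP; case: (z) (z') => -[] //=; rewrite expr0 expr1 ?(eq_sym (-1)) nz.
Qed.

Lemma many_units_weaken Q h k N : (h <= k)%N -> many_units Q h N -> many_units Q k N.
Proof.
move=> lehk [s [us Ns sP]]; exists s; split=> // u /sP[Qu uu hu]; split=> //.
exact: height_leW hu.
Qed.

Lemma int_unit1 : int_unit (1 : K).
Proof. by rewrite /int_unit oner_eq0 invr1 rpred1. Qed.

(** If d is the size of s, iterating fixed_units_step gives at least (d / 2)^k units of F
    of height C 2^k; by few_fixed_units their number is at most a constant times
    (2^k)^(#|reps| - 1). *)
Lemma fixed_units_mod_squares (s : seq K) : uniq s ->
  (forall x, x \in s -> fixed x /\ int_unit x) ->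
  (forall x y, x \in s -> y \in s -> x <> y -> ~ square_equiv fixed x y) ->
  (size s <= 2 ^ #|reps|)%N.
Proof.
move=> us sP sE; have [C sC] : exists C, forall x, x \in s -> height_le C x.
  by apply: heights_bounded => x /sP[].
have [M MP] := few_fixed_units.
have grow k : exists2 N, many_units fixed (C * (2 ^ k).-1) N & (size s ^ k <= 2 ^ k * N)%N.
  elim: k => [|k [N mN leN]].
    exists 1%N; rewrite ?muln0 //; exists [:: 1]; split=> // x; rewrite inE => /eqP ->.
    by split; [rewrite /fixed rmorph1 | exact: int_unit1 | exact: height_le1].
  have sP' x : x \in s -> [/\ fixed x, int_unit x & height_le C x].
    by move=> xs; have [] := sP x xs; split=> //; apply: sC.
  have [N' mN' leN'] := fixed_units_step us sP' sE mN.
  exists N'.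
    apply: many_units_weaken mN'; rewrite expnS; have := expn_gt0 2 k.
    case: (2 ^ k)%N => // e _; have -> : (2 * e.+1).-1 = (e + e).+1 by lia.
    by rewrite mulnS mulnDr.
  rewrite !expnS; apply: leq_trans (leq_mul (leqnn _) leN) _.
  by rewrite mulnCA -[X in (_ <= X)%N]mulnA [X in (_ <= X)%N]mulnCA leq_mul2l leN' orbT.
(* Writing #|reps| = r + 1, the size d of s satisfies d^k <= A (2^(r+1))^k for
   all k: when heights double, the number of units grows by a factor 2^r, and a
   factor 2 is lost to signs at each step. *)
have [r Dr] : exists r, #|reps| = r.+1 by exists #|reps|.-1; rewrite (cardD1 rep0) mem_reps.
rewrite Dr /= in MP *.
apply: (@exponential_growth_bound _ _ (M * (C + C).+1 ^ r)); first by rewrite expn_gt0.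
move=> k; have [N /MP leN le] := grow k; apply: leq_trans le _.
have -> : ((2 ^ r.+1) ^ k = 2 ^ k * (2 ^ k) ^ r)%N by rewrite expnAC expnS.
rewrite mulnCA leq_pmul2l ?expn_gt0 //; apply: leq_trans leN _.
rewrite -mulnA leq_mul2l -expnMn; apply/orP; right.
case: r {Dr MP} => // r; rewrite leq_exp2r // -mulnDl.
have := expn_gt0 2 k; case: (2 ^ k)%N => // e _.
by rewrite /= mulnS addSn ltnS (leq_trans _ (leq_addl _ _)) // leq_mul2r leqnSn orbT.
Qed.

(** Otherwise there are at most 2^#|reps| classes of units of norm one modulo squares.
    Iterating norm1_units_step then bounds the number of units of norm one of height
    2^k by a constant times (2^(#|reps| - 1))^k, against many_norm1_units. *)
Lemma norm_one_units_not_all_quotients :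
  ~ (forall eta, norm1 eta -> int_unit eta -> exists2 u, int_unit u & eta = u / sigma u).
Proof.
move=> H90.
have /choice[a aP] (b : K) : exists u, norm1 b -> int_unit b -> int_unit u /\ b = u / sigma u.
  have [[nb ub]|no] := EM (norm1 b /\ int_unit b); last by exists 0 => nb ub; case: no.
  by have [u uu E] := H90 b nb ub; exists u.
(* If b = u / sigma u, then u sigma u is a unit fixed by sigma, and b is a square
   of a norm-one unit when u sigma u is a square of a fixed unit. *)
pose nu b := a b * sigma (a b).
have nuP b : norm1 b -> int_unit b -> fixed (nu b) /\ int_unit (nu b).
  move=> nb ub; have [ua _] := aP b nb ub; split; last by rewrite int_unitM ?int_unit_rmorph.
  by rewrite /fixed /nu rmorphM sigmaK mulrC.
have nu_equiv x y : norm1 x -> int_unit x -> norm1 y -> int_unit y ->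
    square_equiv fixed (nu x) (nu y) -> square_equiv norm1 x y.
  move=> nx ux ny uy [e [fe ue E]]; have [uax Dx] := aP x nx ux; have [uay Dy] := aP y ny uy.
  have [e0 _ _] := and3P ue; have [x0 _ _] := and3P uax; have [y0 _ _] := and3P uay.
  have sx0 : sigma (a x) != 0 by rewrite fmorph_eq0.
  have sy0 : sigma (a y) != 0 by rewrite fmorph_eq0.
  pose g := a x / (a y * e).
  have sg : sigma g = sigma (a x) / (sigma (a y) * e) by rewrite /g fmorph_div rmorphM fe.
  have ng : g * sigma g = 1.
    rewrite sg /g; have -> : a x / (a y * e) * (sigma (a x) / (sigma (a y) * e)) = nu x / (nu y * e ^+ 2).
      by rewrite /nu; field; rewrite e0 y0 sy0.
    rewrite E mulfV // mulf_neq0 ?expf_neq0 // mulf_neq0 //.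
  have g0 : g != 0 by rewrite mulf_neq0 ?invr_eq0 ?mulf_neq0.
  exists g; split=> //; first by rewrite int_unitM // int_unitV // int_unitM.
  have sgV : sigma g = g^-1 by apply: (mulfI g0); rewrite ng mulfV.
  have -> : g ^+ 2 = g / sigma g by rewrite sgV invrK.
  by rewrite {1}Dx {1}Dy sg /g; field; rewrite e0 y0 sx0 sy0.
have bound (s : seq K) : uniq s -> (forall x, x \in s -> norm1 x /\ int_unit x) ->
    (forall x y, x \in s -> y \in s -> x <> y -> ~ square_equiv norm1 x y) ->
    (size s <= 2 ^ #|reps|)%N.
  move=> us sP sE; rewrite -(size_map nu).
  have lift x y : x \in s -> y \in s -> square_equiv fixed (nu x) (nu y) -> x = y.
    move=> xs ys E; apply: contrapT => nxy; have [[nx ux] [ny uy]] := (sP x xs, sP y ys).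
    by apply: (sE x y xs ys nxy); apply: nu_equiv.
  apply: fixed_units_mod_squares => [|x /mapP[y ys ->]|_ _ /mapP[x xs ->] /mapP[y ys ->] nxy E].
  - rewrite map_inj_in_uniq // => x y xs ys E; apply: lift => //; exists 1.
    by split; [rewrite /fixed rmorph1 | exact: int_unit1 | rewrite expr1n mulr1].
  - by have [ny uy] := sP y ys; apply: nuP.
  by apply: nxy; rewrite (lift x y).
have Esym x y : square_equiv norm1 x y -> square_equiv norm1 y x.
  move=> [e [ne ue ->]]; have [e0 _ _] := and3P ue; exists e^-1; split.
  - by rewrite /norm1 fmorphV -invfM ne invr1.
  - exact: int_unitV.
  by rewrite -mulrA -exprMn mulfV // expr1n mulr1.
have Erefl x : square_equiv norm1 x x.
  by exists 1; split; [rewrite /norm1 rmorph1 mulr1 | exact: int_unit1 | rewrite expr1n mulr1].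
have [s [szs sP sE]] := maximal_inequivalent bound Esym Erefl.
have [C sC] : exists C, forall x, x \in s -> height_le C x.
  by apply: heights_bounded => x /sP[].
have sE' b : norm1 b -> int_unit b -> exists2 x, x \in s & square_equiv norm1 b x.
  by move=> nb ub; apply: sE.
have [c cP] := many_norm1_units.
(* Each step halves the height and costs a factor 2^(#|reps| - 1). *)
have halve k N : many_units norm1 (c * 2 ^ k + (C + C)) N ->
    exists2 N', many_units norm1 (c + (C + C)) N' & (2 ^ k * N <= (2 ^ #|reps|) ^ k * N')%N.
  elim: k N => [|k IHk] N mN; first by exists N; rewrite ?expn0 ?muln1 // in mN *.
  have [|N1 mN1 le1] := @norm1_units_step s C (c * 2 ^ k + C) N sC sE'.
    by apply: many_units_weaken mN; rewrite expnS; lia.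
  have [|N2 mN2 le2] := IHk N1; first by apply: many_units_weaken mN1; lia.
  exists N2 => //; rewrite !expnS.
  apply: (@leq_trans (2 ^ k * (2 ^ #|reps| * N1))).
    rewrite -mulnA mulnCA leq_mul2l (leq_trans le1) ?orbT //.
    by rewrite leq_mul2r szs orbT.
  by rewrite mulnCA -mulnA leq_mul2l le2 orbT.
have [M MP] := many_units_bounded norm1 (c + (C + C)).
(* M bounds the number of units of norm one of the last height, and after M
   steps it is at least 2^M. *)
have [|N' /MP leN' le] := halve M ((2 ^ M) ^ #|reps|)%N.
  apply: (@many_units_weaken _ (c * 2 ^ M)); first by rewrite leq_addr.
  by have := cP (2 ^ M).-1; rewrite prednK // expn_gt0.
have : (2 ^ M <= N')%N.
  by move: le; rewrite (expnAC _ M) mulnC leq_pmul2l // !expn_gt0.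
by move/leq_trans/(_ leN'); rewrite leqNgt ltn_expl.
Qed.

End Counting.

(** * Everywhere unramified quadratic extensions *)

(** The hypotheses on embeddings and on a and x say that K/F is unramified at the
    infinite and at the finite places. *)
Theorem unramified_quadratic_class_number (F K : fieldType) (SF : embedding_system F)
    (SK : embedding_system K) (iota : {rmorphism F -> K}) (sigma : {rmorphism K -> K})
    (n : nat) (a x : 'I_n -> K) :
  (forall x, sigma (sigma x) = x) -> (forall y, sigma (iota y) = iota y) ->
  (forall x, sigma x = x -> exists y, x = iota y) -> (exists x, sigma x != x) ->
  (forall f : {rmorphism K -> algC}, ~ forall x, (f x)^* = f (sigma x)) ->
  (forall i, a i \in Oint) -> (forall i, x i \in Oint) ->
  1 = \sum_i a i * (x i - sigma (x i)) -> ~~ odd (class_number F).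
Proof.
move=> sK sI sF sN noconj aO xO et; apply/negP => oddh.
apply: (norm_one_units_not_all_quotients SK sK sN noconj) => eta n1 /and3P[_ etaO _].
exact: (norm_one_unit_is_quotient SF SK sK sI sF sN aO xO et oddh etaO n1).
Qed.

Lemma sum_of_products_concat (R : comNzRingType) (A B : R -> Prop) z z' :
  (exists n (u v : 'I_n -> R), [/\ forall i, A (u i), forall i, B (v i) & z = \sum_i u i * v i]) ->
  (exists n (u v : 'I_n -> R), [/\ forall i, A (u i), forall i, B (v i) & z' = \sum_i u i * v i]) ->
  exists n (u v : 'I_n -> R), [/\ forall i, A (u i), forall i, B (v i) & z + z' = \sum_i u i * v i].
Proof.
move=> [n [u [v [Au Bv ->]]]] [m [u' [v' [Au' Bv' ->]]]].
pose cat (f : 'I_n -> R) (g : 'I_m -> R) (i : 'I_(n + m)) :=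
  match split i with inl j => f j | inr j => g j end.
exists (n + m)%N, (cat u u'), (cat v v'); split=> [i|i|].
- by rewrite /cat; case: split.
- by rewrite /cat; case: split.
rewrite big_split_ord /cat; congr (_ + _); apply: eq_bigr => i _.
  by rewrite (unsplitK (inl i)).
by rewrite (unsplitK (inr i)).
Qed.

Lemma ideal_product_sum (F : fieldType) (A B : F -> Prop) z : ideal_product A B z ->
  exists n (u v : 'I_n -> F), [/\ forall i, A (u i), forall i, B (v i) & z = \sum_i u i * v i].
Proof.
move=> hz; apply: (hz (fun z => exists n (u v : 'I_n -> F),
  [/\ forall i, A (u i), forall i, B (v i) & z = \sum_i u i * v i])).
- by exists 0%N, (fun=> 0), (fun=> 0); split=> [[]|[]|]; rewrite ?big_ord0.
- by move=> x y; apply: sum_of_products_concat.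
by move=> u v Au Bv; exists 1%N, (fun=> u), (fun=> v); rewrite big_ord_recl big_ord0 addr0.
Qed.

Lemma int_ideal_generated (F : fieldType) (D : F -> Prop) : (forall d, D d -> d \in Oint) ->
  int_ideal (ideal_product (fun a => a \in Oint) D).
Proof.
move=> DO; split=> [z Jz||z z'|c z cO Jz].
- apply: (Jz (fun z => z \in Oint)); [exact: rpred0 | by move=> u v; exact: rpredD|].
  by move=> u v uO Dv; apply: rpredM => //; apply: DO.
- exact: ideal_product0.
- exact: ideal_productD.
apply: (Jz (fun z => ideal_product (fun a => a \in Oint) D (c * z))).
- by rewrite mulr0; exact: ideal_product0.
- by move=> u v; rewrite mulrDr; exact: ideal_productD.
by move=> u v uO Dv; rewrite mulrA; apply: ideal_productM => //; apply: rpredM.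
Qed.

Section Span.
Variable R : comNzRingType.
Implicit Types (S : set R) (x y : R).

Lemma ideal_spanD S x y : ideal_span S x -> ideal_span S y -> ideal_span S (x + y).
Proof.
move=> [n [a [s [Ss Dx]]]] [m [b [t [St Dy]]]].
have [k [u [v [_ Sv E]]]] := @sum_of_products_concat R (fun=> True) S x y
  (ex_intro _ n (ex_intro _ a (ex_intro _ s (And3 (fun=> I) Ss Dx))))
  (ex_intro _ m (ex_intro _ b (ex_intro _ t (And3 (fun=> I) St Dy)))).
by exists k, u, v.
Qed.

Lemma ideal_span_mul S c x : ideal_span S x -> ideal_span S (c * x).
Proof.
move=> [n [a [s [Ss ->]]]]; exists n, (fun i => c * a i), s; split=> //.
by rewrite mulr_sumr; apply: eq_bigr => i _; rewrite mulrA.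
Qed.

Lemma ideal_span_mem S x : S x -> ideal_span S x.
Proof. by move=> Sx; exists 1%N, (fun=> 1), (fun=> x); rewrite big_ord_recl big_ord0 addr0 mul1r. Qed.

Lemma ideal_span_sum S n (a s : 'I_n -> R) : (forall i, ideal_span S (s i)) ->
  ideal_span S (\sum_i a i * s i).
Proof.
move=> Ss; apply: (big_ind (ideal_span S)); last by move=> i _; apply: ideal_span_mul.
  by exists 0%N, (fun=> 0), (fun=> 0); split=> [[]|]; rewrite ?big_ord0.
exact: ideal_spanD.
Qed.

Lemma ideal_exp2 (I : set R) x y : I x -> I y -> ideal_exp I 2 (x * y).
Proof.
move=> Ix Iy; apply: ideal_span_mem; exists x => //; exists y => //.
by apply: ideal_span_mem; exists y => //; exists 1; rewrite ?mulr1.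
Qed.
End Span.

(** If every element of P lying in k were a sum of two products of elements of P,
    then the square of P would contain the ideal generated by the prime below P. *)
Lemma unramified_uniformizer (F : fieldType) (L : fieldExtType F) (k : {subfield L})
    (P : L -> Prop) : embedding_system L -> maximal_ideal P -> (exists2 a, P a & a != 0) ->
  unramified_finite k ->
  exists w, [/\ P w, w \in k & forall u v u' v', P u -> P v -> P u' -> P v' -> w <> u * v + u' * v'].
Proof.
move=> S MP [a Pa a0] unr; have [I PI] := maximal_prime_idealr MP.
have PO : forall x, P x -> x \in Oint by case: (MP) => [[PO _ _ _] _ _].
have inI x (xO : x \in Oint) : P x -> Integer xO \in I by move=> Px; rewrite PI; apply/asboolP.
have [|_ nsub] := unr I.
  exists (Integer (PO _ Pa)); first exact: inI.
  by rewrite -val_eqE.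
apply: contrapT => none; apply: nsub => _ [n [c [s [sP ->]]]].
apply: ideal_span_sum => i; have [sI sk] := sP i.
have Ps : P (integer_val (s i)) by move: sI; rewrite PI => /asboolP.
apply: contrapT => nsq; apply: none; exists (integer_val (s i)); split=> //.
move=> u v u' v' Pu Pv Pu' Pv' E; apply: nsq.
have -> : s i = Integer (PO _ Pu) * Integer (PO _ Pv) + Integer (PO _ Pu') * Integer (PO _ Pv').
  by apply: val_inj.
by apply: ideal_spanD; apply: ideal_exp2; apply: inI.
Qed.

(** If the differences x - sigma x generate a proper ideal of K, then its extension
    to L is proper, and sigma acts trivially modulo a prime of L containing it. *)
Lemma conjugate_differences_generate (K L : fieldType) (SK : embedding_system K)
    (SL : embedding_system L) (i : {rmorphism K -> L}) (sigma : {rmorphism K -> K}) :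
  (exists w, sigma w != w) ->
  (forall P : L -> Prop, maximal_ideal P -> (exists2 a, P a & a != 0) ->
     ~ forall w, w \in Oint -> P (i w - i (sigma w))) ->
  exists n (a x : 'I_n -> K), [/\ forall j, a j \in Oint, forall j, x j \in Oint &
    1 = \sum_j a j * (x j - sigma (x j))].
Proof.
move=> sigma_nontrivial no_inertia.
pose D (d : K) := exists2 x, x \in Oint & d = x - sigma x.
(* J is the ideal of K generated by the differences x - sigma x, and J' is its
   extension to L. *)
pose J := ideal_product (fun a : K => a \in Oint) D.
have IJ : int_ideal J.
  by apply: int_ideal_generated => _ [x xO ->]; rewrite rpredB ?Oint_rmorph.
suff /ideal_product_sum[n [a [d [aO Dd E]]]] : J 1.
  have /choice[x xP] l : exists x, x \in Oint /\ d l = x - sigma x.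
    by have [x] := Dd l; exists x.
  exists n, a, x; split=> [//|l|]; first by case: (xP l).
  by rewrite E; apply: eq_bigr => l _; case: (xP l) => _ ->.
apply: contrapT => J1.
pose D' (d : L) := exists2 j, J j & d = i j.
pose J' := ideal_product (fun a : L => a \in Oint) D'.
have IJ' : int_ideal J'.
  apply: int_ideal_generated => _ [x Jx ->]; rewrite (Oint_rmorph i).
  by case: IJ => JO _ _ _; apply: JO.
have J'1 : ~ J' 1.
  move=> /ideal_product_sum[n [a [d [aO Dd E]]]]; apply: J1.
  have /choice[j jP] l : exists j, J j /\ d l = i j by have [j] := Dd l; exists j.
  apply: (ideal_going_down SK (iota := i) (c := a) (j := j) IJ aO).
    by move=> l; case: (jP l).
  by rewrite E; apply: eq_bigr => l _; case: (jP l) => _ ->.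
have JJ' j : J j -> J' (i j).
  by move=> Jj; rewrite -[i j]mul1r; apply: ideal_productM; [exact: rpred1 | exists j].
have JD (x : K) : x \in Oint -> J (x - sigma x).
  by move=> xO; rewrite -[_ - _]mul1r; apply: ideal_productM; [exact: rpred1 | exists x].
have [a Ja a0] : exists2 a, J' a & a != 0.
  have [w sw] := sigma_nontrivial; have [m m0 mw] := exists_integral_multiple SK w.
  exists (i (m%:~R * w - sigma (m%:~R * w))); first by apply: JJ'; apply: JD; rewrite mw.
  rewrite fmorph_eq0 rmorphM rmorph_int -mulrBr mulf_neq0 //.
  by rewrite subr_eq0 eq_sym.
have [P MP JP] := exists_maximal_ideal SL IJ' Ja a0 J'1.
have P0 : exists2 a, P a & a != 0 by exists a; first exact: JP.
apply: (no_inertia P MP P0) => w wO.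
by apply: JP; rewrite -rmorphB; apply: JJ'; apply: JD.
Qed.

Section IntegersMap.
Variables (L : fieldType) (f : {rmorphism L -> L}).

(** Homomorphisms of fields restricted to the rings of integers, where reduction
    modulo a prime is defined. *)
Definition integers_map (z : integers L) : integers L :=
  Integer (etrans (Oint_rmorph f (integer_val z)) (integer_valP z)).

Lemma integers_map_zmod : zmod_morphism integers_map.
Proof. by move=> u v; apply: val_inj; rewrite /= rmorphB. Qed.
Lemma integers_map_monoid : monoid_morphism integers_map.
Proof. by split=> [|u v]; apply: val_inj; rewrite /= ?rmorph1 ?rmorphM. Qed.
HB.instance Definition _ := GRing.isZmodMorphism.Build _ _ integers_map integers_map_zmod.
HB.instance Definition _ := GRing.isMonoidMorphism.Build _ _ integers_map integers_map_monoid.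
End IntegersMap.

Section QuadraticSubextension.
Variables (F : fieldExtType rat) (L : splittingFieldType F) (k : {subfield L}).
Local Notation GL := (gal_of {:L}).
Local Notation G := 'Gal({:L} / 1%VS)%G.
Local Notation N := 'Gal({:L} / k)%G.

Lemma embedding_system_ext (E : fieldExtType F) : inhabited (embedding_system E).
Proof. exact: (embedding_system_rat (baseFieldType E)). Qed.

Lemma separable_ext (E : fieldExtType F) (M : {subfield E}) : separable M fullv.
Proof.
apply/separableP => u _; apply: pcharf0_separable => p.
by rewrite pchar_lalg pchar_lalg; exact: pchar_num.
Qed.

Lemma galois_1L : galois 1%AS {:L}.
Proof. by apply/and3P; split; [exact: sub1v | exact: separable_ext | exact: normalFieldf]. Qed.

Lemma galois_kL : galois k {:L}.
Proof. by apply: galoisS galois_1L; rewrite sub1v subvf. Qed.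

Lemma gal_ext (g h : GL) : (forall x, g x = h x) -> g = h.
Proof. by move=> gh; apply/eqP/gal_eqP => x _. Qed.

Lemma sub_NG : N \subset G. Proof. by apply: galS; apply: sub1v. Qed.

Lemma index_NG : (\dim k)%VS = 2%N -> (#|G : N|)%g = 2%N.
Proof.
move=> dk; have := Lagrange sub_NG.
rewrite -(galois_dim galois_1L) -(galois_dim galois_kL) dimv1 divn1 dk.
have d2 : (2 %| \dim {:L})%N by rewrite -dk field_dimS ?subvf.
rewrite -{2}(divnK d2) => /eqP; rewrite eqn_pmul2l => [/eqP //|].
by rewrite divn_gt0 // dvdn_leq // adim_gt0.
Qed.

Lemma fixed_by_G (a : L) : (forall g, g \in G -> g a = a) -> exists c : F, a = c%:A.
Proof.
move=> fa; have : a \in (1%VS : {vspace L}).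
  have /galois_fixedField <- := galois_1L.
  by apply/fixedFieldP; rewrite ?memvf.
by case/vlineP => c ->; exists c.
Qed.

(** There is a uniformizer in k, so it is fixed by tau, and integral multiples extend
    the conclusion from the ring of integers to L. *)
Lemma unramified_inertia (P : L -> Prop) (tau : GL) : maximal_ideal P -> (exists2 a, P a & a != 0) ->
  unramified_finite k -> tau \in N -> (forall x, x \in Oint -> P (tau x - x)) -> tau = 1%g.
Proof.
move=> MP P0 unr Ntau inert; have [S] := embedding_system_ext L.
have [w [Pw wk sqw]] := unramified_uniformizer S MP P0 unr.
have tw : tau w = w by apply: fixed_gal Ntau wk; apply: subvf.
have fixO := @unramified_inertia_trivial L S P MP tau w Pw tw sqw inert.
apply: gal_ext => x; rewrite gal_id.
have [m m0 mx] := exists_integral_multiple S x.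
by apply: (mulfI m0); rewrite -(fixO _ mx) rmorphM rmorph_int.
Qed.

(** * The fixed field of a subgroup containing all outer involutions *)

Variable H : {group GL}.
Hypotheses (sHG : H \subset G) (iH : (#|G : H|)%g = 2%N) (iN : (#|G : N|)%g = 2%N).
Hypothesis inH : forall g, g \in G -> g \notin N -> (g * g = 1)%g -> g \in H.
Hypothesis unr : unramified k.

Local Notation K := (fixedField_aspace H).
Local Notation KT := (subvs_of K).

Lemma galM1 (g h : GL) x : (g * h)%g x = h (g x). Proof. by rewrite galM ?memvf. Qed.

Lemma H_fixes_K (w : KT) h : h \in H -> h (vsval w) = vsval w.
Proof. by move=> Hh; have [_ ] := mem_fixedFieldP (subvsP w); apply. Qed.

Lemma fixed_by_H (a : L) : (forall h, h \in H -> h a = a) -> exists w : KT, a = vsval w.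
Proof.
move=> fa; have aK : a \in K by apply/fixedFieldP; rewrite ?memvf.
by exists (vsproj K a); rewrite vsprojK.
Qed.

Variable g : GL.
Hypotheses (Gg : g \in G) (nHg : g \notin H).

Lemma K_stable (w : KT) : g (vsval w) \in K.
Proof.
apply/fixedFieldP; rewrite ?memvf // => h Hh; rewrite -galM1.
have nHG : (g * h * g^-1)%g \in H.
  have nsHG : (H <| G)%g by apply: index2_normal.
  have [_ nHG] := andP nsHG.
  by rewrite -mulgA -{1}(invgK g) -conjgE memJ_norm // groupV (fintype.subsetP nHG).
have -> : (g * h = (g * h * g^-1) * g)%g by rewrite mulgKV.
by rewrite galM1 H_fixes_K.
Qed.

Definition sigma (w : KT) : KT := vsproj K (g (vsval w)).

Lemma sigmaE w : vsval (sigma w) = g (vsval w).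
Proof. by rewrite vsprojK // K_stable. Qed.

Lemma sigma_zmod : zmod_morphism sigma.
Proof. by move=> u v; apply: subvs_inj; rewrite sigmaE !rmorphB /= !sigmaE. Qed.
Lemma sigma_monoid : monoid_morphism sigma.
Proof.
by split=> [|u v]; apply: subvs_inj; rewrite sigmaE ?rmorph1 ?rmorphM //= ?rmorphM ?sigmaE.
Qed.
HB.instance Definition _ := GRing.isZmodMorphism.Build _ _ sigma sigma_zmod.
HB.instance Definition _ := GRing.isMonoidMorphism.Build _ _ sigma sigma_monoid.

Lemma two_cosets u : u \in G -> u \in H \/ exists2 h, h \in H & u = (h * g)%g.
Proof.
move=> Gu; have [Hu|nHu] := boolP (u \in H); [by left | right].
exists (u * g^-1)%g; last by rewrite mulgKV.
by rewrite (index2_mulg sHG iH Gu) ?groupV // (negPf nHu) (negPf nHg).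
Qed.

Lemma sigmaK w : sigma (sigma w) = w.
Proof.
apply: subvs_inj; rewrite !sigmaE -galM1 H_fixes_K //.
exact: (index2_sq sHG iH Gg).
Qed.

Lemma sigma_in_alg (c : F) : sigma c%:A = c%:A.
Proof.
have E : vsval (c%:A : KT) = c%:A by rewrite linearZ rmorph1.
by apply: subvs_inj; rewrite sigmaE E linearZ rmorph1.
Qed.

Lemma sigma_fixed w : sigma w = w -> exists c : F, w = c%:A.
Proof.
move=> fw; have [|c Dc] := @fixed_by_G (vsval w).
  move=> u /two_cosets[Hu|[h Hh ->]]; first exact: H_fixes_K.
  by rewrite galM1 H_fixes_K // -sigmaE fw.
by exists c; apply: subvs_inj; rewrite Dc linearZ rmorph1.
Qed.

Lemma sigma_nontrivial : exists w, sigma w != w.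
Proof.
apply: contrapT => none; move/negP: nHg; apply.
rewrite -(gal_fixedField H) gal_kHom ?subvf //.
apply/kAHomP => u uK; apply/eqP; apply: contrapT => /negP nu; apply: none.
exists (vsproj K u); apply/eqP => /(congr1 (@vsval _ _ K)).
by rewrite sigmaE vsprojK // => /eqP; apply/negP.
Qed.

(** A nontrivial element of an inertia group of L/F is an involution outside N. *)
Lemma inertia_in_H (P : L -> Prop) (tau : GL) : maximal_ideal P -> (exists2 a, P a & a != 0) ->
  tau \in G -> (forall x, x \in Oint -> P (tau x - x)) -> tau \in H.
Proof.
move=> MP P0 Gt inert; have [IP _ _] := MP; have [_ _ PD _] := IP.
(* tau^2 is in N and is in the inertia group as well, hence trivial. *)
have inert2 x : x \in Oint -> P ((tau * tau)%g x - x).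
  move=> xO; rewrite galM1; have -> : tau (tau x) - x = (tau (tau x) - tau x) + (tau x - x) by ring.
  by apply: PD; apply: inert; rewrite ?Oint_rmorph.
have t2 := unramified_inertia MP P0 unr.1 (index2_sq sub_NG iN Gt) inert2.
have [Nt|nNt] := boolP (tau \in N); last exact: inH.
by rewrite (unramified_inertia MP P0 unr.1 Nt inert) group1.
Qed.

(** If g acted trivially on K modulo P, then g and 1 would agree modulo P on the
    invariants of H, so that an element of the coset of g would be in the inertia
    group of P; inertia groups are contained in H. *)
Lemma no_inertia (P : L -> Prop) : maximal_ideal P -> (exists2 a, P a & a != 0) ->
  ~ forall w : KT, w \in Oint -> P (vsval w - vsval (sigma w)).
Proof.
move=> MP P0 cong; have [pi_k [pi piP]] := residue_field MP.
pose I : finType := {h : GL | h \in H}.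
pose s (i : I) := [the {rmorphism integers L -> integers L} of integers_map (val i : GL)].
have valE (f : {rmorphism L -> L}) z : integer_val (integers_map f z) = f (integer_val z) by [].
have [||z fz|i iE] := @integral_conjugates _ pi_k pi
    [the {rmorphism integers L -> pi_k} of pi \o integers_map g] I s (Sub 1%g (group1 H)).
- by move=> z; apply: val_inj; rewrite /= gal_id.
- move=> j; pose f (i : I) : I := Sub (val i * val j)%g (groupM (valP i) (valP j)).
  have f_inj : injective f by move=> i i' /(congr1 val) /mulIg/val_inj.
  by exists (perm f_inj) => i z; apply: val_inj; rewrite permE /= galM1.
- have [w Dw] : exists w : KT, integer_val z = vsval w.
    by apply: fixed_by_H => h Hh; have := fz (Sub h Hh) => /(congr1 (@integer_val _)).
  apply/eqP; rewrite -subr_eq0 -rmorphB piP; apply/asboolP.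
  rewrite -[integer_val _]/(\val _) rmorphB /= Dw -sigmaE; apply: cong.
  have := integer_valP z; rewrite Dw.
  by rewrite (Oint_rmorph [the {rmorphism KT -> L} of @vsval _ _ K]).
(* g and some h in H have the same effect modulo P, so h^-1 g is in the inertia
   group of P, although it is not in H. *)
pose h := val i; have Hh : h \in H := valP i.
have : (h^-1 * g)%g \in H.
  apply: inertia_in_H MP P0 _ _; first by rewrite groupM ?groupV // (fintype.subsetP sHG).
  move=> x xO; have xO' : h^-1%g x \in Oint by rewrite Oint_rmorph.
  have /eqP : pi (integers_map g (Integer xO')) = pi (integers_map (val i : GL) (Integer xO')).
    exact: iE.
  rewrite -subr_eq0 -rmorphB piP => /asboolP.
  rewrite -[integer_val _]/(\val _) rmorphB /= galM1.
  by rewrite -/h -(galM1 h^-1%g h) mulVg gal_id.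
by rewrite groupMl ?groupV // (negPf nHg).
Qed.

(** The field L is generated over K by one element, whose minimal polynomial has a
    complex root. *)
Lemma embedding_extends (f : {rmorphism KT -> algC}) :
  exists psi : {rmorphism L -> algC}, forall w : KT, psi (vsval w) = f w.
Proof.
pose L' : fieldExtType KT := fieldOver K.
have sep x : separable_element 1%AS (x : L').
  apply: pcharf0_separable => p; rewrite pchar_lalg pchar_lalg pchar_lalg; exact: pchar_num.
have sepL : separable 1%AS (fullv : {vspace L'}) by apply/separableP => x _; exact: sep.
have genL := eq_adjoin_separable_generator sepL (sub1v _).
set t := separable_generator _ _ in genL.
have [p min_p] : exists p : {poly KT}, minPoly 1 t = map_poly (in_alg L') p.
  by have /polyOver1P := minPolyOver 1 t.
have [z pz0] : exists z, root (map_poly f p) z.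
  apply/closed_rootP; rewrite size_map_poly -(size_map_poly (in_alg L')) -min_p.
  by rewrite size_minPoly.
have [psi [_ psiE]] := @rmorphism_extension KT L' algC f t z p (esym genL) min_p pz0.
pose psi' : {rmorphism L -> algC} := psi.
exists psi' => w; rewrite -psiE; congr (psi _).
by rewrite fieldOver_scaleE mulr1.
Qed.

(** Otherwise complex conjugation at an embedding of L above f would be given by an
    element h of G acting on K as g does. Then h is an involution outside H, hence is
    in N, and it is trivial because L/k is unramified at infinite places. *)
Lemma no_conjugation (f : {rmorphism KT -> algC}) :
  ~ forall w, (f w)^* = f (sigma w).
Proof.
move=> fconj; have [psi psiE] := embedding_extends f.
pose I : finType := {h : GL | h \in G}.
pose s (i : I) : {rmorphism L -> L} := (val i : GL).
have [||z fz|i iE] := @integral_conjugates _ algC psi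
    [the {rmorphism L -> algC} of Num.conj \o psi] I s (Sub 1%g (group1 G)).
- by move=> z; rewrite /= gal_id.
- move=> j; pose e (i : I) : I := Sub (val i * val j)%g (groupM (valP i) (valP j)).
  have e_inj : injective e by move=> i i' /(congr1 val) /mulIg/val_inj.
  by exists (perm e_inj) => i z; rewrite permE /= galM1.
- have [h Gh|c ->] := @fixed_by_G z; first exact: (fz (Sub h Gh)).
  have -> : c%:A = vsval (c%:A : KT) by rewrite linearZ rmorph1.
  rewrite -[RHS]/((psi (vsval (c%:A : KT)))^*) !psiE fconj.
  by congr (f _); rewrite sigma_in_alg.
(* h induces complex conjugation at psi, and is therefore an involution. *)
pose h : GL := val i; have Gh : h \in G := valP i.
have hE z : (psi z)^* = psi (h z) := iE z.
have h2 : (h * h)%g = 1%g.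
  by apply: gal_ext => z; rewrite galM1 gal_id; apply: (fmorph_inj psi); rewrite -!hE conjCK.
have nHh : h \notin H.
  apply/negP => Hh; have [w /eqP[]] := sigma_nontrivial; apply: (fmorph_inj f).
  by rewrite -fconj -psiE hE H_fixes_K.
have [Nh|nNh] := boolP (h \in N); last by move/negP: nHh; apply; apply: inH.
have real z : psi z \is Num.real.
  apply: unr.2 => x kx; apply/CrealP; rewrite hE; congr (psi _).
  by apply: fixed_gal Nh kx; apply: subvf.
move/negP: nHh; apply; suff -> : h = 1%g by apply: group1.
by apply: gal_ext => z; rewrite gal_id; apply: (fmorph_inj psi); rewrite -hE; apply/CrealP.
Qed.

(** The fixed field of H is a quadratic extension of F unramified at all places. *)
Lemma class_number_even : ~~ odd (class_number F).
Proof.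
have [SF] : inhabited (embedding_system F) := embedding_system_rat F.
have [SL] := embedding_system_ext L; have [SK] := embedding_system_ext KT.
have [n [a [x [aO xO E]]]] := @conjugate_differences_generate KT L SK SL
  [the {rmorphism KT -> L} of @vsval _ _ K] [the {rmorphism KT -> KT} of sigma]
  sigma_nontrivial no_inertia.
apply: (@unramified_quadratic_class_number F KT SF SK (in_alg KT)
  [the {rmorphism KT -> KT} of sigma] n a x) => //.
- exact: sigmaK.
- exact: sigma_in_alg.
- exact: sigma_fixed.
- exact: sigma_nontrivial.
exact: no_conjugation.
Qed.

End QuadraticSubextension.

Local Close Scope ring_scope.

Theorem proposition4 (F : fieldExtType rat) (L : splittingFieldType F)
    (k : {subfield L}) :
  odd (class_number F) ->
  ('Gal({:L} / 1%VS) \isog Hol [set: 'Z_8]%G)%g ->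
  (\dim k)%VS = 2 ->
  unramified k ->
  ('Gal({:L} / k) \isog 'SD_16)%g \/ ('Gal({:L} / k) \isog 'Mod_16)%g.
Proof.
move=> oddF isoG dk unr; have iN := index_NG dk; have sNG := sub_NG k.
set G := 'Gal({:L} / 1%VS)%G in iN sNG; set N := 'Gal({:L} / k)%G in iN sNG.
pose T := [set g in G | (g \notin N) && (g * g == 1)%g]%SET.
have sTG : T \subset G by apply/fintype.subsetP => g; rewrite inE => /andP[].
have [sGT|nsGT] := boolP (G \subset <<T>>%g).
  exact: (Hol_C8_index2 isoG sNG iN sGT).
have sTG' : (<<T>> \subset G)%g by rewrite gen_subG.
have [eqTG|[H maxH sTH]] := maximal_exists sTG'; first by rewrite -eqTG subxx in nsGT.
have pG : (2.-group G)%g.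
  by rewrite /pgroup (card_isog isoG : #|G| = _) card_Hol_C8.
have iH : (#|G : H|)%g = 2%N := p_maximal_index pG maxH.
have sHG : H \subset G by have /maxgroupp/andP[] := maxH.
have nsGH : ~~ (G \subset H) by have /maxgroupp/andP[] := maxH.
have [g Gg nHg] := fintype.subsetPn nsGH.
have inH h : h \in G -> h \notin N -> (h * h)%g = 1%g -> h \in H.
  move=> Gh nNh h2; apply: (fintype.subsetP sTH); apply: mem_gen.
  by rewrite inE Gh nNh h2 eqxx.
by have /negP[] := class_number_even sHG iH iN inH unr Gg nHg.
Qed.
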